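(* Let $\phi\in HS(L^2(\mathbb T);H^1(\mathbb T))$ be a convolution operator, $\widehat{\phi f}(n)=\phi_n\widehat f(n)$ with $\phi_n\in\mathbb R$. Then the stochastic KdV-Burgers equation $$du=(u_{xx}-u_{xxx}-(u^2)_x)\,dt+\phi\,\partial_x dW,\qquad u|_{t=0}=u_0,\qquad t\ge0,\ x\in\mathbb T,$$ is globally well-posed in $L^2(\mathbb T)$ for mean zero data. That is, if $u_0\in L^2(\mathbb T)$ has mean zero, then for any $T>0$ there is a unique process $u\in C([0,T];L^2(\mathbb T))$ satisfying the equation on $[0,T]$ almost surely.
   Context: $\mathbb T=\mathbb R/2\pi\mathbb Z$; $\widehat f(n)$ denotes the spatial Fourier coefficient and $\langle a\rangle=(1+|a|^2)^{1/2}$. Noise: $W(t,x)=\sum_{n\ne0}B_n(t)e^{inx}$, where $(B_n)_{n\ge1}$ are independent standard complex-valued Brownian motions on a filtered probability space $(\Omega,\mathcal F,(\mathcal F_t)_{t\ge0},\mathbb P)$ and $B_{-n}=\overline{B_n}$. All functions and the noise $\phi\,\partial_xdW$ are real-valued (so $\phi_{-n}=\phi_n$) with spatial mean zero. $HS(L^2;H^1)$ is the space of Hilbert-Schmidt operators from $L^2(\mathbb T)$ to $H^1(\mathbb T)$; for a convolution operator, $\|\phi\|_{HS(L^2;H^1)}=\big(\sum_n\langle n\rangle^{2}|\phi_n|^2\big)^{1/2}$. Solutions are pathwise mild solutions: with $\widehat{S(t)f}(n)=e^{-n^2|t|+in^3t}\widehat f(n)$, ''satisfying the equation on $[0,T]$''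 means $$u(t)=S(t)u_0-\int_0^tS(t-t')\partial_x(u^2(t'))\,dt'+\int_0^tS(t-t')\phi\,\partial_xdW(t'),\qquad t\in[0,T].$$ *)

(* Defs.v *)
From mathcomp Require Import all_boot all_order all_algebra.
From mathcomp Require Import complex.
From mathcomp Require Import all_classical all_reals all_analysis.

Set Implicit Arguments.
Unset Strict Implicit.
Unset Printing Implicit Defensive.

Import Order.TTheory GRing.Theory Num.Theory.
Import numFieldNormedType.Exports.

Local Open Scope classical_set_scope.
Local Open Scope ring_scope.
Local Open Scope complex_scope.

Section ComplexValued.
Context {R : realType}.

Definition cexp (z : R[i]) : R[i] :=
  (expR (complex.Re z))%:C * (cos (complex.Im z) +i* sin (complex.Im z)).

Definition normc2 (z : R[i]) : R := complex.Re z ^+ 2 + complex.Im z ^+ 2.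

Definition cRintegral d (X : measurableType d) (mu : {measure set X -> \bar R})
    (D : set X) (f : X -> R[i]) : R[i] :=
  (\int[mu]_(x in D) complex.Re (f x)) +i* (\int[mu]_(x in D) complex.Im (f x)).

End ComplexValued.

(* A function on the torus R/2piZ is represented by a function on R, of which
   only the restriction to [0, 2pi[ matters: torus is Lebesgue measure on R
   restricted to [0, 2pi[. *)
Section Torus.
Context (R : realType).

Definition torus : {measure set (measurableTypeR R) -> \bar R} :=
  mrestr (@lebesgue_measure R) (measurable_itv `[0, 2 * pi[).

Definition L2dist (f g : R -> R) : \bar R :=
  'N[torus]_2%:E[EFin \o (f \- g)].

Definition L2 : set (R -> R) := [set f | f \in Lfun torus 2%:E].

Definition L20 : set (R -> R) := [set f | L2 f /\ \int[torus]_x f x = 0].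

(* Normalised so that f = \sum_n fourier f n * e^{inx}. *)
Definition fourier (f : R -> R) (n : int) : R[i] :=
  ((2 * pi)^-1)%:C *
  cRintegral torus setT (fun x => (f x)%:C * cexp (0 -i* (n%:~R * x))).

End Torus.

(* Spatial operators, acting on sequences of Fourier coefficients. *)
Section FourierMultipliers.
Context {R : realType}.

Definition ddx (a : int -> R[i]) (n : int) : R[i] := 'i%C * n%:~R * a n.

Definition semigroup (t : R) (a : int -> R[i]) (n : int) : R[i] :=
  cexp (- (n%:~R ^+ 2 * `|t|) +i* (n%:~R ^+ 3 * t)) * a n.

Definition convop (phi : int -> R) (a : int -> R[i]) (n : int) : R[i] :=
  (phi n)%:C * a n.

(* The convolution operator phi is in HS(L2; H1). *)
Definition hilbert_schmidt_L2_H1 (phi : int -> R) : Prop :=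
  (\esum_(n in [set: int]) ((1 + n%:~R ^+ 2) * phi n ^+ 2)%:E < +oo)%E.

End FourierMultipliers.

Section Noise.
Context (R : realType) (d : measure_display) (Omega : measurableType d).
Variable P : probability Omega R.

Definition filtration (F : R -> set (set Omega)) : Prop :=
  [/\ forall t, 0 <= t -> sigma_algebra [set: Omega] (F t),
      forall t, 0 <= t -> F t `<=` measurable
    & forall s t, 0 <= s -> s <= t -> F s `<=` F t].

Definition increment (X : R -> Omega -> R) (s t : R) (w : Omega) : R :=
  X t w - X s w.

Definition brownian (F : R -> set (set Omega)) (X : R -> Omega -> R) : Prop :=
  [/\ forall t (D : set (measurableTypeR R)), 0 <= t -> measurable D ->
        F t (X t @^-1` D),
      {ae P, forall w, X 0 w = 0},
      {ae P, forall w, {within `[0, +oo[, continuous (fun t => X t w)}},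
      forall s t (D : set (measurableTypeR R)), 0 <= s -> s < t ->
        measurable D ->
        P (increment X s t @^-1` D) = normal_prob 0 (Num.sqrt (t - s)) D
    & forall s t A (D : set (measurableTypeR R)), 0 <= s -> s < t ->
        F s A -> measurable D ->
        P (A `&` increment X s t @^-1` D) =
        (P A * P (increment X s t @^-1` D))%E].

Definition sigma_process (X : R -> Omega -> R) : set (set Omega) :=
  <<s [set A | exists t (D : set (measurableTypeR R)),
         [/\ 0 <= t, measurable D & A = X t @^-1` D] ]>>.

Definition sigma_cprocess (B : R -> Omega -> R[i]) : set (set Omega) :=
  <<s sigma_process (fun t w => complex.Re (B t w)) `|`
      sigma_process (fun t w => complex.Im (B t w)) >>.

Definition mutually_independent (I : eqType) (J : set I)
    (G : I -> set (set Omega)) : Prop :=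
  forall (s : seq I) (A : I -> set Omega), uniq s ->
    (forall i, i \in s -> J i /\ G i (A i)) ->
    P (\big[setI/setT]_(i <- s) A i) = (\prod_(i <- s) P (A i))%E.

(* Convention: real and imaginary parts are independent standard real Brownian
   motions, so that E|B_t|^2 = 2t. *)
Definition complex_brownian (F : R -> set (set Omega))
    (B : R -> Omega -> R[i]) : Prop :=
  let part (b : bool) t w :=
    if b then complex.Re (B t w) else complex.Im (B t w) in
  (forall b, brownian F (part b)) /\
  mutually_independent [set: bool] (fun b => sigma_process (part b)).

(* Only the B n with n >= 1 are used. *)
Definition independent_complex_brownians (F : R -> set (set Omega))
    (B : nat -> R -> Omega -> R[i]) : Prop :=
  (forall n, (0 < n)%N -> complex_brownian F (B n)) /\
  mutually_independent [set n | (0 < n)%N] (fun n => sigma_cprocess (B n)).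

(* W(t, x) = \sum_(n <> 0) B_n(t) e^{inx} with B_{-n} = conj B_n, through its
   Fourier coefficients. *)
Definition noise (B : nat -> R -> Omega -> R[i]) (n : int) (t : R) (w : Omega)
    : R[i] :=
  match n with
  | Posz 0 => 0
  | Posz k => B k t w
  | Negz k => (B k.+1 t w)^*
  end.

(* Z = \int_0^t g dB for a continuous deterministic integrand g: the step
   functions equal to g (t k / m) on [t k / m, t (k + 1) / m[ converge to g in
   L2(0, t), so the Wiener integral of g is the limit in L2(Omega) of their
   integrals. *)
Definition is_wiener_integral (B : R -> Omega -> R[i]) (g : R -> R[i]) (t : R)
    (Z : Omega -> R[i]) : Prop :=
  let node (m k : nat) : R := t * k%:R / m.+1%:R in
  let riemann m w :=
    \sum_(k < m.+1) g (node m k) * (B (node m k.+1) w - B (node m k) w) in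
  [/\ measurable_fun [set: Omega] (fun w => complex.Re (Z w)),
      measurable_fun [set: Omega] (fun w => complex.Im (Z w))
    & (fun m => \int[P]_w (normc2 (riemann m w - Z w))%:E)%E @ \oo --> 0%E].

(* Processes with paths in C([0, T]; L2), of mean zero, whose value at each time
   is an L2-valued random variable; L2 being separable, its Borel sigma-algebra
   is generated by the open balls. *)
Definition CL20_process (T : R) (u : R -> Omega -> R -> R) : Prop :=
  [/\ forall t w, 0 <= t <= T -> L20 (u t w),
      forall w t, 0 <= t <= T ->
        (fun s => L2dist (u s w) (u t w)) @ within `[0, T] (nbhs t) --> 0%E
    & forall t g (r : R), 0 <= t <= T -> L2 g ->
        measurable [set w | (L2dist (u t w) g < r%:E)%E]].

(* Z(t) = \int_0^t S(t-t') phi d_x dW(t'), as a process with paths in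
   C([0, T]; L2). *)
Definition stochastic_convolution (phi : int -> R)
    (B : nat -> R -> Omega -> R[i]) (T : R) (Z : R -> Omega -> R -> R) : Prop :=
  CL20_process T Z /\
  forall t n, 0 <= t <= T ->
    is_wiener_integral (noise B n)
      (fun t' => semigroup (t - t') (convop phi (ddx (fun=> 1))) n) t
      (fun w => fourier (Z t w) n).

Definition mild_solution (phi : int -> R) (B : nat -> R -> Omega -> R[i])
    (T : R) (u0 : R -> R) (u : R -> Omega -> R -> R) : Prop :=
  CL20_process T u /\
  exists2 Z, stochastic_convolution phi B T Z &
    {ae P, forall w, forall t, 0 <= t <= T -> forall n,
      fourier (u t w) n =
        semigroup t (fourier u0) n
        - cRintegral (@lebesgue_measure R) `[0, t]
            (fun t' => semigroup (t - t')
               (ddx (fourier (fun x => u t' w x ^+ 2))) n)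
        + fourier (Z t w) n}.

Definition indistinguishable (T : R) (u v : R -> Omega -> R -> R) : Prop :=
  {ae P, forall w, forall t, 0 <= t <= T ->
    {ae torus R, forall x, u t w x = v t w x}}.

End Noise.

(* Main.v *)
Require Import Defs.
From HB Require Import structures.
From mathcomp Require Import all_boot all_order all_algebra.
From mathcomp Require Import complex.
From mathcomp Require Import all_classical all_reals all_analysis.
From mathcomp Require Import measurable_realfun zify ring lra.

(** Write the solution as [u = v + z], where [z] is the stochastic convolution, the solution of
    the linear equation with the given noise. Then [v] solves, for each outcome, an equation without
    noise, and the proof is pathwise once [z] is understood.

    Everything is done in the coordinates of the real trigonometric basis [trig] of the torus, which
    is total ([trig_total]); there the semigroup is a decaying rotation in the plane of the cosine and
    the sine of one frequency, and [mild_cpx] translates the complex Fourier form of the equation.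

    Local theory. The square of an [L2] function has bounded coordinates, and the Duhamel integral
    recovers the derivative: its coordinate at frequency [n] gains [n / (n ^ 2 + m ^ 2)] for the time
    weight [exp (m ^ 2 t)] ([duhamel_bdd]). This is square summable with a small sum for large [m], so
    the Duhamel map contracts on every time interval, as soon as the nonlinearity is made globally
    Lipschitz by the radial truncation [cut A] of [v]: [cutoff_solution_ex]. The same estimate gives
    the stability of the equation and the uniqueness of its paths, [stability] and [duhamel_uniq].

    Global bound. The integral of [v ^ 2 v'] vanishes, so the energy of [v] changes only through terms
    that contain [z]; in these the derivative of [v] is absorbed by the dissipation, and what remains
    is controlled by the square of the supremum norm of [z] times the energy. By Gronwall's lemma [v] is
    bounded on [[0, T]] in terms of the integral over time of the [H1] norm of [z]. The computation is made for
    Galerkin approximations, [galerkin_energy], and passes to the limit, [energy_bound]. The bound does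
    not depend on [A], hence for large [A] the truncation is inactive and [v] solves the equation
    itself. Measurability in the outcome is inherited from the Picard iterates ([mild_coords]).

    The stochastic convolution. The semigroup gains the derivative lost in the noise: the second
    moment of [n z_n] is of the order of [n ^ 2 phi_n ^ 2], which is summable since [phi] is
    Hilbert-Schmidt with values in [H1]. Integration by parts defines each coordinate as a continuous
    function of the Brownian path ([pathint]). Doob's inequality, which is elementary here because
    [rmax S - S] grows only by the new increment, and Abel summation bound its supremum over time
    ([conv_sup]); so the series of coordinates defines almost surely a continuous path in [L2] with
    finite [H1] norm in mean square over time: [conv_coord_ae_bound] and [convolution_ex].

    Two mild solutions have the same stochastic convolution up to a null set, since Wiener integrals
    are limits of the same Riemann sums ([convolution_unique]); uniqueness then follows path by path. *)

Set Implicit Arguments.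
Unset Strict Implicit.
Unset Printing Implicit Defensive.

Import Order.TTheory GRing.Theory Num.Theory.
Import numFieldNormedType.Exports.
Local Open Scope classical_set_scope.
Local Open Scope ring_scope.

(** * Square-integrable functions *)

Lemma cvg_sqr (R : realType) (I : Type) (F : set_system I) (FF : Filter F)
    (f : I -> R) (a : R) :
  f @ F --> a -> (fun x => f x ^+ 2) @ F --> a ^+ 2.
Proof. by move=> fa; rewrite expr2; under eq_fun do rewrite expr2; exact: cvgM. Qed.

Section SquareIntegrable.
Context d (T : measurableType d) (R : realType) (mu : {measure set T -> \bar R}).
Implicit Types f g h : T -> R.

(** Pointwise-defined functions are used throughout instead of classes modulo null sets, so that
    paths and random fields are plain functions; [ip] and [nrm] are the scalar product and the
    seminorm of [L2]. *)
Definition sqi f := measurable_fun setT f /\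
  mu.-integrable setT (EFin \o (fun x => f x ^+ 2)).

Definition ip f g : R := \int[mu]_x (f x * g x).

Definition nrm f : R := Num.sqrt (ip f f).

Lemma sqiM f g : sqi f -> sqi g -> mu.-integrable setT (EFin \o (fun x => f x * g x)).
Proof.
move=> [mf if2] [mg ig2].
apply: (@le_integrable _ _ _ mu setT measurableT _
    (fun x => (f x ^+ 2)%:E + (g x ^+ 2)%:E)%E) => //.
- exact/measurable_EFinP/measurable_funM.
- move=> x _ /=; rewrite lee_fin normrM.
  rewrite [X in _ <= X]ger0_norm ?addr_ge0 ?sqr_ge0//.
  have := sqr_ge0 (`|f x| - `|g x|); rewrite -(real_normK (num_real (f x))).
  rewrite -(real_normK (num_real (g x))).
  have := normr_ge0 (f x); have := normr_ge0 (g x); nra.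
- exact: (@integrableD _ _ _ mu setT measurableT _ _ if2 ig2).
Qed.

Lemma sqiD f g : sqi f -> sqi g -> sqi (fun x => f x + g x).
Proof.
move=> sf sg; split; first by apply: measurable_funD; [case: sf|case: sg].
have i1 := sqiM sf sg; case: sf => _ i2; case: sg => _ i3.
have := integrableD measurableT (integrableD measurableT i2 i3)
  (integrableZl measurableT 2 i1).
apply: eq_integrable => // x _ /=.
by rewrite -!EFinM -!EFinD; congr EFin; ring.
Qed.

Lemma sqiZ a f : sqi f -> sqi (fun x => a * f x).
Proof.
move=> [mf i1]; split; first by apply: measurable_funM.
have := integrableZl measurableT (a ^+ 2) i1.
by apply: eq_integrable => // x _ /=; rewrite -EFinM exprMn.
Qed.

Lemma sqiN f : sqi f -> sqi (fun x => - f x).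
Proof.
move=> /(@sqiZ (-1)); congr (sqi _); apply/funext => x; by rewrite mulN1r.
Qed.

Lemma sqiB f g : sqi f -> sqi g -> sqi (fun x => f x - g x).
Proof. by move=> sf sg; apply: sqiD => //; exact: sqiN. Qed.

Lemma sqi0 : sqi (fun=> 0).
Proof.
split; first exact: measurable_cst.
by apply: eq_integrable (integrable0 _ _) => // x _ /=; rewrite expr0n.
Qed.

Lemma sqi_sum (I : Type) (s : seq I) (F : I -> T -> R) :
  (forall i, sqi (F i)) -> sqi (fun x => \sum_(i <- s) F i x).
Proof.
move=> sF; elim: s => [|i s ih].
  by under eq_fun do rewrite big_nil; exact: sqi0.
by under eq_fun do rewrite big_cons; exact: sqiD.
Qed.

Lemma sqi_bddM f g (C : R) : sqi f -> measurable_fun setT g ->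
  (forall x, `|g x| <= C) -> sqi (fun x => f x * g x).
Proof.
move=> [mf i1] mg gC; split; first exact: measurable_funM.
have C0 (x : T) : 0 <= C by exact: le_trans (normr_ge0 _) (gC x).
apply: (le_integrable measurableT _ _ (integrableZl measurableT (C ^+ 2) i1)).
  by apply/measurable_EFinP/measurable_funX; exact: measurable_funM.
move=> x _ /=; rewrite lee_fin exprMn normrM (normrM (C ^+ 2)) mulrC.
rewrite !(ger0_norm (sqr_ge0 _)) ler_wpM2r ?sqr_ge0//.
rewrite -(real_normK (num_real (g x))).
by rewrite lerXn2r ?nnegrE ?(C0 x).
Qed.

Lemma ipC f g : ip f g = ip g f.
Proof. by rewrite /ip; apply: eq_Rintegral => x _; rewrite mulrC. Qed.

Lemma ipDl f g h : sqi f -> sqi g -> sqi h ->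
  ip (fun x => f x + g x) h = ip f h + ip g h.
Proof.
move=> sf sg sh; rewrite /ip; under eq_Rintegral do rewrite mulrDl.
by rewrite RintegralD//; exact: sqiM.
Qed.

Lemma ipZl a f h : sqi f -> sqi h -> ip (fun x => a * f x) h = a * ip f h.
Proof.
move=> sf sh; rewrite /ip; under eq_Rintegral do rewrite -mulrA.
by rewrite RintegralZl//; exact: sqiM.
Qed.

Lemma ipNl f h : sqi f -> sqi h -> ip (fun x => - f x) h = - ip f h.
Proof.
move=> sf sh; rewrite -mulN1r -ipZl//; congr (ip _ _).
by apply/funext => x; rewrite mulN1r.
Qed.

Lemma ipBl f g h : sqi f -> sqi g -> sqi h ->
  ip (fun x => f x - g x) h = ip f h - ip g h.
Proof. by move=> sf sg sh; rewrite ipDl ?ipNl//; exact: sqiN. Qed.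

Lemma ipDr f g h : sqi f -> sqi g -> sqi h ->
  ip h (fun x => f x + g x) = ip h f + ip h g.
Proof. by move=> *; rewrite ipC ipDl// !(ipC h). Qed.

Lemma ipZr a f h : sqi f -> sqi h -> ip h (fun x => a * f x) = a * ip h f.
Proof. by move=> *; rewrite ipC ipZl// !(ipC h). Qed.

Lemma ipBr f g h : sqi f -> sqi g -> sqi h ->
  ip h (fun x => f x - g x) = ip h f - ip h g.
Proof. by move=> *; rewrite ipC ipBl// !(ipC h). Qed.

Lemma ip0l h : ip (fun=> 0) h = 0.
Proof.
rewrite /ip; under eq_Rintegral do rewrite mul0r.
by rewrite /Rintegral integral0.
Qed.

Lemma ip_suml (I : Type) (s : seq I) (F : I -> T -> R) h :
  (forall i, sqi (F i)) -> sqi h ->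
  ip (fun x => \sum_(i <- s) F i x) h = \sum_(i <- s) ip (F i) h.
Proof.
move=> sF sh; elim: s => [|i s ih].
  by under eq_fun do rewrite big_nil; rewrite big_nil ip0l.
under eq_fun do rewrite big_cons.
by rewrite ipDl ?big_cons ?ih//; exact: sqi_sum.
Qed.

Lemma ip_sumr (I : Type) (s : seq I) (F : I -> T -> R) h :
  (forall i, sqi (F i)) -> sqi h ->
  ip h (fun x => \sum_(i <- s) F i x) = \sum_(i <- s) ip h (F i).
Proof.
by move=> sF sh; rewrite ipC ip_suml//; apply: eq_bigr => i _; rewrite ipC.
Qed.

Lemma ip_ge0 f : 0 <= ip f f.
Proof. by apply: Rintegral_ge0 => x _; rewrite -expr2 sqr_ge0. Qed.

Lemma nrm_ge0 f : 0 <= nrm f. Proof. exact: sqrtr_ge0. Qed.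

Lemma nrm2 f : nrm f ^+ 2 = ip f f.
Proof. by rewrite sqr_sqrtr ?ip_ge0. Qed.

Lemma cauchy_schwarz f g : sqi f -> sqi g -> `|ip f g| <= nrm f * nrm g.
Proof.
move=> sf sg.
have q t : 0 <= ip f f - 2 * t * ip f g + t ^+ 2 * ip g g.
  have := ip_ge0 (fun x => f x - t * g x).
  have st := sqiZ t sg.
  rewrite ipBl ?ipBr ?ipZl ?ipZr//; last exact: sqiB.
  by rewrite (ipC g f); congr (0 <= _); ring.
rewrite -ler_sqr ?nnegrE ?mulr_ge0 ?nrm_ge0// exprMn !nrm2 -normrX.
rewrite ger0_norm ?sqr_ge0//.
have := ip_ge0 g; rewrite le_eqVlt => /predU1P[g0|g0].
  rewrite -g0 mulr0; have [->|b0] := eqVneq (ip f g) 0; first by rewrite expr0n.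
  have := q ((ip f f + 1) / (2 * ip f g)).
  rewrite -g0 mulr0 addr0.
  rewrite [X in _ - X](_ : _ = ip f f + 1); last by field.
  lra.
have := q (ip f g / ip g g).
rewrite [X in _ + X](_ : _ = ip f g ^+ 2 / ip g g); last by field; rewrite gt_eqF.
rewrite [X in _ - X](_ : _ = 2 * (ip f g ^+ 2 / ip g g)); last by field; rewrite gt_eqF.
move=> h; rewrite -ler_pdivrMr//; lra.
Qed.

Lemma ler_nrmD f g : sqi f -> sqi g -> nrm (fun x => f x + g x) <= nrm f + nrm g.
Proof.
move=> sf sg; rewrite -ler_sqr ?nnegrE ?addr_ge0 ?nrm_ge0//.
have sfg := sqiD sf sg.
rewrite nrm2 ipDl ?ipDr// sqrrD !nrm2 (ipC g f).
have := ler_norm (ip f g); have := cauchy_schwarz sf sg; lra.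
Qed.

Lemma nrmZ a f : sqi f -> nrm (fun x => a * f x) = `|a| * nrm f.
Proof.
move=> sf; rewrite /nrm ipZl ?ipZr//; last exact: sqiZ.
by rewrite mulrA -expr2 sqrtrM ?sqr_ge0// sqrtr_sqr.
Qed.

Lemma nrmN f : sqi f -> nrm (fun x => - f x) = nrm f.
Proof.
move=> sf; rewrite -[RHS]mul1r -normr1 -normrN -nrmZ//.
by congr nrm; apply/funext => x; rewrite mulN1r.
Qed.

Lemma nrm0 : nrm (fun=> 0) = 0.
Proof. by rewrite /nrm ip0l sqrtr0. Qed.

Lemma nrm_distC f g : sqi f -> sqi g ->
  nrm (fun x => f x - g x) = nrm (fun x => g x - f x).
Proof.
move=> sf sg; rewrite -nrmN; last exact: sqiB.
by congr nrm; apply/funext => x; rewrite opprB.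
Qed.

Lemma nrm_tri f g h : sqi f -> sqi g -> sqi h ->
  nrm (fun x => f x - h x) <= nrm (fun x => f x - g x) + nrm (fun x => g x - h x).
Proof.
move=> sf sg sh; apply: le_trans (ler_nrmD (sqiB sf sg) (sqiB sg sh)).
by rewrite le_eqVlt; apply/orP; left; apply/eqP; congr nrm; apply/funext => x; ring.
Qed.

Lemma ler_dist_nrm f g : sqi f -> sqi g ->
  `|nrm f - nrm g| <= nrm (fun x => f x - g x).
Proof.
move=> sf sg; rewrite ler_norml; apply/andP; split.
  have := ler_nrmD (sqiB sg sf) sf; rewrite (nrm_distC sg sf).
  by under eq_fun do rewrite subrK; lra.
have := ler_nrmD (sqiB sf sg) sg.
by under eq_fun do rewrite subrK; lra.
Qed.

Lemma ip_intE f : sqi f -> (\int[mu]_x ((f x) ^+ 2)%:E = (ip f f)%:E)%E.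
Proof.
move=> [mf i1]; rewrite /ip /Rintegral fineK.
  by apply: eq_integral => x _; rewrite expr2.
have := integrable_fin_num measurableT i1.
by congr (_ \is a fin_num); apply: eq_integral => x _ /=; rewrite expr2.
Qed.

Lemma sqi_intP f : measurable_fun setT f ->
  (\int[mu]_x ((f x) ^+ 2)%:E < +oo)%E -> sqi f.
Proof.
move=> mf h; split=> //; apply/integrableP; split.
  by apply/measurable_EFinP; exact: measurable_funX.
apply: le_lt_trans h; rewrite le_eqVlt; apply/orP; left; apply/eqP.
by apply: eq_integral => x _ /=; rewrite ger0_norm// sqr_ge0.
Qed.

Lemma nrm_eq0 f : sqi f -> nrm f = 0 -> {ae mu, forall x, f x = 0}.
Proof.
move=> sf f0; have := ip_intE sf.
have -> : ip f f = 0 by rewrite -nrm2 f0 expr0n.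
move=> h.
have mf2 : measurable_fun setT (EFin \o (fun x => f x ^+ 2)).
  by apply/measurable_EFinP; apply: measurable_funX; case: sf.
have [+ _] := ae_eq_integral_abs mu measurableT mf2; case.
  rewrite -[RHS]h; apply: eq_integral => x _ /=; by rewrite ger0_norm// sqr_ge0.
move=> N [mN N0 sN]; exists N; split => // x /= fx; apply: sN => /= H; apply: fx.
by have /eqP := H I; rewrite eqe sqrf_eq0 => /eqP.
Qed.

Lemma ip_ae f f' g : sqi f -> sqi f' -> sqi g ->
  {ae mu, forall x, f x = f' x} -> ip f g = ip f' g.
Proof.
move=> sf sf' sg ff'; rewrite /ip /Rintegral; congr fine.
apply: ae_eq_integral => //.
- by case: sf => ? _; case: sg => ? _; exact/measurable_EFinP/measurable_funM.
- by case: sf' => ? _; case: sg => ? _; exact/measurable_EFinP/measurable_funM.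
- by apply: filterS ff' => x /= -> _.
Qed.

(** The series of [2 ^ n |f_(n+1) - f_n| ^ 2] has a finite integral, so almost everywhere it
    converges, and with it the telescoping series, as [|a| <= 2 ^- n + 2 ^ n a ^ 2]; Fatou's lemma
    bounds the distance to the pointwise limit. *)
Lemma sqi_complete (f : nat -> T -> R) (C : R) : 0 < C -> (forall n, sqi (f n)) ->
  (forall n, nrm (fun x => f n.+1 x - f n x) <= C * 2^-1 ^+ n) ->
  exists2 g, sqi g & forall n, nrm (fun x => g x - f n x) <= 2 * C * 2^-1 ^+ n.
Proof.
move=> C0 sf df.
have h0 n : 0 < 2^-1 ^+ n :> R by rewrite exprn_gt0// invr_gt0.
have tail n m : nrm (fun x => f (n + m)%N x - f n x) <= 2 * C * (2^-1 ^+ n - 2^-1 ^+ (n + m)).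
  elim: m => [|m ih].
    rewrite addn0; under eq_fun do rewrite subrr; by rewrite nrm0 subrr mulr0.
  apply: le_trans (nrm_tri (sf _) (sf (n + m)%N) (sf _)) _.
  rewrite addnS; have := df (n + m)%N; rewrite exprS => /lerD/(_ ih)/le_trans; apply.
  by set a := _ ^+ (n + m); rewrite le_eqVlt; apply/orP; left; apply/eqP; field.
have hp n : 0 <= 2 * C * 2^-1 ^+ n by rewrite !mulr_ge0// ltW.
pose D n x : \bar R := (2 ^+ n * (f n.+1 x - f n x) ^+ 2)%:E.
have mD n : measurable_fun setT (D n).
  apply/measurable_EFinP; apply: measurable_funM => //.
  by apply: measurable_funX; case: (sqiB (sf n.+1) (sf n)).
have D0 n x : (0 <= D n x)%E by rewrite lee_fin mulr_ge0 ?sqr_ge0// exprn_ge0.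
have iD n : (\int[mu]_x D n x <= (C ^+ 2 * 2^-1 ^+ n)%:E)%E.
  rewrite /D; under eq_integral do rewrite EFinM.
  rewrite ge0_integralZl//; last 2 first.
  - by apply/measurable_EFinP/measurable_funX; case: (sqiB (sf n.+1) (sf n)).
  - by move=> x _; rewrite lee_fin sqr_ge0.
  rewrite ip_intE; last exact: sqiB.
  rewrite -EFinM lee_fin -nrm2.
  have : nrm (fun x => f n.+1 x - f n x) ^+ 2 <= (C * 2^-1 ^+ n) ^+ 2.
    by rewrite lerXn2r ?nnegrE ?nrm_ge0 ?mulr_ge0// ltW.
  set y := nrm _ ^+ 2 => yle; have p0 : 0 < 2 ^+ n :> R by rewrite exprn_gt0.
  rewrite -ler_pdivlMl//; apply: le_trans yle _.
  by rewrite -exprVn le_eqVlt; apply/orP; left; apply/eqP; ring.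
have sD : (\int[mu]_x (\sum_(0 <= n <oo) D n x) < +oo)%E.
  rewrite integral_nneseries//.
  apply: (@le_lt_trans _ _ (\sum_(0 <= n <oo) (C ^+ 2 * 2^-1 ^+ n)%:E)%E).
    by apply: lee_nneseries => // n _ _; exact: integral_ge0.
  have /cvg_lim : series (geometric (C ^+ 2) (2^-1 : R)) @ \oo --> C ^+ 2 * (1 - 2^-1)^-1.
    apply: cvg_geometric_series; rewrite ger0_norm ?invr_ge0//.
    by rewrite invf_lt1// ltr1n.
  move=> lg; have cg : cvgn (series (geometric (C ^+ 2) (2^-1 : R))).
    by apply: is_cvg_geometric_series; rewrite ger0_norm ?invr_ge0// invf_lt1// ltr1n.
  have -> : (\sum_(0 <= n <oo) (C ^+ 2 * 2^-1 ^+ n)%:E)%E =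
     (limn (series (geometric (C ^+ 2) (2^-1 : R))))%:E.
    rewrite -EFin_lim//; congr (limn _); apply/funext => n /=.
    by rewrite sumEFin.
  by rewrite ltry.
have aeD : {ae mu, forall x, (\sum_(0 <= n <oo) D n x < +oo)%E}.
  have : mu.-integrable setT (fun x => \sum_(0 <= n <oo) D n x)%E.
    apply/integrableP; split; first by apply: ge0_emeasurable_sum.
    apply: le_lt_trans sD; rewrite le_eqVlt; apply/orP; left; apply/eqP.
    by apply: eq_integral => x _ /=; rewrite gee0_abs//; exact: nneseries_ge0.
  move=> /(integrable_ae measurableT); apply: filterS => x /(_ I).
  by rewrite ge0_fin_numE//; exact: nneseries_ge0.
pose G := [set x | (\sum_(0 <= n <oo) D n x < +oo)%E].
have mG : measurable G.
  have := emeasurable_fun_infty_o measurableT (ge0_emeasurable_sum (P := xpredT) (fun k x _ _ => D0 k x) (fun k _ => mD k)) +oo%E.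
  by rewrite setTI.
have cG x : G x -> cvgn (f ^~ x).
  move=> Gx.
  have cs : cvgn (series (fun n => f n.+1 x - f n x)).
    apply: normed_cvg.
    apply: (@series_le_cvg _ _ (fun n => 2^-1 ^+ n + 2 ^+ n * (f n.+1 x - f n x) ^+ 2)).
    - by move=> n; exact: normr_ge0.
    - by move=> n; apply: addr_ge0; rewrite ?(ltW (h0 n))// mulr_ge0 ?sqr_ge0// exprn_ge0.
    - move=> n; set y := f _ _ - _; have := sqr_ge0 (1 - 2 ^+ n * `|y|).
      have p0 : 0 < 2 ^+ n :> R by rewrite exprn_gt0.
      rewrite -(real_normK (num_real y)) sqrrB expr1n mul1r => q.
      rewrite -(ler_pM2l p0) mulrDr -exprMn divff// expr1n.
      rewrite /= -/y; have := mulr_ge0 (ltW p0) (normr_ge0 y); nra.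
    - rewrite (_ : series _ = series (geometric 1 (2^-1 : R)) \+
          series (fun n => 2 ^+ n * (f n.+1 x - f n x) ^+ 2)); last first.
        apply/funext => n; rewrite /= /series /= -big_split/=.
        by apply: eq_bigr => i _; rewrite mul1r.
      apply: is_cvgD.
        by apply: is_cvg_geometric_series; rewrite ger0_norm ?invr_ge0// invf_lt1// ltr1n.
      apply: nondecreasing_is_cvgn.
        apply: nondecreasing_series => n _ _.
        by rewrite mulr_ge0 ?sqr_ge0// exprn_ge0.
      exists (fine (\sum_(0 <= n <oo) D n x)%E) => _ [n _ <-] /=.
      rewrite -lee_fin fineK ?ge0_fin_numE//; last exact: nneseries_ge0.
      by rewrite /series/= -sumEFin; exact: (@nneseries_lim_ge _ (D^~ x) xpredT 0%N n (fun k _ _ => D0 k x)).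
  have -> : f^~ x = (fun n => f 0%N x + series (fun n => f n.+1 x - f n x) n).
    apply/funext => n; rewrite /series/= telescope_sumr//.
    by rewrite addrC subrK.
  by apply: is_cvgD => //; exact: is_cvg_cst.
pose fG n x := f n x * \1_G x.
pose g x : R := limn (fG ^~ x).
have cfG x : fG ^~ x @ \oo --> g x.
  rewrite /g; have [Gx|nGx] := pselect (G x).
    rewrite (_ : fG ^~ x = f ^~ x); first exact: cG.
    by apply/funext => n; rewrite /fG indicE mem_set// mulr1.
  rewrite (_ : fG ^~ x = cst 0); first by rewrite lim_cst//; exact: cvg_cst.
  by apply/funext => n; rewrite /fG indicE memNset// mulr0.
have mfG n : measurable_fun setT (fG n).
  by apply: measurable_funM; [case: (sf n)|exact: measurable_indic].
have mg : measurable_fun setT g.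
  by apply: (measurable_fun_cvg mfG) => x _; exact: cfG.
have sfG n : sqi (fG n).
  apply: (@sqi_bddM _ _ 1) => //.
  by move=> x; rewrite indicE; case: (x \in G); rewrite ?normr1 ?normr0 ?ler01.
have key n : (\int[mu]_x ((g x - fG n x) ^+ 2)%:E <= ((2 * C * 2^-1 ^+ n) ^+ 2)%:E)%E.
  have -> : (\int[mu]_x ((g x - fG n x) ^+ 2)%:E =
     \int[mu]_x limn_einf (fun m => ((fG (n + m)%N x - fG n x) ^+ 2)%:E))%E.
    apply: eq_integral => x _.
    have cc : ((fG (n + m)%N x - fG n x) ^+ 2)%:E @[m --> \oo] --> ((g x - fG n x) ^+ 2)%:E.
      apply: cvg_EFin; first by apply: nearW.
      apply: cvg_sqr; apply: cvgB; last exact: cvg_cst.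
      under [X in X @ _ --> _]eq_fun do rewrite addnC.
      by have := cfG x; rewrite -(cvg_shiftn n).
    have [-> _] := cvg_limn_einf_sup cc; by [].
  apply: le_trans (fatou _ _ _ _) _ => //.
  - move=> m; apply/measurable_EFinP/measurable_funX; apply: measurable_funB => //.
  - by move=> m x _; rewrite lee_fin sqr_ge0.
  rewrite limn_einf_lim; apply: lime_le; first exact: is_cvg_einfs.
  apply: nearW => m; apply: (@le_trans _ _ (\int[mu]_x ((fG (n + m)%N x - fG n x) ^+ 2)%:E)%E).
    by apply: ereal_inf_lbound; exists m => /=.
  rewrite (@le_trans _ _ (\int[mu]_x ((f (n + m)%N x - f n x) ^+ 2)%:E)%E)//.
    apply: ge0_le_integral => //.
    - by move=> x _; rewrite lee_fin sqr_ge0.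
    - by apply/measurable_EFinP/measurable_funX/measurable_funB.
    - by apply/measurable_EFinP/measurable_funX; case: (sqiB (sf (n + m)%N) (sf n)).
    - move=> x _; rewrite lee_fin /fG -mulrBl exprMn ler_piMr ?sqr_ge0//.
  rewrite ip_intE ?lee_fin -?nrm2; last exact: sqiB.
  rewrite lerXn2r ?nnegrE ?nrm_ge0 ?hp//.
  apply: le_trans (tail n m) _; rewrite ler_pM2l ?mulr_gt0//.
  by rewrite gerBl ltW.
have sg : sqi g.
  rewrite (_ : g = fun x => (g x - fG 0%N x) + fG 0%N x); last first.
    by apply/funext => x; rewrite subrK.
  apply: sqiD => //; apply: sqi_intP; first exact: measurable_funB.
  by apply: le_lt_trans (key 0%N) _; rewrite ltry.
have fGf n : {ae mu, forall x, fG n x = f n x}.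
  by apply: filterS aeD => x Gx; rewrite /fG indicE mem_set// mulr1.
exists g => // n.
rewrite -ler_sqr ?nnegrE ?nrm_ge0 ?hp//.
have sgn := sqiB sg (sfG n); have sgn' := sqiB sg (sf n).
have ae1 : {ae mu, forall x, g x - f n x = g x - fG n x}.
  by apply: filterS (fGf n) => x ->.
rewrite nrm2 (ip_ae sgn' sgn sgn' ae1) ipC (ip_ae sgn' sgn sgn ae1).
by rewrite -lee_fin -ip_intE.
Qed.


End SquareIntegrable.

Section OrthonormalBasis.
Context d (T : measurableType d) (R : realType) (mu : {measure set T -> \bar R}).
Variable e : nat -> T -> R.
Hypothesis sqie : forall k, sqi mu (e k).
Hypothesis orthe : forall i j, ip mu (e i) (e j) = (i == j)%:R.
Implicit Types (f g : T -> R) (a : nat -> R).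

Definition psum a (N : nat) : T -> R := fun x => \sum_(k < N) a k * e k x.

Lemma sqi_psum a N : sqi mu (psum a N).
Proof. by apply: sqi_sum => k; exact: sqiZ. Qed.

Lemma ip_psum a N f : sqi mu f ->
  ip mu (psum a N) f = \sum_(k < N) a k * ip mu (e k) f.
Proof.
move=> sf; rewrite ip_suml//; last by move=> k; exact: sqiZ.
by apply: eq_bigr => k _; rewrite ipZl.
Qed.

Lemma psum_coord a N k : ip mu (psum a N) (e k) = if (k < N)%N then a k else 0.
Proof.
rewrite ip_psum//; case: ifPn => kN.
  rewrite (bigD1 (Ordinal kN))//= orthe eqxx mulr1 big1 ?addr0// => i ik.
  by rewrite orthe -val_eqE/= in ik *; rewrite (negbTE ik) mulr0.
rewrite big1// => i _; rewrite orthe; case: eqP => [ik|]; last by rewrite mulr0.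
by move: kN; rewrite -ik ltn_ord.
Qed.

Lemma ip_psum2 a b N : ip mu (psum a N) (psum b N) = \sum_(k < N) a k * b k.
Proof.
rewrite ip_psum; last exact: sqi_psum.
by apply: eq_bigr => k _; rewrite ipC psum_coord ltn_ord.
Qed.

Lemma pythagoras f N : sqi mu f ->
  ip mu f f = \sum_(k < N) ip mu f (e k) ^+ 2 +
    nrm mu (fun x => f x - psum (fun i => ip mu f (e i)) N x) ^+ 2.
Proof.
move=> sf; set p := psum _ _; have sp : sqi mu p by exact: sqi_psum.
rewrite nrm2 ipBl// ?ipBr//; last exact: sqiB.
rewrite (ipC _ f p) ip_psum2 ip_psum//.
under [\sum_(k < N) _ ^+ 2]eq_bigr do rewrite expr2.
under [X in _ = _ + (_ - X - _)]eq_bigr do rewrite (ipC _ _ f).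
under [X in _ = _ + (_ - _ - (X - _))]eq_bigr do rewrite (ipC _ _ f).
by move: (\sum_(i < N) _) => S; ring.
Qed.

Lemma bessel f N : sqi mu f -> \sum_(k < N) ip mu f (e k) ^+ 2 <= nrm mu f ^+ 2.
Proof. by move=> sf; rewrite nrm2 (pythagoras N sf) lerDl sqr_ge0. Qed.

Lemma coord_le f k : sqi mu f -> `|ip mu f (e k)| <= nrm mu f.
Proof.
move=> sf; rewrite (le_trans (cauchy_schwarz _ _))// -[leRHS]mulr1.
by rewrite ler_wpM2l ?nrm_ge0// /nrm orthe eqxx sqrtr1.
Qed.

Lemma nrm_psumB a N M : (N <= M)%N ->
  nrm mu (fun x => psum a M x - psum a N x) ^+ 2 =
  \sum_(k < M) a k ^+ 2 - \sum_(k < N) a k ^+ 2.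
Proof.
move=> NM; have sN := sqi_psum a N; have sM := sqi_psum a M.
rewrite nrm2 ipBl// ?ipBr//; last exact: sqiB.
rewrite !ip_psum2 (ipC _ (psum a M)) ip_psum//.
have -> : \sum_(k < N) a k * ip mu (e k) (psum a M) = \sum_(k < N) a k ^+ 2.
  apply: eq_bigr => i _.
  by rewrite ipC psum_coord (leq_trans (ltn_ord i) NM) -expr2.
have E n : \sum_(k < n) a k * a k = \sum_(k < n) a k ^+ 2.
  by apply: eq_bigr => i _; rewrite expr2.
by rewrite !E subrr subr0.
Qed.

(** The partial sums are Cauchy, by orthonormality; a rapidly converging subsequence of them has
    a limit. *)
Lemma riesz_fischer a (M : R) : (forall N, \sum_(k < N) a k ^+ 2 <= M) ->
  exists f, [/\ sqi mu f, forall k, ip mu f (e k) = a k &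
    (fun N => nrm mu (fun x => f x - psum a N x)) @ \oo --> (0 : R)].
Proof.
move=> aM; pose s N := \sum_(k < N) a k ^+ 2.
have nds : nondecreasing_seq s.
  apply/nondecreasing_seqP => n; rewrite /s big_ord_recr/=.
  by rewrite lerDl sqr_ge0.
have cs : cvgn s.
  by apply: nondecreasing_is_cvgn => //; exists M => _ [n _ <-]; exact: aM.
have sl n : s n <= limn s by apply: nondecreasing_cvgn_le.
have Nj j : exists N, forall n, (N <= n)%N -> limn s - s n <= (2^-1 ^+ j) ^+ 2.
  have e0 : 0 < (2^-1 ^+ j) ^+ 2 :> R by rewrite !exprn_gt0 ?invr_gt0.
  move/cvgrPdist_le : cs => /(_ _ e0)[N _ HN]; exists N => n Nn.
  by have := HN n Nn; apply: le_trans; exact: ler_norm.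
have [N HN] := choice Nj.
have dist n m j : (N j <= n)%N -> (N j <= m)%N ->
    nrm mu (fun x => psum a m x - psum a n x) <= 2^-1 ^+ j.
  wlog nm : n m / (n <= m)%N => [hw|].
    have [/hw//|/ltnW mn nj mj] := leqP n m.
    by rewrite nrm_distC; [exact: hw|exact: sqi_psum|exact: sqi_psum].
  move=> nj mj; rewrite -ler_sqr ?nnegrE ?nrm_ge0 ?exprn_ge0//.
  rewrite nrm_psumB//; apply: le_trans (HN j n nj).
  by rewrite lerD2r; exact: sl.
pose K j := (\sum_(i < j.+1) N i)%N.
have NK i j : (i <= j)%N -> (N i <= K j)%N.
  move=> ij; rewrite /K (bigD1 (Ordinal (n := j.+1) (m := i) ij))//=.
  exact: leq_addr.
have [||g sg Hg] := @sqi_complete _ _ _ mu (fun j => psum a (K j)) 1 ltr01.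
- by move=> j; exact: sqi_psum.
- by move=> j; rewrite mul1r; apply: dist; exact: NK.
have cg : (fun N => nrm mu (fun x => g x - psum a N x)) @ \oo --> (0 : R).
  apply/cvgrPdist_le => eps eps0.
  have c0 : (fun j => 3 * 2^-1 ^+ j : R) @ \oo --> (0 : R).
    rewrite -(mulr0 3); apply: cvgM; first exact: cvg_cst.
    by apply: cvg_expr; rewrite ger0_norm ?invr_ge0// invf_lt1// ltr1n.
  move/cvgrPdist_le : c0 => /(_ _ eps0)[j _ /(_ j (leqnn j))].
  rewrite sub0r normrN => Hj.
  exists (N j) => // n /= Nn; rewrite sub0r normrN ger0_norm ?nrm_ge0//.
  apply: le_trans (le_trans (ler_norm _) Hj).
  have := nrm_tri sg (sqi_psum a (K j)) (sqi_psum a n).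
  move/le_trans; apply; have := Hg j; have := dist n (K j) j Nn (NK j j (leqnn _)).
  by rewrite mulr1; lra.
exists g; split=> // k.
have : (fun N => ip mu g (e k) - ip mu (psum a N) (e k)) @ \oo --> (0 : R).
  apply/norm_cvg0P; apply: (@squeeze_cvgr _ _ _ _ (cst 0) _ _ _ _ _ cg) => //.
    apply: nearW => n; rewrite normr_ge0 /= -ipBl//; last exact: sqi_psum.
    by apply: coord_le; apply: sqiB => //; exact: sqi_psum.
  exact: cvg_cst.
move=> c1; have c2 : (fun N => ip mu g (e k) - ip mu (psum a N) (e k)) @ \oo -->
    ip mu g (e k) - a k.
  apply: cvgB; first exact: cvg_cst.
  apply: cvg_near_cst; exists k.+1 => // n /= kn; by rewrite psum_coord kn.
by apply/eqP; rewrite -subr_eq0; apply/eqP; exact: (cvg_unique _ c2 c1).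
Qed.

Hypothesis total : forall f, sqi mu f -> (forall k, ip mu f (e k) = 0) ->
  {ae mu, forall x, f x = 0}.

(** The function with the coordinates of [f] given by [riesz_fischer] is equal to [f] almost
    everywhere, by totality. *)
Lemma psum_cvg f : sqi mu f ->
  (fun N => nrm mu (fun x => f x - psum (fun k => ip mu f (e k)) N x)) @ \oo --> (0 : R).
Proof.
move=> sf.
have [g [sg cg]] := riesz_fischer (a := fun k => ip mu f (e k)) (fun N => bessel N sf).
apply: cvg_trans; apply: near_eq_cvg; apply: nearW => N.
have ae : {ae mu, forall x, f x - g x = 0}.
  apply: total; first exact: sqiB.
  by move=> k; rewrite ipBl// cg subrr.
set p := psum _ _; have sp : sqi mu p by exact: sqi_psum.
have sgp := sqiB sg sp; have sfp := sqiB sf sp.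
have ae' : {ae mu, forall x, f x - p x = g x - p x}.
  by apply: filterS ae => x /eqP; rewrite subr_eq0 => /eqP ->.
by rewrite /nrm (ip_ae sfp sgp sfp ae') ipC (ip_ae sfp sgp sgp ae').
Qed.

Lemma parseval f : sqi mu f ->
  (fun N => \sum_(k < N) ip mu f (e k) ^+ 2) @ \oo --> nrm mu f ^+ 2.
Proof.
move=> sf; have /(cvg_sqr _) c := psum_cvg sf.
have : (fun N => nrm mu f ^+ 2 -
  nrm mu (fun x => f x - psum (fun k => ip mu f (e k)) N x) ^+ 2) @ \oo -->
  nrm mu f ^+ 2 - 0 ^+ 2 by apply: cvgB; [exact: cvg_cst|exact: c].
rewrite expr0n subr0; apply: cvg_trans; apply: near_eq_cvg; apply: nearW => N.
by rewrite nrm2 (pythagoras N sf) addrK.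
Qed.

Lemma nrm_le_coord f (M : R) : sqi mu f ->
  (forall N, \sum_(k < N) ip mu f (e k) ^+ 2 <= M) -> nrm mu f ^+ 2 <= M.
Proof.
move=> sf h; rewrite -(cvg_lim (@Rhausdorff _) (parseval sf)).
apply: limr_le; first by apply/cvg_ex; eexists; exact: parseval.
exact: nearW.
Qed.

End OrthonormalBasis.

(** * Fourier analysis on the torus *)

Section MeasureRestriction.
Context d (T : measurableType d) (R : realType) (mu : {measure set T -> \bar R}).
Variables (D : set T) (mD : measurable D).
Import HBNNSimple.

Let ge0_integral_mrestr_nnsfun (h : {nnsfun T >-> R}) :
  (\int[mrestr mu mD]_x (h x)%:E = \int[mu]_(x in D) (h x)%:E)%E.
Proof.
under [LHS]eq_integral do rewrite fimfunE -fsumEFin//.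
under [RHS]eq_integral do rewrite fimfunE -fsumEFin//.
rewrite [LHS]ge0_integral_fsum//; last 2 first.
- by move=> r; exact/measurable_EFinP/measurableT_comp.
- by move=> n x _; rewrite EFinM nnfun_muleindic_ge0.
rewrite [RHS]ge0_integral_fsum//; last 2 first.
- by move=> r; apply/measurable_EFinP; apply: measurable_funTS; exact/measurableT_comp.
- by move=> n x _; rewrite EFinM nnfun_muleindic_ge0.
apply: eq_fsbigr => r _.
rewrite !integralZl_indic_nnsfun//; congr (_ * _)%E.
by rewrite !integral_indic//= /mrestr setIT.
Qed.

Lemma ge0_integral_mrestr (f : T -> \bar R) : measurable_fun setT f ->
  (forall x, 0 <= f x)%E ->
  (\int[mrestr mu mD]_x f x = \int[mu]_(x in D) f x)%E.
Proof.
move=> mf f0; pose f_ := nnsfun_approx measurableT mf.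
transitivity (limn (fun n => \int[mrestr mu mD]_x (f_ n x)%:E))%E.
  rewrite -monotone_convergence//=.
  - apply: eq_integral => x _; apply/esym/cvg_lim => //=.
    exact: cvg_nnsfun_approx.
  - by move=> n; apply: measurableT_comp.
  - by move=> n x _; rewrite lee_fin.
  - by move=> x _ a b ab; rewrite lee_fin//; exact/lefP/nd_nnsfun_approx.
rewrite (_ : (\int[mu]_(x in D) _ =
    limn (fun n => \int[mu]_(x in D) (f_ n x)%:E))%E); last first.
  rewrite -monotone_convergence//=.
  - apply: eq_integral => x _; apply/esym/cvg_lim => //.
    exact: cvg_nnsfun_approx.
  - by move=> n; exact/measurable_EFinP/measurable_funTS.
  - by move=> n x _; rewrite lee_fin.
  - by move=> x _ a b ab; rewrite lee_fin//; exact/lefP/nd_nnsfun_approx.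
by congr (limn _); apply/funext => n; exact: ge0_integral_mrestr_nnsfun.
Qed.

Lemma integral_mrestr (f : T -> \bar R) : measurable_fun setT f ->
  (\int[mrestr mu mD]_x f x = \int[mu]_(x in D) f x)%E.
Proof.
move=> mf; rewrite [LHS]integralE [in RHS]integralE; congr (_ - _)%E.
  by apply: ge0_integral_mrestr => //; exact: measurable_funepos.
by apply: ge0_integral_mrestr => //; exact: measurable_funeneg.
Qed.

Lemma integrable_mrestr (f : T -> \bar R) : measurable_fun setT f ->
  mu.-integrable D f <-> (mrestr mu mD).-integrable setT f.
Proof.
move=> mf; split=> /integrableP[_ h]; apply/integrableP; split=> //.
- by rewrite ge0_integral_mrestr//; exact: measurableT_comp.
- exact: measurable_funTS.
- by rewrite -ge0_integral_mrestr//; exact: measurableT_comp.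
Qed.

Lemma ae_mrestr (Q : T -> Prop) :
  {ae mu, forall x, D x -> Q x} -> {ae mrestr mu mD, forall x, Q x}.
Proof.
move=> [N [mN N0 sN]]; exists (N `|` ~` D); split.
- by apply: measurableU => //; exact: measurableC.
- rewrite /mrestr setIUl setICl setU0.
  apply/eqP; rewrite eq_le measure_ge0 andbT -N0.
  by apply: le_measure; rewrite ?inE//; exact: measurableI.
- move=> x /= nQ; have [Dx|] := pselect (D x); last by right.
  by left; apply: sN => /= /(_ Dx).
Qed.

End MeasureRestriction.

Section RealIntegrable.
Context d (T : measurableType d) (R : realType) (mu : {measure set T -> \bar R}).
Variables (D : set T) (mD : measurable D).
Implicit Types f g : T -> R.

Lemma integrableDR f g : mu.-integrable D (EFin \o f) -> mu.-integrable D (EFin \o g) ->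
  mu.-integrable D (EFin \o (fun x => f x + g x)).
Proof. exact: integrableD. Qed.

Lemma integrableBR f g : mu.-integrable D (EFin \o f) -> mu.-integrable D (EFin \o g) ->
  mu.-integrable D (EFin \o (fun x => f x - g x)).
Proof. exact: integrableB. Qed.

End RealIntegrable.

Section LineIntegrals.
Context (R : realType).
Notation leb := (@lebesgue_measure R).
Implicit Types f F : R -> R.

Lemma cont_integrable f (a b : R) : continuous f ->
  leb.-integrable `[a, b] (EFin \o f).
Proof.
move=> cf; apply: continuous_compact_integrable; first exact: segment_compact.
by apply: continuous_subspaceT.
Qed.

Lemma FTC2 f F (a b : R) : a <= b -> continuous f ->
  (forall x : R, is_derive x (1 : R) F (f x)) ->
  \int[leb]_(x in `[a, b]) f x = F b - F a.
Proof.
move=> ab cf dF; move: ab; rewrite le_eqVlt => /predU1P[->|ab].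
  by rewrite set_itv1 Rintegral_set1 subrr.
have cF x : {for x, continuous F}.
  by apply/differentiable_continuous/derivable1_diffP; case: (dF x).
rewrite /Rintegral (@continuous_FTC2 _ f F)//.
- by apply: continuous_subspaceT.
- split => [x _||]; first by case: (dF x).
  + by apply: cvg_at_right_filter; exact: cF.
  + by apply: cvg_at_left_filter; exact: cF.
- by move=> x _; rewrite derive1E; case: (dF x).
Qed.

End LineIntegrals.

Section Torus.
Context (R : realType).

Lemma mfunM (f g : R -> R) : measurable_fun [set: R] f -> measurable_fun [set: R] g ->
  measurable_fun [set: R] (fun x => f x * g x).
Proof. exact: measurable_funM. Qed.

Notation leb := (@lebesgue_measure R).
Notation mu := (torus R).
Implicit Types f g : R -> R.

Lemma twopi_gt0 : 0 < 2 * pi :> R. Proof. by rewrite mulr_gt0// pi_gt0. Qed.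

Lemma torus_itv f : measurable_fun setT f ->
  \int[mu]_x f x = \int[leb]_(x in `[0, 2 * pi]) f x.
Proof.
move=> mf; rewrite /Rintegral integral_mrestr; last exact/measurable_EFinP.
by rewrite integral_itv_bndo_bndc//; apply/measurable_EFinP; exact: measurable_funTS.
Qed.

Lemma torus_fin : (mu setT < +oo)%E.
Proof.
rewrite /= /mrestr/= setTI lebesgue_measure_itv/=.
by case: ifPn => _; rewrite ltry.
Qed.

Lemma torus_integrable f C : measurable_fun setT f -> (forall x, `|f x| <= C) ->
  mu.-integrable setT (EFin \o f).
Proof.
move=> mf fC; apply: measurable_bounded_integrable => //; first exact: torus_fin.
exists C; split; first exact: num_real.
by move=> y Cy x _; apply: le_trans (ltW Cy).
Qed.

Lemma sqi_bdd f C : measurable_fun setT f -> (forall x, `|f x| <= C) -> sqi mu f.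
Proof.
move=> mf fC; split=> //; apply: (@torus_integrable _ (C ^+ 2)).
  exact: measurable_funX.
move=> x; rewrite normrX lerXn2r ?nnegrE//.
exact: le_trans (fC x).
Qed.

Lemma sqi_cst c : sqi mu (fun=> c).
Proof. by apply: (@sqi_bdd _ `|c|). Qed.

Lemma sqi_integrable f : sqi mu f -> mu.-integrable setT (EFin \o f).
Proof.
move=> sf; have := sqiM sf (sqi_cst 1).
by apply: eq_integrable => // x _ /=; rewrite mulr1.
Qed.

Definition cosz (z : int) (x : R) : R := cos (z%:~R * x).
Definition sinz (z : int) (x : R) : R := sin (z%:~R * x).

Lemma cts_cosz z : continuous (cosz z).
Proof.
move=> x; suff : {for x, continuous (cos \o (fun y : R => z%:~R * y))} by [].
apply: continuous_comp; first by apply: cvgM; [exact: cvg_cst|exact: cvg_id].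
exact: continuous_cos.
Qed.

Lemma cts_sinz z : continuous (sinz z).
Proof.
move=> x; suff : {for x, continuous (sin \o (fun y : R => z%:~R * y))} by [].
apply: continuous_comp; first by apply: cvgM; [exact: cvg_cst|exact: cvg_id].
exact: continuous_sin.
Qed.

Lemma mcosz z : measurable_fun setT (cosz z).
Proof. by apply: continuous_measurable_fun; exact: cts_cosz. Qed.

Lemma msinz z : measurable_fun setT (sinz z).
Proof. by apply: continuous_measurable_fun; exact: cts_sinz. Qed.

Lemma cosz_le1 z x : `|cosz z x| <= 1. Proof. exact: cos_max. Qed.
Lemma sinz_le1 z x : `|sinz z x| <= 1. Proof. exact: sin_max. Qed.

Lemma sqi_cosz z : sqi mu (cosz z).
Proof. by apply: (@sqi_bdd _ 1); [exact: mcosz|exact: cosz_le1]. Qed.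
Lemma sqi_sinz z : sqi mu (sinz z).
Proof. by apply: (@sqi_bdd _ 1); [exact: msinz|exact: sinz_le1]. Qed.

Lemma cosz_2pi z : cos (z%:~R * (2 * pi)) = 1 :> R.
Proof.
have h n : cos (n%:R * (2 * pi)) = 1 :> R.
  have := periodicn (@cosD2pi R) n (0 : R).
  by rewrite add0r cos0 !mulr_natl.
case: z => n; first exact: h.
by rewrite NegzE rmorphN/= mulNr cosN; exact: h.
Qed.

Lemma sinz_2pi z : sin (z%:~R * (2 * pi)) = 0 :> R.
Proof.
have h n : sin (n%:R * (2 * pi)) = 0 :> R.
  have := periodicn (@sinD2pi R) n (0 : R).
  by rewrite add0r sin0 !mulr_natl.
case: z => n; first exact: h.
by rewrite NegzE rmorphN/= mulNr sinN (h n.+1) oppr0.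
Qed.

Lemma int_cosz z : \int[mu]_x cosz z x = if z == 0 then 2 * pi else 0.
Proof.
rewrite torus_itv; last exact: mcosz.
have [->|z0] := eqVneq z 0.
  under eq_Rintegral do rewrite /cosz mul0r cos0.
  rewrite Rintegral_cst// mul1r /= lebesgue_measure_itv/= lte_fin twopi_gt0.
  by rewrite -EFinB /= subr0.
have z1 : z%:~R != 0 :> R by rewrite intr_eq0.
have dF (x : R) : is_derive x (1 : R) (fun x => z%:~R^-1 * sin (z%:~R * x)) (cosz z x).
  by apply: is_derive_eq; rewrite /cosz /GRing.scale/=; field.
rewrite (@FTC2 _ _ _ (0 : R) (2 * pi) (ltW twopi_gt0) (@cts_cosz z) dF).
by rewrite sinz_2pi !mulr0 sin0 mulr0 subrr.
Qed.

Lemma int_sinz z : \int[mu]_x sinz z x = 0.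
Proof.
rewrite torus_itv; last exact: msinz.
have [->|z0] := eqVneq z 0.
  under eq_Rintegral do rewrite /sinz mul0r sin0.
  by rewrite Rintegral_cst// mul0r.
have z1 : z%:~R != 0 :> R by rewrite intr_eq0.
have dF (x : R) : is_derive x (1 : R) (fun x => - z%:~R^-1 * cos (z%:~R * x)) (sinz z x).
  by apply: is_derive_eq; rewrite /sinz /GRing.scale/=; field.
rewrite (@FTC2 _ _ _ (0 : R) (2 * pi) (ltW twopi_gt0) (@cts_sinz z) dF).
by rewrite cosz_2pi mulr0 cos0 subrr.
Qed.

Lemma coszM z1 z2 x :
  cosz z1 x * cosz z2 x = 2^-1 * (cosz (z1 - z2) x + cosz (z1 + z2) x).
Proof. by rewrite /cosz rmorphB rmorphD/= mulrBl mulrDl cosB cosD; field. Qed.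

Lemma sinzM z1 z2 x :
  sinz z1 x * sinz z2 x = 2^-1 * (cosz (z1 - z2) x - cosz (z1 + z2) x).
Proof. by rewrite /cosz /sinz rmorphB rmorphD/= mulrBl mulrDl cosB cosD; field. Qed.

Lemma sincoszM z1 z2 x :
  sinz z1 x * cosz z2 x = 2^-1 * (sinz (z1 + z2) x + sinz (z1 - z2) x).
Proof. by rewrite /cosz /sinz rmorphB rmorphD/= mulrBl mulrDl sinB sinD; field. Qed.

Lemma ip_cosz z1 z2 : ip mu (cosz z1) (cosz z2) =
  (if z1 == z2 then pi else 0) + (if z1 == - z2 then pi else 0).
Proof.
rewrite /ip; under eq_Rintegral do rewrite coszM.
have i1 z := sqi_integrable (sqi_cosz z).
rewrite RintegralZl//; last exact: integrableDR.
rewrite RintegralD// !int_cosz subr_eq0 addr_eq0.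
by case: ifP => _; case: ifP => _; field.
Qed.

Lemma ip_sinz z1 z2 : ip mu (sinz z1) (sinz z2) =
  (if z1 == z2 then pi else 0) - (if z1 == - z2 then pi else 0).
Proof.
rewrite /ip; under eq_Rintegral do rewrite sinzM.
have i1 z := sqi_integrable (sqi_cosz z).
rewrite RintegralZl//; last exact: integrableBR.
rewrite RintegralB// !int_cosz subr_eq0 addr_eq0.
by case: ifP => _; case: ifP => _; field.
Qed.

Lemma ip_sincosz z1 z2 : ip mu (sinz z1) (cosz z2) = 0.
Proof.
rewrite /ip; under eq_Rintegral do rewrite sincoszM.
have i1 z := sqi_integrable (sqi_sinz z).
rewrite RintegralZl//; last exact: integrableDR.
by rewrite RintegralD// !int_sinz addr0 mulr0.
Qed.

(** Frequency of the [k]-th element of the real basis: [trig 0] is the constant, [trig (2m+1)] and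
    [trig (2m+2)] are the cosine and the sine at frequency [m+1]. *)
Definition freq (k : nat) : nat := uphalf k.

Definition trig (k : nat) : R -> R :=
  if k is 0 then fun=> (Num.sqrt (2 * pi))^-1
  else fun x => (Num.sqrt pi)^-1 * (if odd k then cosz (freq k) x else sinz (freq k) x).

Lemma trig_odd n : trig n.*2.+1 = fun x => (Num.sqrt pi)^-1 * cosz n.+1 x.
Proof. by rewrite /trig /= odd_double /= /freq /= doubleK. Qed.

Lemma trig_even n : trig n.*2.+2 = fun x => (Num.sqrt pi)^-1 * sinz n.+1 x.
Proof.
have e : freq n.*2.+2 = n.+1 by rewrite /freq; lia.
by rewrite /trig e /= odd_double.
Qed.

Lemma trig0E : trig 0 = fun x => (Num.sqrt (2 * pi))^-1 * cosz 0 x.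
Proof. by apply/funext => x; rewrite /= /cosz mul0r cos0 mulr1. Qed.

Lemma sqi_trig k : sqi mu (trig k).
Proof.
case: k => [|k]; first exact: sqi_cst.
by rewrite /trig; case: (odd _); apply: sqiZ; [exact: sqi_cosz|exact: sqi_sinz].
Qed.

Lemma cts_trig k : continuous (trig k).
Proof.
case: k => [|k] x; first exact: cvg_cst.
rewrite /trig; case: (odd _); apply: cvgM; try exact: cvg_cst.
  exact: cts_cosz.
exact: cts_sinz.
Qed.

Lemma trig_bdd k x : `|trig k x| <= 1.
Proof.
have p1 : 1 <= Num.sqrt pi :> R.
  by rewrite -[leLHS]sqrtr1 ler_sqrt ?pi_gt0// (le_trans _ (pi_ge2 R))// ler1n.
have p2 : Num.sqrt pi <= Num.sqrt (2 * pi) :> R.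
  by rewrite ler_sqrt ?twopi_gt0//; have := pi_gt0 R; lra.
case: k => [|k] /=.
  rewrite ger0_norm ?invr_ge0// invf_le1 ?(le_trans p1)//.
  by rewrite (lt_le_trans ltr01)// (le_trans p1).
rewrite normrM ger0_norm ?invr_ge0//.
rewrite mulr_ile1 ?invr_ge0// ?invf_le1 ?(lt_le_trans ltr01)//.
by case: ifP => _; [exact: cosz_le1|exact: sinz_le1].
Qed.

Lemma orth_trig i j : ip mu (trig i) (trig j) = (i == j)%:R.
Proof.
have s1 : Num.sqrt pi * Num.sqrt pi = pi :> R.
  by rewrite -expr2 sqr_sqrtr// ltW// pi_gt0.
have s2 : Num.sqrt (2 * pi) * Num.sqrt (2 * pi) = 2 * pi :> R.
  by rewrite -expr2 sqr_sqrtr// ltW// twopi_gt0.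
have n1 : Num.sqrt pi != 0 :> R by rewrite gt_eqF// sqrtr_gt0 pi_gt0.
have n2 : Num.sqrt (2 * pi) != 0 :> R by rewrite gt_eqF// sqrtr_gt0 twopi_gt0.
have freqN a b : (Posz (freq a.+1) == - Posz (freq b)) = false.
  by apply/eqP; rewrite /freq/=; lia.
wlog ij : i j / (i <= j)%N => [hw|].
  have [/hw//|/ltnW/hw] := leqP i j; by rewrite ipC eq_sym.
have sc z := sqi_cosz z; have ss z := sqi_sinz z.
case: i ij => [|i]; case: j => [|j] // ij.
- rewrite trig0E ipZl ?ipZr//; last exact: sqiZ.
  rewrite ip_cosz oppr0 eqxx mulrA -invfM s2 -mulr2n -[X in _ * X]mulr_natl.
  by rewrite mulVf// gt_eqF// twopi_gt0.
- rewrite trig0E /trig ipZl//; last by case: (odd _); exact: sqiZ.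
  case: (odd _); rewrite ipZr//.
    rewrite ip_cosz; case: eqP => // _; case: eqP => [|_].
      by move=> /eqP; rewrite eq_sym oppr_eq0.
    by rewrite addr0 !mulr0.
  by rewrite ipC ip_sincosz !mulr0.
rewrite /trig; case oi : (odd i.+1); case oj : (odd j.+1).
- rewrite ipZl ?ipZr ?ip_cosz//; last exact: sqiZ.
  rewrite freqN addr0.
  have -> : (freq i.+1 == freq j.+1 :> int) = (i.+1 == j.+1).
    apply/eqP/eqP => [[h]|->//]; move: h; rewrite /freq /=.
    have := odd_double_half i; have := odd_double_half j.
    by move: oi oj; rewrite /= => /negbTE -> /negbTE ->; lia.
  by case: eqP => _; rewrite ?mulr0// mulrA -invfM s1 mulVf// gt_eqF// pi_gt0.
- rewrite ipZl ?ipZr//; last exact: sqiZ.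
  rewrite (ipC mu (cosz _)) ip_sincosz !mulr0; case: eqP => // e.
  by rewrite e oj in oi.
- rewrite ipZl ?ipZr//; last exact: sqiZ.
  rewrite ip_sincosz !mulr0; case: eqP => // e.
  by rewrite e oj in oi.
- rewrite ipZl ?ipZr ?ip_sinz//; last exact: sqiZ.
  rewrite freqN subr0.
  have -> : (freq i.+1 == freq j.+1 :> int) = (i.+1 == j.+1).
    apply/eqP/eqP => [[h]|->//]; move: h; rewrite /freq /=.
    have := odd_double_half i; have := odd_double_half j.
    by move: oi oj; rewrite /= => /negbFE -> /negbFE ->; lia.
  by case: eqP => _; rewrite ?mulr0// mulrA -invfM s1 mulVf// gt_eqF// pi_gt0.
Qed.

(** Polynomials in [y] belong to the class of bounded continuous [g] such that
    [f * g] is orthogonal to all [cosz z] and [sinz z]. *)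
Lemma poly_orth f (al be ga : R) (y := fun x => al + be * cosz 1 x + ga * sinz 1 x) :
  sqi mu f -> (forall z, ip mu f (cosz z) = 0) -> (forall z, ip mu f (sinz z) = 0) ->
  forall p : {poly R}, ip mu f (fun x => p.[y x]) = 0.
Proof.
move=> sf fc fs.
pose V (g : R -> R) := [/\ measurable_fun setT g, exists C : R, forall x, `|g x| <= C,
  forall z, ip mu f (fun x => g x * cosz z x) = 0 &
  forall z, ip mu f (fun x => g x * sinz z x) = 0].
have VM (g h : R -> R) (C D : R) : measurable_fun setT g -> (forall x, `|g x| <= C) ->
    measurable_fun setT h -> (forall x, `|h x| <= D) -> sqi mu (fun x => g x * h x).
  move=> mg gC mh hD; apply: (@sqi_bdd _ (C * D)); first exact: measurable_funM.
  by move=> x; rewrite normrM ler_pM.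
have my : measurable_fun setT y.
  apply: measurable_funD; last by apply: measurable_funM => //; exact: msinz.
  by apply: measurable_funD => //; apply: measurable_funM => //; exact: mcosz.
have yb x : `|y x| <= `|al| + `|be| + `|ga|.
  rewrite (le_trans (ler_normD _ _))// lerD ?(le_trans (ler_normD _ _)) ?lerD2l//.
    by rewrite normrM ler_piMr// cosz_le1.
  by rewrite normrM ler_piMr// sinz_le1.
have Vy g : V g -> V (fun x => g x * y x).
  move=> [mg [C gC] gc gs].
  have sc z := VM _ _ _ _ mg gC (mcosz z) (cosz_le1 z).
  have ss z := VM _ _ _ _ mg gC (msinz z) (sinz_le1 z).
  split.
  - exact: measurable_funM.
  - by exists (C * (`|al| + `|be| + `|ga|)) => x; rewrite normrM ler_pM.
  - move=> z; rewrite (_ : (fun x => _) = (fun x => al * (g x * cosz z x) +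
      (be / 2 * (g x * cosz (1 - z) x) + (be / 2 * (g x * cosz (1 + z) x) +
      (ga / 2 * (g x * sinz (1 + z) x) + ga / 2 * (g x * sinz (1 - z) x)))))).
      rewrite !ipDr ?ipZr ?gc ?gs ?mulr0 ?addr0//; by repeat apply: sqiD; exact: sqiZ.
    apply/funext => x; rewrite /y.
    transitivity (al * (g x * cosz z x) + be * g x * (cosz 1 x * cosz z x) +
      ga * g x * (sinz 1 x * cosz z x)); first by ring.
    by rewrite coszM sincoszM; field.
  - move=> z; rewrite (_ : (fun x => _) = (fun x => al * (g x * sinz z x) +
      (be / 2 * (g x * sinz (z + 1) x) + (be / 2 * (g x * sinz (z - 1) x) +
      (ga / 2 * (g x * cosz (1 - z) x) + - (ga / 2) * (g x * cosz (1 + z) x)))))).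
      rewrite !ipDr ?ipZr ?gc ?gs ?mulr0 ?addr0//; by repeat apply: sqiD; exact: sqiZ.
    apply/funext => x; rewrite /y.
    transitivity (al * (g x * sinz z x) + be * g x * (sinz z x * cosz 1 x) +
      ga * g x * (sinz 1 x * sinz z x)); first by ring.
    by rewrite sinzM sincoszM; field.
have Vc c : V (fun=> c).
  split=> //.
  - by exists `|c|.
  - by move=> z; rewrite ipZr ?fc ?mulr0//; exact: sqi_cosz.
  - by move=> z; rewrite ipZr ?fs ?mulr0//; exact: sqi_sinz.
have VD g h : V g -> V h -> V (fun x => g x + h x).
  move=> [mg [C gC] gc gs] [mh [D hD] hc hs]; split.
  - exact: measurable_funD.
  - by exists (C + D) => x; rewrite (le_trans (ler_normD _ _))// lerD.
  - move=> z; under eq_fun do rewrite mulrDl.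
    rewrite ipDr ?gc ?hc ?addr0//; apply: VM; eauto; [exact: mcosz|exact: cosz_le1|
      exact: mcosz|exact: cosz_le1].
  - move=> z; under eq_fun do rewrite mulrDl.
    rewrite ipDr ?gs ?hs ?addr0//; apply: VM; eauto; [exact: msinz|exact: sinz_le1|
      exact: msinz|exact: sinz_le1].
move=> p; have : V (fun x => p.[y x]).
  elim/poly_ind: p => [|p c Vp].
    by under eq_fun do rewrite horner0; exact: Vc.
  under eq_fun do rewrite hornerMXaddC.
  by apply: (VD (fun x => p.[y x] * y x)); [exact: Vy|exact: Vc].
move=> [_ _ /(_ 0) <- _]; congr ip; apply/funext => x.
by rewrite /cosz mul0r cos0 mulr1.
Qed.

Lemma bernoulli_ineq (a : R) n : -1 <= a -> 1 + n%:R * a <= (1 + a) ^+ n.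
Proof.
move=> a1; elim: n => [|n ih]; first by rewrite mul0r addr0 expr0.
rewrite exprS; have a0 : 0 <= 1 + a by lra.
have := ler_wpM2l a0 ih; apply: le_trans.
have := mulr_ge0 (ler0n R n) (sqr_ge0 a); rewrite -natr1; lra.
Qed.

(** By Bernoulli's inequality these polynomials tend to the indicator of [y < 1/2] on the unit
    interval, except at 1/2. *)
Definition stepfun k (y : R) := (1 - y ^+ k) ^+ (2 ^ k).

Lemma stepfun_itv k y : 0 <= y <= 1 -> 0 <= stepfun k y <= 1.
Proof.
move=> /andP[y0 y1]; have := exprn_ge0 k y0; have := exprn_ile1 k y0 y1 => h1 h2.
by rewrite /stepfun exprn_ge0 ?exprn_ile1//; lra.
Qed.

Lemma stepfun_cvg1 y : 0 <= y < 2^-1 -> (fun k => stepfun k y) @ \oo --> (1 : R).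
Proof.
move=> /andP[y0 y2].
have c0 : (fun k => 1 - (2 * y) ^+ k) @ \oo --> (1 : R).
  rewrite -[X in _ --> X]subr0; apply: cvgB; first exact: cvg_cst.
  apply: cvg_expr; rewrite ger0_norm ?mulr_ge0//.
  by rewrite mulrC -ltr_pdivlMr// mul1r.
apply: (squeeze_cvgr _ c0 (cvg_cst (1 : R))).
apply: nearW => k; have yk : 0 <= y <= 1 by rewrite y0/=; lra.
have /andP[_ ->] := stepfun_itv k yk; rewrite andbT.
have yk1 : y ^+ k <= 1 by apply: exprn_ile1 => //; lra.
have /(bernoulli_ineq (2 ^ k)) : -1 <= - y ^+ k by lra.
by apply: le_trans; rewrite natrX exprMn mulrN.
Qed.

Lemma stepfun_cvg0 y : 2^-1 < y <= 1 -> (fun k => stepfun k y) @ \oo --> (0 : R).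
Proof.
move=> /andP[y2 y1].
have y0 : 0 < y by apply: lt_trans y2; rewrite invr_gt0.
have c0 : (fun k => (2 * y)^-1 ^+ k) @ \oo --> (0 : R).
  apply: cvg_expr; rewrite ger0_norm ?invr_ge0 ?mulr_ge0 ?(ltW y0)//.
  by rewrite invf_lt1 ?mulr_gt0// mulrC -ltr_pdivrMr// mul1r.
apply: (squeeze_cvgr _ (cvg_cst (0 : R)) c0).
apply: nearW => k; have yk : 0 <= y <= 1 by rewrite (ltW y0).
have /andP[-> _] := stepfun_itv k yk; rewrite /=.
have yk0 : 0 < y ^+ k by exact: exprn_gt0.
have yk1 : y ^+ k <= 1 by apply: exprn_ile1 => //; exact: ltW.
have h1 : (1 + y ^+ k) ^+ (2 ^ k) * stepfun k y <= 1.
  rewrite /stepfun -exprMn exprn_ile1//; first by apply: mulr_ge0; lra.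
  have := sqr_ge0 (y ^+ k); lra.
have h2 : (2 * y) ^+ k <= (1 + y ^+ k) ^+ (2 ^ k).
  have /(bernoulli_ineq (2 ^ k)) : -1 <= y ^+ k by lra.
  by apply: le_trans; rewrite natrX exprMn lerDr.
rewrite exprVn -[leRHS]mul1r ler_pdivlMr ?exprn_gt0 ?mulr_gt0// mulrC.
apply: le_trans h1; rewrite ler_wpM2r//.
by have /andP[] := stepfun_itv k yk.
Qed.

(** With [y = 1/2 - sin (x/2) sin ((b-x)/2) / 2], a trigonometric polynomial of degree one, the
    set [y < 1/2] is, within one period, the arc [0 < x < b]; [f] is orthogonal to [stepfun k y], which tends to the
    indicator of this arc. *)
Lemma arc_orth f b : sqi mu f -> (forall z, ip mu f (cosz z) = 0) ->
  (forall z, ip mu f (sinz z) = 0) -> 0 < b < 2 * pi ->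
  \int[leb]_(x in `[0, b]) f x = 0.
Proof.
move=> sf fc fs /andP[b0 b2].
have mf : measurable_fun setT f by case: sf.
pose y x := 2^-1 + 4^-1 * cos (b / 2) + (- 4^-1 * cos (b / 2)) * cosz 1 x +
  (- 4^-1 * sin (b / 2)) * sinz 1 x.
have yE x : y x = 2^-1 - 2^-1 * (sin (x / 2) * sin ((b - x) / 2)).
  rewrite /y /cosz /sinz mulr1z mul1r.
  have e1 : cos (x - b / 2) = cos (x / 2) * cos ((b - x) / 2) + sin (x / 2) * sin ((b - x) / 2).
    by rewrite -cosB; congr cos; field.
  have e2 : cos (b / 2) = cos (x / 2) * cos ((b - x) / 2) - sin (x / 2) * sin ((b - x) / 2).
    by rewrite -cosD; congr cos; field.
  transitivity (2^-1 + 4^-1 * (cos (b / 2) - cos (x - b / 2))).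
    by rewrite (cosB x); field.
  by rewrite e1 e2; field.
have y01 x : 0 <= y x <= 1.
  rewrite yE; have := sin_max (x / 2); have := sin_max ((b - x) / 2).
  rewrite !ler_norml => /andP[h1 h2] /andP[h3 h4]; apply/andP; split; nra.
have my : measurable_fun setT y.
  apply: measurable_funD; last by apply: measurable_funM => //; exact: msinz.
  by apply: measurable_funD => //; apply: measurable_funM => //; exact: mcosz.
have mst k : measurable_fun setT (fun x => stepfun k (y x)).
  by apply: measurable_funX; apply: measurable_funB => //; exact: measurable_funX.
have ist k : \int[mu]_x (f x * stepfun k (y x)) = 0.
  have := poly_orth (2^-1 + 4^-1 * cos (b / 2)) (- 4^-1 * cos (b / 2))
    (- 4^-1 * sin (b / 2)) sf fc fs ((1 - 'X^k) ^+ (2 ^ k)).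
  by move=> <-; apply: eq_Rintegral => x _; rewrite horner_exp hornerD hornerN hornerXn hornerC.
have iD (D : set R) : measurable D -> D `<=` `[0, 2 * pi[ -> leb.-integrable D (EFin \o f).
  move=> mD sD; have := sqi_integrable sf.
  rewrite -integrable_mrestr; last exact/measurable_EFinP.
  by apply: integrableS.
have dc := @dominated_convergence _ _ R leb `[0, 2 * pi[ (measurable_itv _)
  (fun k x => (f x * stepfun k (y x))%:E) (fun x => (f x * \1_(`[0, b]) x)%:E)
  (fun x => `|f x|%:E).
have {dc} [] := dc.
- move=> k; apply/measurable_EFinP; apply: measurable_funTS.
  exact: mfunM.
- apply/measurable_EFinP; apply: measurable_funTS.
  by apply: mfunM => //; apply: measurable_indic.
- exists [set 0; b]; split.
  + by apply: measurableU.
  + have /countable_lebesgue_measure0 // : countable [set (0 : R); b].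
    by apply: finite_set_countable; exact: finite_set2.
  + move=> x /= /not_implyP[]; rewrite in_itv/= => /andP[x0 x2] nc.
    have [->|xn0] := eqVneq x 0; first by left.
    have [->|xnb] := eqVneq x b; first by right.
    exfalso; apply: nc; apply: cvg_EFin; first exact: nearW.
    apply: cvgM; first exact: cvg_cst.
    have xp : 0 < x by rewrite lt_neqAle eq_sym xn0.
    have s0 : 0 < sin (x / 2).
      apply: sin_gt0_pi; rewrite divr_gt0//= ltr_pdivrMr// mulrC//.
    have [xb|bx|xb] := ltgtP x b; last by rewrite xb eqxx in xnb.
    + rewrite indicE mem_set/=; last by rewrite in_itv/= x0 ltW.
      apply: stepfun_cvg1; have /andP[-> _] := y01 x; rewrite /= yE.
      have : 0 < sin ((b - x) / 2).
        apply: sin_gt0_pi; rewrite divr_gt0 ?subr_gt0//= ltr_pdivrMr//; lra.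
      by move=> /(mulr_gt0 s0); lra.
    + rewrite indicE memNset/=; last by rewrite in_itv/= x0 leNgt bx.
      apply: stepfun_cvg0; have /andP[_ ->] := y01 x; rewrite andbT yE.
      have : 0 < sin ((x - b) / 2).
        apply: sin_gt0_pi; rewrite divr_gt0 ?subr_gt0//= ltr_pdivrMr//; lra.
      have -> : (b - x) / 2 = - ((x - b) / 2) by field.
      by rewrite sinN => /(mulr_gt0 s0); lra.
- have := iD _ (measurable_itv `[0, 2 * pi[) (@subset_refl _ _).
  by move=> /integrable_abse; apply: eq_integrable.
- apply: aeW => x k _ /=; rewrite lee_fin normrM ler_piMr//.
  by have /andP[p q] := stepfun_itv k (y01 x); rewrite ger0_norm.
move=> _ _ /=.
have -> : (fun k => \int[leb]_(x in `[0%R, (2 * pi)%R[) (f x * stepfun k (y x))%:E)%E =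
    (fun=> 0%E).
  apply/funext => k; have := ist k; rewrite /Rintegral.
  rewrite integral_mrestr; last by apply/measurable_EFinP; exact: mfunM.
  move=> h; rewrite -[LHS]fineK ?h//.
  apply: integrable_fin_num => //.
  apply/(integrable_mrestr leb (measurable_itv `[0, 2 * pi[)).
    by apply/measurable_EFinP; exact: mfunM.
  apply: sqi_integrable; apply: (@sqi_bddM _ _ _ _ _ _ 1); [exact: sf|exact: mst|].
  by move=> x; have /andP[p q] := stepfun_itv k (y01 x); rewrite ger0_norm.
move=> c; have h := cvg_unique (@ereal_hausdorff R) c (cvg_cst 0%E).
rewrite /Rintegral; have -> : (\int[leb]_(x in `[0%R, b]) (f x)%:E = 0)%E; last by [].
rewrite -[RHS]h integral_mkcond [RHS]integral_mkcond; apply: eq_integral => x _.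
rewrite !patchE; case: ifPn => [xb|nxb].
  have x2 : x \in `[0, 2 * pi[%classic.
    move: xb; rewrite !inE/= !in_itv/= => /andP[-> xb]; exact: le_lt_trans b2.
  by rewrite x2 indicE xb mulr1.
by case: ifP => // _; rewrite indicE (negbTE nxb) mulr0.
Qed.

(** The primitive of [f] vanishes identically, by [arc_orth]; by Lebesgue's differentiation
    theorem so does [f]. *)
Lemma trig_total f : sqi mu f -> (forall k, ip mu f (trig k) = 0) ->
  {ae mu, forall x, f x = 0}.
Proof.
move=> sf h; have mf : measurable_fun setT f by case: sf.
have s1 : (Num.sqrt pi)^-1 != 0 :> R by rewrite invr_eq0 gt_eqF// sqrtr_gt0 pi_gt0.
have s2 : (Num.sqrt (2 * pi))^-1 != 0 :> R.
  by rewrite invr_eq0 gt_eqF// sqrtr_gt0 twopi_gt0.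
have fcn (n : nat) : ip mu f (cosz n) = 0.
  case: n => [|n].
    have := h 0%N; rewrite trig0E ipZr//; last exact: sqi_cosz.
    by move=> /eqP; rewrite mulf_eq0 (negbTE s2) => /eqP.
  have := h n.*2.+1; rewrite trig_odd.
  rewrite ipZr//; last exact: sqi_cosz.
  by move=> /eqP; rewrite mulf_eq0 (negbTE s1) => /eqP.
have fsn (n : nat) : ip mu f (sinz n) = 0.
  case: n => [|n].
    have -> : sinz 0 = fun=> 0 by apply/funext => x; rewrite /sinz mul0r sin0.
    by rewrite ipC ip0l.
  have := h n.*2.+2; rewrite trig_even.
  rewrite ipZr//; last exact: sqi_sinz.
  by move=> /eqP; rewrite mulf_eq0 (negbTE s1) => /eqP.
have fc z : ip mu f (cosz z) = 0.
  case: z => n; first exact: fcn.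
  rewrite -[RHS](fcn n.+1); congr ip; apply/funext => x.
  by rewrite /cosz NegzE rmorphN/= mulNr cosN.
have fs z : ip mu f (sinz z) = 0.
  case: z => n; first exact: fsn.
  rewrite (_ : sinz _ = fun x => (-1) * sinz n.+1 x).
    by rewrite ipZr ?fsn ?mulr0//; exact: sqi_sinz.
  by apply/funext => x; rewrite mulN1r /sinz NegzE mulrNz mulNr sinN.
apply: ae_mrestr.
have i1 : leb.-integrable `[0, 2 * pi[ (EFin \o f).
  apply/(integrable_mrestr leb (measurable_itv `[0, 2 * pi[)) => //.
    exact/measurable_EFinP.
  exact: sqi_integrable.
pose g : R -> R := f \_ `[0, 2 * pi[.
have ig : leb.-integrable setT (EFin \o g).
  rewrite -restrict_EFin.
  exact: (@integrable_mkcond _ _ R leb `[0, 2 * pi[ (EFin \o f) (measurable_itv _)).1.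
have igy y : leb.-integrable `]-oo, y] (EFin \o g).
  exact: (@integrableS _ _ _ leb setT).
have /= ft := @FTC1Ny R g igy (@open_integrable_locally _ _ _ openT ig).
have F0 x : 0 < x < 2 * pi -> \int[leb]_(t in `]-oo, x]) g t = 0.
  move=> /andP[x0 x2]; have := arc_orth sf fc fs (b := x).
  rewrite x0 x2 => /(_ isT) <-.
  rewrite Rintegral_mkcond [RHS]Rintegral_mkcond; apply: eq_Rintegral => t _.
  have E (i : interval R) : (t \in [set` i]) = (t \in i).
    by apply/idP/idP => [/set_mem|/mem_set].
  rewrite /g !patchE !E !in_itv/=.
  case: (leP t x) => tx; last by rewrite andbF.
  by rewrite (le_lt_trans tx x2) !andbT.
have z0 : {ae leb, forall x, x != 0}.
  exists [set 0]; split => //; first exact: lebesgue_measure_set1.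
  by move=> x /= /negP; rewrite negbK => /eqP.
apply: (filterS2 (ae_filter_ringOfSetsType leb)) ft z0 => x [_ gx] xn0; rewrite /= in_itv/= => /andP[x0 x2].
have xp : 0 < x by rewrite lt_neqAle eq_sym xn0.
have -> : f x = g x by rewrite /g patchE mem_set//= in_itv/= x0.
rewrite -gx derive1E.
have cz : \near x, (fun=> 0 : R) x = \int[leb]_(t in `]-oo, x]) g t.
  near=> t; rewrite F0//; apply/andP; split; near: t.
    exact: lt_nbhsr.
  exact: lt_nbhsl.
by rewrite -(near_eq_derive _ cz) derive_cst.
Unshelve. all: by end_near.
Qed.

End Torus.

Section TorusFourier.
Context (R : realType).
Notation mu := (torus R).
Implicit Types f g : R -> R.
Local Open Scope complex_scope.

Lemma Lnorm2E f : sqi mu f -> 'N[mu]_2%:E[EFin \o f]%E = (nrm mu f)%:E.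
Proof.
move=> sf; rewrite unlock /=.
have -> : (\int[mu]_x (`|(EFin \o f) x| `^ 2) = (ip mu f f)%:E)%E.
  rewrite -ip_intE//; apply: eq_integral => x _ /=.
  by rewrite powR_mulrn// real_normK// num_real.
by rewrite poweR_EFin powR12_sqrt ?ip_ge0.
Qed.

Lemma L2P f : L2 f <-> sqi mu f.
Proof.
split=> [fL|sf].
  split; last exact: Lfun2_integrable_sqr.
  by move: fL; rewrite /L2 /= inE => /andP[]; rewrite inE.
rewrite /L2 /= inE; apply/andP; split; rewrite inE/=; first by case: sf.
by rewrite /finite_norm Lnorm2E// ltry.
Qed.

Lemma L2distE f g : sqi mu f -> sqi mu g ->
  L2dist f g = (nrm mu (fun x => f x - g x))%:E.
Proof. by move=> sf sg; rewrite /L2dist -Lnorm2E//; exact: sqiB. Qed.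

Lemma L20P f : L20 f <-> sqi mu f /\ ip mu f (trig 0) = 0.
Proof.
rewrite /L20 /= L2P; have s0 : (Num.sqrt (2 * pi))^-1 != 0 :> R.
  by rewrite invr_eq0 gt_eqF// sqrtr_gt0 twopi_gt0.
have E : sqi mu f -> ip mu f (trig 0) = (Num.sqrt (2 * pi))^-1 * \int[mu]_x f x.
  move=> sf; rewrite /ip /=; under eq_Rintegral do rewrite mulrC.
  by rewrite RintegralZl//; exact: sqi_integrable.
split=> -[sf f0]; split=> //; first by rewrite E// f0 mulr0.
by move: f0; rewrite E// => /eqP; rewrite mulf_eq0 (negbTE s0) => /eqP.
Qed.

End TorusFourier.

(** * The cut-off equation in real coordinates *)

Ltac posi := repeat first
  [ exact: sqr_ge0 | exact: expR_ge0 | exact: nrm_ge0 | exact: ler0n | by []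
  | assumption | exact: ltW | apply: addr_ge0 | apply: mulr_ge0 | rewrite invr_ge0
  | apply: exprn_ge0 ].

Section Coordinates.
Context (R : realType).
Notation leb := (@lebesgue_measure R).
Implicit Types (a f : nat -> R) (k N : nat).

(** In real coordinates, the derivative and the Airy group act on the pair of coordinates of one
    frequency, which [partner] exchanges, as a multiple of a quarter turn and as a rotation; [sg]
    carries the sign of the rotation. *)
Definition fr k : R := (freq k)%:R.
Definition partner k : nat := if odd k then k.+1 else k.-1.
Definition sg k : R := if odd k then 1 else -1.

Definition sgrp (t : R) a k : R := expR (- (fr k ^+ 2 * t)) *
  (cos (fr k ^+ 3 * t) * a k + sg k * sin (fr k ^+ 3 * t) * a (partner k)).

Definition ddxc f k : R := - sg k * fr k * f (partner k).

Lemma fr_ge0 k : 0 <= fr k. Proof. exact: ler0n. Qed.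

Lemma fr0 : fr 0 = 0. Proof. by []. Qed.

Lemma sg_norm k : `|sg k| = 1.
Proof. by rewrite /sg; case: ifP => _; rewrite ?normrN normr1. Qed.

Lemma sg2 k : sg k * sg k = 1.
Proof. by rewrite /sg; case: ifP => _; rewrite ?mulrNN mulr1. Qed.

Lemma fr_partner k : fr (partner k) = fr k.
Proof.
rewrite /fr /freq /partner; congr (_%:R); case: ifP => ok; last by case: k ok => //= k; lia.
by have := odd_double_half k; rewrite ok; lia.
Qed.

Lemma partnerK k : (0 < k)%N -> partner (partner k) = k.
Proof.
by case: k => // k _; rewrite /partner /=; case ok: (odd k) => /=; rewrite ok.
Qed.

Lemma sg_partner k : (0 < k)%N -> sg (partner k) = - sg k.
Proof.
by case: k => // k _; rewrite /sg /partner /=; case ok: (odd k) => /=; rewrite ok ?opprK.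
Qed.

Lemma sum_partner (b : nat -> R) j : \sum_(k < j.*2.+1) b (partner k) = \sum_(k < j.*2.+1) b k.
Proof.
elim: j => [|j ih]; first by rewrite !big_ord1.
rewrite doubleS [LHS]big_ord_recr/= [in LHS]big_ord_recr/=.
rewrite [RHS]big_ord_recr/= [in RHS]big_ord_recr/= ih.
rewrite /partner /= odd_double /= -!addrA; congr (_ + _).
by rewrite addrC.
Qed.

Lemma sum_partner_le (b : nat -> R) N : (forall k, 0 <= b k) ->
  \sum_(k < N) b (partner k) <= \sum_(k < N.*2.+1) b k.
Proof.
move=> b0; rewrite -sum_partner -!(big_mkord xpredT (fun k => b (partner k))).
rewrite [leRHS](big_cat_nat _ (n := N))//=; last by lia.
by rewrite lerDl sumr_ge0.
Qed.

Lemma sgrp_bdd t a k (M : R) : (forall j, `|a j| <= M) -> `|sgrp t a k| <= 2 * M * expR (- (fr k ^+ 2 * t)).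
Proof.
move=> aM; rewrite /sgrp normrM ger0_norm ?expR_ge0// mulrC ler_wpM2r ?expR_ge0//.
rewrite (le_trans (ler_normD _ _))// mulr_natl mulr2n; apply: lerD.
  by rewrite normrM -[leRHS]mul1r ler_pM// cos_max.
rewrite normrM normrM sg_norm mul1r -[leRHS]mul1r ler_pM//; exact: sin_max.
Qed.

Lemma sgrp_ddxc_bdd t f k (M : R) : (forall j, `|f j| <= M) ->
  `|sgrp t (ddxc f) k| <= 2 * M * fr k * expR (- (fr k ^+ 2 * t)).
Proof.
move=> fM; have M0 : 0 <= M by exact: le_trans (normr_ge0 _) (fM 0%N).
pose g j := if fr j == fr k then ddxc f j else 0.
have -> : sgrp t (ddxc f) k = sgrp t g k by rewrite /sgrp /g fr_partner eqxx.
set E := expR _; rewrite (_ : 2 * M * fr k * E = 2 * (M * fr k) * E); last by ring.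
apply: sgrp_bdd => j; rewrite /g; case: eqP => [jk|_]; last by rewrite normr0 mulr_ge0// fr_ge0.
rewrite /ddxc !normrM normrN sg_norm mul1r jk (ger0_norm (fr_ge0 k)) mulrC.
by rewrite ler_wpM2r ?fr_ge0.
Qed.

Lemma sgrp_linB t a b k : sgrp t a k - sgrp t b k = sgrp t (fun j => a j - b j) k.
Proof. by rewrite /sgrp; ring. Qed.

Lemma sgrp_sqr t a k : 0 <= t -> sgrp t a k ^+ 2 <= 2 * (a k ^+ 2 + a (partner k) ^+ 2).
Proof.
move=> t0; rewrite /sgrp; set E := expR _; set C := cos _; set S := sin _.
have E1 : E <= 1 by rewrite expR_le1// oppr_le0 mulr_ge0// sqr_ge0.
have E0 : 0 <= E by exact: expR_ge0.
have C1 : C ^+ 2 <= 1 by have := cos2Dsin2 (fr k ^+ 3 * t); have := sqr_ge0 S; rewrite -/C -/S; lra.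
have S1 : S ^+ 2 <= 1 by have := cos2Dsin2 (fr k ^+ 3 * t); have := sqr_ge0 C; rewrite -/C -/S; lra.
rewrite exprMn (@le_trans _ _ ((C * a k + sg k * S * a (partner k)) ^+ 2))//.
  by rewrite ler_piMl ?sqr_ge0// expr_le1.
set x := C * _; set y := _ * a (partner k).
have hx : x ^+ 2 <= a k ^+ 2 by rewrite exprMn ler_piMl ?sqr_ge0.
have hy : y ^+ 2 <= a (partner k) ^+ 2.
  by rewrite !exprMn [sg k ^+ 2]expr2 sg2 mul1r ler_piMl ?sqr_ge0.
have := sqr_ge0 (x - y); nra.
Qed.

(** [freq k >= k / 2], so the sum over [k] telescopes. *)
Lemma sum_kernel (m N1 N2 : nat) : (0 < m)%N -> (N1 <= N2)%N ->
  \sum_(N1 <= k < N2) (fr k / (fr k ^+ 2 + m%:R ^+ 2)) ^+ 2 <= 8 / (N1%:R + m%:R).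
Proof.
move=> m0 N12; have M1 : 1 <= m%:R :> R by rewrite ler1n.
have step k : (fr k / (fr k ^+ 2 + m%:R ^+ 2)) ^+ 2 <=
    8 / (k%:R + m%:R) - 8 / (k.+1%:R + m%:R).
  have n2k : k%:R <= 2 * fr k.
    by rewrite /fr /freq -natrM ler_nat uphalf_half; have := odd_double_half k; lia.
  set n := fr k in n2k *; set M : R := m%:R in M1 *.
  have n0 : 0 <= n by exact: fr_ge0.
  have k0 : 0 <= k%:R :> R by exact: ler0n.
  have p1 : 0 < n ^+ 2 + M ^+ 2 by nra.
  have p2 : 0 < (k%:R + M) * (k.+1%:R + M) by rewrite -natr1; nra.
  apply: (@le_trans _ _ ((n ^+ 2 + M ^+ 2)^-1)).
    rewrite expr_div_n ler_pdivrMr ?exprn_gt0//.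
    rewrite (_ : _^-1 * _ = n ^+ 2 + M ^+ 2); last by field; rewrite gt_eqF.
    by rewrite lerDl sqr_ge0.
  rewrite (_ : 8 / _ - _ = 8 / ((k%:R + M) * (k.+1%:R + M))); last first.
    by rewrite -natr1; field; rewrite !gt_eqF//; lra.
  have h1 : (k%:R + M) * (k.+1%:R + M) <= (2 * n + M) * (2 * n + 2 * M).
    by apply: ler_pM; rewrite -?natr1; lra.
  have h2 := sqr_ge0 (n - M).
  rewrite ler_pdivlMr// mulrC ler_pdivrMr//; nra.
rewrite (le_trans (ler_sum_nat (fun k _ => step k)))//.
rewrite (@telescope_sumr_eq _ _ _ (fun k => - (8 / (k%:R + m%:R))))//; last first.
  by move=> k _; rewrite opprK addrC.
by rewrite opprK addrC gerBl divr_ge0// addr_ge0.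
Qed.

End Coordinates.

Lemma cvg_bound (R : realType) (I : Type) (F : set_system I) (FF : Filter F)
    (f g : I -> R) (l : R) :
  g @ F --> (0 : R) -> (forall s, `|f s - l| <= g s) -> f @ F --> l.
Proof.
move=> g0 fg; apply/cvgrPdist_le => e e0.
move/cvgrPdist_le : g0 => /(_ _ e0); apply: filterS => s.
rewrite sub0r normrN => h; rewrite distrC.
by apply: le_trans (fg s) (le_trans (ler_norm _) h).
Qed.

Lemma cvg_ordsum (R : realType) (I : Type) (F : set_system I) (FF : Filter F) (N : nat)
    (f : nat -> I -> R) (l : nat -> R) : (forall k, f k @ F --> l k) ->
  (fun x => \sum_(k < N) f k x) @ F --> \sum_(k < N) l k.
Proof.
move=> fl; elim: N => [|N ih].
  by rewrite big_ord0; under eq_fun do rewrite big_ord0; exact: cvg_cst.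
by rewrite big_ord_recr/=; under eq_fun do rewrite big_ord_recr/=; exact: cvgD.
Qed.

Lemma ler1_expR (R : realType) (x : R) : 0 <= x -> 1 <= expR x.
Proof. by move=> x0; rewrite -[leLHS]expR0 ler_expR. Qed.

Lemma cts_max0 (R : realType) : continuous (fun s : R => Num.max 0 s).
Proof.
have -> : (fun s : R => Num.max 0 s) = (fun s => 2^-1 * (s + `|s|)).
  by apply/funext => s; case: leP => s0; [rewrite ger0_norm//|rewrite ltr0_norm//]; field.
move=> s; apply: cvgM; first exact: cvg_cst.
by apply: cvgD; [exact: cvg_id|apply: cvg_norm; exact: cvg_id].
Qed.

Section TimeIntegral.
Context (R : realType).
Notation leb := (@lebesgue_measure R).
Implicit Types g : R -> R.

Definition pint g (t : R) : R := \int[leb]_(s in `[0, t]) g s.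

Lemma pint_le0 g t : t <= 0 -> pint g t = 0.
Proof.
rewrite le_eqVlt => /predU1P[->|t0]; first by rewrite /pint set_itv1 Rintegral_set1.
by rewrite /pint set_itv_ge ?Rintegral_set0// bnd_simp -ltNge.
Qed.

Lemma pint_eq g h t : (forall s, 0 <= s <= t -> g s = h s) -> pint g t = pint h t.
Proof. by move=> gh; apply: eq_Rintegral => s; rewrite inE/= in_itv/=; exact: gh. Qed.

Lemma pintD g h t : continuous g -> continuous h ->
  pint (fun s => g s + h s) t = pint g t + pint h t.
Proof. by move=> cg ch; rewrite /pint RintegralD//; exact: cont_integrable. Qed.

Lemma pintB g h t : continuous g -> continuous h ->
  pint (fun s => g s - h s) t = pint g t - pint h t.
Proof. by move=> cg ch; rewrite /pint RintegralB//; exact: cont_integrable. Qed.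

Lemma pintZ c g t : continuous g -> pint (fun s => c * g s) t = c * pint g t.
Proof. by move=> cg; rewrite /pint RintegralZl//; exact: cont_integrable. Qed.

Lemma pint_ge0 g t : (forall s, 0 <= s <= t -> 0 <= g s) -> 0 <= pint g t.
Proof. by move=> g0; apply: Rintegral_ge0 => s /=; rewrite in_itv/=; exact: g0. Qed.

Lemma le_pint g h t : continuous g -> continuous h ->
  (forall s, 0 <= s <= t -> g s <= h s) -> pint g t <= pint h t.
Proof.
move=> cg ch gh; apply: le_Rintegral; [by []|exact: cont_integrable|exact: cont_integrable|].
by move=> s; rewrite /= in_itv/=; exact: gh.
Qed.

Lemma pint_norm g t : continuous g -> `|pint g t| <= pint (fun s => `|g s|) t.
Proof. by move=> cg; apply: le_normr_Rintegral => //; exact: cont_integrable. Qed.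

Lemma pint_FTC2 g (G : R -> R) t : 0 <= t -> continuous g ->
  (forall x : R, is_derive x (1 : R) G (g x)) -> pint g t = G t - G 0.
Proof. by move=> t0 cg dG; rewrite /pint (FTC2 t0 cg dG). Qed.

Lemma pint_derive g (t : R) : continuous g -> 0 < t -> is_derive t (1 : R) (pint g) (g t).
Proof.
move=> cg t0.
have [d1 d2] := @continuous_FTC1_closed R g 0 t (t + 1) (ltr_pwDr ltr01 (lexx _))
  (cont_integrable 0 (t + 1) cg) t0 (cg t).
apply: DeriveDef; first exact: d1.
by rewrite -derive1E; exact: d2.
Qed.

Lemma pint_cts g : continuous g -> continuous (pint g).
Proof.
move=> cg t; pose a : R := - `|t| - 1.
have a0 : a < 0 by have := normr_ge0 t; rewrite /a; lra.
have at' : a < t by have := ler_norm (- t); rewrite normrN /a; lra.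
pose G (s : R) := \int[leb]_(r in `[a, s]) g r.
have E s : pint g s = G (Num.max 0 s) - G 0.
  have [s0|s0] := leP 0 s; last by rewrite pint_le0 ?subrr// ltW.
  rewrite /G Rintegral_itvB; last 3 first.
  - exact: cont_integrable.
  - by rewrite bnd_simp ltW.
  - by rewrite bnd_simp.
  by rewrite Rintegral_itv_obnd_cbnd//; apply: integrableS (cont_integrable 0 s cg) => //;
    exact: subset_itv_oc_cc.
have -> : pint g = fun s => G (Num.max 0 s) - G 0 by apply/funext.
apply: cvgB; last exact: cvg_cst.
have am : a < Num.max 0 t by rewrite lt_max a0.
have [dG _] := @continuous_FTC1_closed R g a (Num.max 0 t) (Num.max 0 t + 1)
  (ltr_pwDr ltr01 (lexx _)) (cont_integrable _ _ cg) am (cg _).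
have cG : {for Num.max 0 t, continuous G}.
  by apply/differentiable_continuous/derivable1_diffP.
apply: (@continuous_comp R R R (fun s => Num.max 0 s) G t _ cG).
exact: cts_max0.
Qed.

End TimeIntegral.

Section Paths.
Context (R : realType).
Notation leb := (@lebesgue_measure R).
Notation mu := (torus R).
Implicit Types (f g : R -> R) (U V F : R -> R -> R).

Lemma nrm_bddM f g : sqi mu f -> measurable_fun [set: R] g -> (forall x, `|g x| <= 1) ->
  nrm mu (fun x => f x * g x) <= nrm mu f.
Proof.
move=> sf mg g1; have sfg : sqi mu (fun x => f x * g x) by exact: sqi_bddM sf mg g1.
rewrite -ler_sqr ?nnegrE ?nrm_ge0// !nrm2 /ip; apply: le_Rintegral => //.
- exact: sqiM.
- exact: sqiM.
- move=> x _; rewrite -!expr2 exprMn ler_piMr ?sqr_ge0// -real_normK ?num_real//.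
  by rewrite expr_le1.
Qed.

(** The coordinates of [f ^ 2], meaningful for square-integrable [f] since [trig k] is bounded. *)
Definition quad (k : nat) f : R := ip mu f (fun x => f x * trig k x).

Lemma sqi_trigM f k : sqi mu f -> sqi mu (fun x => f x * trig k x).
Proof.
move=> sf; apply: (@sqi_bddM _ _ _ _ _ _ 1) => //; last exact: trig_bdd.
by case: (sqi_trig R k).
Qed.

Lemma nrm_trigM f k : sqi mu f -> nrm mu (fun x => f x * trig k x) <= nrm mu f.
Proof.
by move=> sf; apply: nrm_bddM => //; [case: (sqi_trig R k)|exact: trig_bdd].
Qed.

(** [f ^ 2 - g ^ 2 = (f - g) f + g (f - g)], and [trig k] is bounded by 1. *)
Lemma quadB f g k : sqi mu f -> sqi mu g ->
  `|quad k f - quad k g| <= nrm mu (fun x => f x - g x) * (nrm mu f + nrm mu g).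
Proof.
move=> sf sg; have sfg := sqiB sf sg.
have -> : quad k f - quad k g = ip mu (fun x => f x - g x) (fun x => f x * trig k x) +
    ip mu g (fun x => (f x - g x) * trig k x).
  rewrite ipBl//; last exact: sqi_trigM.
  under [X in _ = _ + ip _ _ X]eq_fun do rewrite mulrBl.
  by rewrite ipBr//; try exact: sqi_trigM; rewrite addrA subrK.
rewrite (le_trans (ler_normD _ _))// mulrDr; apply: lerD.
  apply: le_trans (cauchy_schwarz sfg (sqi_trigM k sf)) _.
  by rewrite ler_wpM2l ?nrm_ge0// nrm_trigM.
apply: le_trans (cauchy_schwarz sg (sqi_trigM k sfg)) _.
by rewrite mulrC ler_wpM2r ?nrm_ge0// nrm_trigM.
Qed.

Lemma quad_bdd f k : sqi mu f -> `|quad k f| <= nrm mu f ^+ 2.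
Proof.
move=> sf; apply: le_trans (cauchy_schwarz sf (sqi_trigM k sf)) _.
by rewrite expr2 ler_wpM2l ?nrm_ge0// nrm_trigM.
Qed.

(** Paths in [C(R; L2)]. Times range over the whole line, so that no restriction to an interval
    has to be carried along; paths on [[0, T]] are extended by constants. *)
Definition tcont U := (forall t, sqi mu (U t)) /\
  forall t, nrm mu (fun x => U s x - U t x) @[s --> t] --> (0 : R).

Lemma tcont_cst f : sqi mu f -> tcont (fun=> f).
Proof.
move=> sf; split=> // t; rewrite (_ : (fun s : R => _) = cst 0); first exact: cvg_cst.
by apply/funext => s /=; rewrite -[RHS](nrm0 mu); congr nrm; apply/funext => x; rewrite subrr.
Qed.

Lemma tcontD U V : tcont U -> tcont V -> tcont (fun t x => U t x + V t x).
Proof.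
move=> [sU cU] [sV cV]; split=> [t|t]; first exact: sqiD.
have c : nrm mu (fun x => U s x - U t x) + nrm mu (fun x => V s x - V t x) @[s --> t] -->
    (0 + 0 : R) by apply: cvgD; [exact: cU|exact: cV].
rewrite addr0 in c; apply: cvg_bound c _ => s.
rewrite subr0 ger0_norm ?nrm_ge0//.
have := ler_nrmD (sqiB (sU s) (sU t)) (sqiB (sV s) (sV t)); apply: le_trans.
by rewrite le_eqVlt; apply/orP; left; apply/eqP; congr nrm; apply/funext => x; ring.
Qed.

Lemma tcont_nrm U : tcont U -> continuous (fun t => nrm mu (U t)).
Proof.
move=> [sU cU] t; apply: cvg_bound (cU t) _ => s; exact: ler_dist_nrm.
Qed.

Lemma tcont_ip U g : tcont U -> sqi mu g -> continuous (fun t => ip mu (U t) g).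
Proof.
move=> [sU cU] sg t.
have c : nrm mu (fun x => U s x - U t x) * nrm mu g @[s --> t] --> 0 * nrm mu g.
  by apply: cvgM; [exact: cU|exact: cvg_cst].
rewrite mul0r in c; apply: cvg_bound c _ => s.
by rewrite -ipBl//; apply: cauchy_schwarz => //; exact: sqiB.
Qed.

Lemma tcont_quad U k : tcont U -> continuous (fun t => quad k (U t)).
Proof.
move=> tU t; have [sU cU] := tU.
have c : nrm mu (fun x => U s x - U t x) * (nrm mu (U s) + nrm mu (U t)) @[s --> t] -->
    0 * (nrm mu (U t) + nrm mu (U t)).
  by apply: cvgM; [exact: cU|apply: cvgD; [exact: tcont_nrm|exact: cvg_cst]].
by rewrite mul0r in c; apply: cvg_bound c _ => s; exact: quadB.
Qed.


(** The Duhamel integral of the forcing whose coordinates are those of minus the derivative of [f]. *)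
Definition duhamel (f : R -> nat -> R) (t : R) (k : nat) : R :=
  pint (fun s => sgrp (t - s) (ddxc (f s)) k) t.

Lemma cts_scale (c : R) : continuous (fun s : R => c * s).
Proof. by move=> s; apply: cvgM; [exact: cvg_cst|exact: cvg_id]. Qed.

Lemma cts_expR_lin (c : R) : continuous (fun s => expR (c * s)).
Proof.
move=> s; suff : {for s, continuous (expR \o (fun y : R => c * y))} by [].
by apply: continuous_comp; [exact: cts_scale|exact: continuous_expR].
Qed.

Lemma cts_expR_linN (c : R) : continuous (fun s => expR (- (c * s))).
Proof.
have -> : (fun s => expR (- (c * s))) = (fun s => expR (- c * s)).
  by apply/funext => s; rewrite mulNr.
exact: cts_expR_lin.
Qed.

Lemma cts_cos_lin (c : R) : continuous (fun s => cos (c * s)).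
Proof.
move=> s; suff : {for s, continuous (cos \o (fun y : R => c * y))} by [].
by apply: continuous_comp; [exact: cts_scale|exact: continuous_cos].
Qed.

Lemma cts_sin_lin (c : R) : continuous (fun s => sin (c * s)).
Proof.
move=> s; suff : {for s, continuous (sin \o (fun y : R => c * y))} by [].
by apply: continuous_comp; [exact: cts_scale|exact: continuous_sin].
Qed.

Lemma pint_expR (c t : R) : 0 <= t -> c != 0 ->
  pint (fun s => expR (c * s)) t = c^-1 * expR (c * t) - c^-1.
Proof.
move=> t0 c0; have dG (x : R) : is_derive x (1 : R) (fun s => c^-1 * expR (c * s)) (expR (c * x)).
  by apply: is_derive_eq; rewrite /GRing.scale/=; field.
by rewrite (pint_FTC2 t0 (@cts_expR_lin c) dG) mulr0 expR0 mulr1.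
Qed.

(** The integrand of the [k]-th coordinate in the frame rotating with the semigroup. *)
Definition rotf (b : R -> nat -> R) (k : nat) (s : R) : R :=
  expR (fr R k ^+ 2 * s) *
  (cos (fr R k ^+ 3 * s) * b s k - sg R k * sin (fr R k ^+ 3 * s) * b s (partner k)).

Lemma cts_rotf b k : (forall j, continuous (fun s => b s j)) -> continuous (rotf b k).
Proof.
move=> cb s; apply: cvgM; first exact: cts_expR_lin.
apply: cvgB; first by apply: cvgM; [exact: cts_cos_lin|exact: cb].
apply: cvgM; last exact: cb.
by apply: cvgM; [exact: cvg_cst|exact: cts_sin_lin].
Qed.

(** The semigroup property, in the form of the addition formulas for [exp], [cos] and [sin]. *)
Lemma sgrp_rotf b (t s : R) k : sgrp (t - s) (b s) k =
  expR (- (fr R k ^+ 2 * t)) * (cos (fr R k ^+ 3 * t) * rotf b k s +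
    sg R k * sin (fr R k ^+ 3 * t) * rotf b (partner k) s).
Proof.
case: k => [|k]; last first.
  rewrite /sgrp /rotf fr_partner partnerK// sg_partner//.
  rewrite (_ : - (_ * (t - s)) = - (fr R k.+1 ^+ 2 * t) + fr R k.+1 ^+ 2 * s); last by ring.
  rewrite [_ ^+ 3 * (t - s)]mulrBr sinB cosB expRD; set E := expR _; set E' := expR _.
  have := sg2 R k.+1; set sk := sg R k.+1 => sk2.
  set C := cos _; set S := sin _; set c := cos _; set s' := sin _.
  apply/eqP; rewrite -subr_eq0; apply/eqP.
  transitivity ((1 - sk * sk) * (E * E' * S * s' * b s k.+1)); first by ring.
  by rewrite sk2 subrr mul0r.
rewrite /sgrp /rotf fr0 !expr0n/= !mul0r oppr0 expR0 sin0 cos0; ring.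
Qed.

(** The semigroup property separates [t] from [s], so that the integral over [s] depends on [t]
    only through its upper bound. *)
Lemma duhamelE (f : R -> nat -> R) t k : (forall j, continuous (fun s => f s j)) ->
  duhamel f t k = expR (- (fr R k ^+ 2 * t)) *
   (cos (fr R k ^+ 3 * t) * pint (rotf (fun s => ddxc (f s)) k) t +
    sg R k * sin (fr R k ^+ 3 * t) * pint (rotf (fun s => ddxc (f s)) (partner k)) t).
Proof.
move=> cf; have cd j : continuous (fun s => ddxc (f s) j).
  by move=> s; apply: cvgM; [exact: cvg_cst|exact: cf].
have cr j := @cts_rotf (fun s => ddxc (f s)) j cd.
have cc c g : continuous g -> continuous (fun s : R => c * g s).
  by move=> cg s; apply: cvgM; [exact: cvg_cst|exact: cg].
rewrite /duhamel.
under [X in pint X]eq_fun do rewrite (sgrp_rotf (fun s => ddxc (f s))).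
rewrite pintZ; last by move=> s; apply: cvgD; exact: cc.
by rewrite pintD ?pintZ//; exact: cc.
Qed.

Lemma duhamel_cts (f : R -> nat -> R) k : (forall j, continuous (fun s => f s j)) ->
  continuous (fun t => duhamel f t k).
Proof.
move=> cf; have cd j : continuous (fun s => ddxc (f s) j).
  by move=> s; apply: cvgM; [exact: cvg_cst|exact: cf].
under eq_fun do rewrite duhamelE//.
move=> t; apply: cvgM.
  exact: cts_expR_linN.
apply: cvgD; first by apply: cvgM; [exact: cts_cos_lin|apply: pint_cts; exact: cts_rotf].
apply: cvgM; last by apply: pint_cts; exact: cts_rotf.
by apply: cvgM; [exact: cvg_cst|exact: cts_sin_lin].
Qed.

Lemma cts_sgrpB (t : R) k (c : R -> nat -> R) :
  (forall j, continuous (fun s => c s j)) -> continuous (fun s => sgrp (t - s) (c s) k).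
Proof.
move=> cc; under eq_fun do rewrite sgrp_rotf.
have cr j := @cts_rotf c j cc.
move=> s; apply: cvgM; first exact: cvg_cst.
by apply: cvgD; apply: cvgM; try exact: cvg_cst; exact: cr.
Qed.

Lemma duhamelB (f g : R -> nat -> R) t k : (forall j, continuous (fun s => f s j)) ->
  (forall j, continuous (fun s => g s j)) ->
  duhamel f t k - duhamel g t k = duhamel (fun s j => f s j - g s j) t k.
Proof.
move=> cf cg; rewrite /duhamel.
have cd (h : R -> nat -> R) j : (forall j, continuous (fun s => h s j)) -> continuous (fun s => ddxc (h s) j).
  by move=> ch s; apply: cvgM; [exact: cvg_cst|exact: ch].
rewrite -pintB; try by apply: cts_sgrpB => // j; exact: cd.
congr pint; apply/funext => s; rewrite sgrp_linB; congr sgrp.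
by apply/funext => j; rewrite /ddxc; ring.
Qed.

(** The weight [e^{m^2 t}] gains the decaying factor [fr k / (fr k ^ 2 + m ^ 2)]. *)
Lemma duhamel_bdd (f : R -> nat -> R) (t M : R) (m k : nat) : (0 < m)%N -> 0 <= t ->
  (forall j, continuous (fun s => f s j)) ->
  (forall s j, 0 <= s <= t -> `|f s j| <= M * expR (m%:R ^+ 2 * s)) ->
  `|duhamel f t k| <= 2 * M * (fr R k / (fr R k ^+ 2 + m%:R ^+ 2)) * expR (m%:R ^+ 2 * t).
Proof.
move=> m0 t0 cf fM; set n := fr R k; set g := m%:R ^+ 2.
have g0 : 0 < g by rewrite exprn_gt0// ltr0n.
have n0 : 0 <= n by exact: fr_ge0.
have ng : 0 < n ^+ 2 + g by rewrite ltr_pwDr// sqr_ge0.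
have M0 : 0 <= M.
  have := fM 0 0%N; rewrite lexx t0 mulr0 expR0 mulr1 => /(_ isT); exact: le_trans.
have cd j : continuous (fun s => ddxc (f s) j).
  by move=> s; apply: cvgM; [exact: cvg_cst|exact: cf].
have ci := @cts_sgrpB t k (fun s => ddxc (f s)) cd.
apply: (le_trans (pint_norm _ ci)).
pose G s := 2 * M * n * expR (- (n ^+ 2 * t)) * expR ((n ^+ 2 + g) * s).
have cG : continuous G by move=> s; apply: cvgM; [exact: cvg_cst|exact: cts_expR_lin].
apply: (@le_trans _ _ (pint G t)).
  apply: le_pint => //; first by move=> s; apply: cvg_norm; exact: ci.
  move=> s st; apply: le_trans (sgrp_ddxc_bdd _ _ (fun j => fM s j st)) _.
  rewrite /G -/n le_eqVlt; apply/orP; left; apply/eqP.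
  rewrite -[RHS]mulrA -expRD [LHS](_ : _ = 2 * M * n * (expR (g * s) * expR (- (n ^+ 2 * (t - s))))); last by ring.
  by rewrite -expRD; congr (_ * expR _); ring.
rewrite /G pintZ; last exact: cts_expR_lin.
rewrite pint_expR ?gt_eqF//.
apply: (@le_trans _ _ (2 * M * n * expR (- (n ^+ 2 * t)) * ((n ^+ 2 + g)^-1 * expR ((n ^+ 2 + g) * t)))).
  rewrite ler_wpM2l//; first by rewrite !mulr_ge0// expR_ge0.
  by rewrite gerBl invr_ge0 ltW.
rewrite le_eqVlt; apply/orP; left; apply/eqP.
transitivity (2 * M * (n / (n ^+ 2 + g)) * (expR (- (n ^+ 2 * t)) * expR ((n ^+ 2 + g) * t))); first by ring.
by rewrite -expRD; congr (_ * expR _); ring.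
Qed.

End Paths.

Section Synthesis.
Context (R : realType).
Notation mu := (torus R).
Implicit Types (a b : nat -> R) (c : R -> nat -> R).

Definition summ a := exists M, forall N, \sum_(k < N) a k ^+ 2 <= M.

Lemma synth_ex a : exists f : R -> R, sqi mu f /\ (summ a -> forall k, ip mu f (trig k) = a k).
Proof.
have [[M aM]|na] := pselect (summ a); last by exists (fun=> 0); split => //; exact: sqi0.
have [f [sf fa _]] := riesz_fischer (@sqi_trig R) (@orth_trig R) aM.
by exists f.
Qed.

(** One function realising all square-summable sequences at once makes the Picard iterates
    functions of the data, which is what lets measurability propagate through them. *)
Lemma synth_sig : {s : (nat -> R) -> R -> R |
  forall a, sqi mu (s a) /\ (summ a -> forall k, ip mu (s a) (trig k) = a k)}.
Proof. by apply: cid; have [s hs] := choice synth_ex; exists s. Qed.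

Definition synth : (nat -> R) -> R -> R := sval synth_sig.

Lemma sqi_synth a : sqi mu (synth a).
Proof. by case: (svalP synth_sig a). Qed.

Lemma synth_coord a k : summ a -> ip mu (synth a) (trig k) = a k.
Proof. by case: (svalP synth_sig a) => _ h /h. Qed.

Lemma nrm_le_trig (f : R -> R) (M : R) : sqi mu f ->
  (forall N, \sum_(k < N) ip mu f (trig k) ^+ 2 <= M) -> nrm mu f ^+ 2 <= M.
Proof. exact: (nrm_le_coord (@sqi_trig R) (@orth_trig R) (@trig_total R)). Qed.

Lemma bessel_trig (f : R -> R) N : sqi mu f ->
  \sum_(k < N) ip mu f (trig k) ^+ 2 <= nrm mu f ^+ 2.
Proof. exact: (bessel (@sqi_trig R) (@orth_trig R)). Qed.

Lemma coord_le_trig (f : R -> R) k : sqi mu f -> `|ip mu f (trig k)| <= nrm mu f.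
Proof. exact: (coord_le (@sqi_trig R) (@orth_trig R)). Qed.

Lemma sum_tail b (M : R) : (forall k, 0 <= b k) -> (forall N, \sum_(k < N) b k <= M) ->
  forall e : R, 0 < e -> exists N, forall N', (N <= N')%N -> \sum_(N <= k < N') b k <= e.
Proof.
move=> b0 bM e e0; have cs : cvgn (series b).
  apply: nondecreasing_is_cvgn; first exact: nondecreasing_series.
  by exists M => _ [n _ <-]; rewrite /series/= big_mkord.
have sl n : series b n <= limn (series b).
  by apply: nondecreasing_cvgn_le => //; exact: nondecreasing_series.
move/cvgrPdist_le : cs => /(_ _ e0)[N _ HN]; exists N => N' NN'.
have := HN N (leqnn N); have := sl N'; rewrite /series/= (big_cat_nat _ NN')//= => h1 h2.
have := ler_norm (limn (series b) - \sum_(0 <= k < N) b k); rewrite /series/= in h1 h2 *; lra.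
Qed.

(** The tail of a dominated family is uniformly small on a bounded set of times, and finitely many
    continuous coordinates remain. *)
Lemma tcont_synth c : (forall k, continuous (fun t => c t k)) ->
  (forall T : R, exists b, (exists M, forall N, \sum_(k < N) b k <= M) /\
     forall t k, t <= T -> c t k ^+ 2 <= b k) ->
  tcont (fun t => synth (c t)) /\ forall t k, ip mu (synth (c t)) (trig k) = c t k.
Proof.
move=> cc cb.
have sc t : summ (c t).
  have [b [[M bM] h]] := cb t; exists M => N; apply: le_trans (bM N).
  by apply: ler_sum => k _; exact: h.
have cE t k : ip mu (synth (c t)) (trig k) = c t k by exact: synth_coord.
split=> //; split=> [t|t]; first exact: sqi_synth.
apply/cvgrPdist_le => e e0.
have [b [[M bM] h]] := cb (t + 1).
have b0 k : 0 <= b k by apply: le_trans (sqr_ge0 _) (h t k _); rewrite lerDl.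
have e1 : 0 < e ^+ 2 / 8 by rewrite divr_gt0// exprn_gt0.
have [N HN] := sum_tail b0 bM e1.
have cN : \sum_(k < N) (c s k - c t k) ^+ 2 @[s --> t] --> \sum_(k < N) (c t k - c t k) ^+ 2.
  apply: (@cvg_ordsum _ _ _ _ _ (fun k s => (c s k - c t k) ^+ 2)
    (fun k => (c t k - c t k) ^+ 2)) => k.
  by apply: cvg_sqr; apply: cvgB; [exact: cc|exact: cvg_cst].
rewrite [X in _ --> X]big1 in cN; last by move=> k _; rewrite subrr expr0n.
have e2 : 0 < e ^+ 2 / 2 by rewrite divr_gt0// exprn_gt0.
move/cvgrPdist_le : cN => /(_ _ e2) cN.
near=> s; rewrite sub0r normrN ger0_norm ?nrm_ge0//.
have sd := sqiB (sqi_synth (c s)) (sqi_synth (c t)).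
rewrite -ler_sqr ?nnegrE ?nrm_ge0 ?(ltW e0)//.
have st : s <= t + 1.
  have : `|t - s| <= 1 by near: s; apply: cvgr_dist_le.
  by rewrite ler_norml => /andP[]; lra.
have hs : \sum_(k < N) (c s k - c t k) ^+ 2 <= e ^+ 2 / 2.
  have : `|0 - \sum_(k < N) (c s k - c t k) ^+ 2| <= e ^+ 2 / 2 by near: s.
  by rewrite sub0r normrN; apply: le_trans; exact: ler_norm.
apply: nrm_le_trig => // N'.
under eq_bigr do rewrite (ipBl (sqi_synth _) (sqi_synth _) (sqi_trig R _)) !cE.
apply: (@le_trans _ _ (\sum_(k < N + N') (c s k - c t k) ^+ 2)).
  rewrite -!(big_mkord xpredT (fun k => (c s k - c t k) ^+ 2)).
  rewrite [leRHS](big_cat_nat _ (n := N'))//=; last exact: leq_addl.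
  by rewrite lerDl sumr_ge0// => k _; rewrite sqr_ge0.
rewrite -(big_mkord xpredT (fun k => (c s k - c t k) ^+ 2)).
rewrite (big_cat_nat _ (n := N))//=; last exact: leq_addr.
rewrite big_mkord (_ : e ^+ 2 = e ^+ 2 / 2 + e ^+ 2 / 2); last by field.
apply: lerD => //.
apply: (@le_trans _ _ (\sum_(N <= k < N + N') 4 * b k)).
  apply: ler_sum => k _; have := h s k st; have := h t k; rewrite lerDl ler01 => /(_ isT).
  have := sqr_ge0 (c s k + c t k); nra.
rewrite -mulr_sumr; have := HN _ (leq_addr N' N); lra.
Unshelve. all: by end_near.
Qed.

End Synthesis.

Section Picard.
Context (R : realType).
Notation mu := (torus R).
Implicit Types (f g : R -> R) (U V W F : R -> R -> R).

Definition tp (t : R) : R := Num.max 0 t.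

Lemma tp_ge0 t : 0 <= tp t. Proof. by rewrite /tp le_max lexx. Qed.

Lemma tp_id t : 0 <= t -> tp t = t. Proof. by move=> t0; rewrite /tp; apply/max_idPr. Qed.

(** Radial truncation to the ball of radius [A]; it turns the quadratic nonlinearity into a
    globally Lipschitz one, and is the identity on the ball. *)
Definition cut (A : R) f : R -> R := fun x => (A / Num.max A (nrm mu f)) * f x.

Lemma sqi_cut A f : sqi mu f -> sqi mu (cut A f). Proof. exact: sqiZ. Qed.

Lemma cut_le A f : 0 < A -> sqi mu f -> nrm mu (cut A f) <= A.
Proof.
move=> A0 sf; have m0 : 0 < Num.max A (nrm mu f) by rewrite lt_max A0.
rewrite nrmZ// ger0_norm ?divr_ge0 ?(ltW A0) ?(ltW m0)//.
rewrite mulrAC ler_pdivrMr// ler_wpM2l ?(ltW A0)//.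
by rewrite le_max lexx orbT.
Qed.

Lemma cut_id A f : 0 < A -> nrm mu f <= A -> cut A f = f.
Proof.
move=> A0 fA; apply/funext => x; rewrite /cut; move/max_idPl : fA => ->.
by rewrite divff ?gt_eqF// mul1r.
Qed.

Lemma cutB A f g : 0 < A -> sqi mu f -> sqi mu g ->
  nrm mu (fun x => cut A f x - cut A g x) <= 2 * nrm mu (fun x => f x - g x).
Proof.
move=> A0 sf sg; have sfg := sqiB sf sg.
set mf := Num.max A (nrm mu f); set mg := Num.max A (nrm mu g).
have mf0 : 0 < mf by rewrite lt_max A0.
have mg0 : 0 < mg by rewrite lt_max A0.
have Af : A / mf <= 1 by rewrite ler_pdivrMr// mul1r le_max lexx.
have -> : (fun x => cut A f x - cut A g x) =
    (fun x => A / mf * (f x - g x) + (A / mf - A / mg) * g x).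
  by apply/funext => x; rewrite /cut; ring.
apply: le_trans (ler_nrmD (sqiZ _ sfg) (sqiZ _ sg)) _.
rewrite !nrmZ// mulr_natl mulr2n; apply: lerD.
  by rewrite ger0_norm ?divr_ge0 ?(ltW A0) ?(ltW mf0)// ler_piMl ?nrm_ge0.
have mB : `|mg - mf| <= nrm mu (fun x => f x - g x).
  have := ler_dist_nrm sf sg; set n := nrm mu (fun x => f x - g x).
  rewrite !ler_norml /mf /mg; have n0 : 0 <= n by exact: nrm_ge0.
  move=> /andP[h1 h2].
  by case: (leP A (nrm mu f)) => hf; case: (leP A (nrm mu g)) => hg; apply/andP; split; lra.
rewrite (_ : A / mf - A / mg = A / mf * ((mg - mf) / mg)); last first.
  by field; rewrite !gt_eqF.
rewrite !normrM (ger0_norm (ltW A0)) (ger0_norm (x := mf^-1)) ?invr_ge0 ?(ltW mf0)//.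
rewrite (ger0_norm (x := mg^-1)) ?invr_ge0 ?(ltW mg0)//.
have gm : nrm mu g / mg <= 1 by rewrite ler_pdivrMr// mul1r le_max lexx orbT.
rewrite (_ : A / mf * (`|mg - mf| / mg) * nrm mu g =
  A / mf * (`|mg - mf| * (nrm mu g / mg))); last by ring.
rewrite (le_trans _ mB)// -[leRHS]mul1r ler_pM//.
- by rewrite divr_ge0 ?(ltW A0) ?(ltW mf0).
- by rewrite mulr_ge0// divr_ge0 ?nrm_ge0// ltW.
- by rewrite ler_piMr.
Qed.

Lemma tcont_cut A V : 0 < A -> tcont V -> tcont (fun s => cut A (V s)).
Proof.
move=> A0 [sV cV]; split=> [t|t]; first exact: sqi_cut.
have c : 2 * nrm mu (fun x => V s x - V t x) @[s --> t] --> 2 * (0 : R).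
  by apply: cvgM; [exact: cvg_cst|exact: cV].
rewrite mulr0 in c; apply: cvg_bound c _ => s.
by rewrite subr0 ger0_norm ?nrm_ge0// cutB.
Qed.

(** The sum over [k] of [duhamel_bdd], with a factor [1 / m] to spare: this makes the Duhamel map
    contracting for the weight [exp (m ^ 2 t)] with [m] large. *)
Lemma duhamel_sum (f : R -> nat -> R) (t M : R) (m N1 N2 : nat) : (0 < m)%N -> 0 <= t ->
  (N1 <= N2)%N -> (forall j, continuous (fun s => f s j)) ->
  (forall s j, 0 <= s <= t -> `|f s j| <= M * expR (m%:R ^+ 2 * s)) ->
  \sum_(N1 <= k < N2) duhamel f t k ^+ 2 <=
    32 * (M * expR (m%:R ^+ 2 * t)) ^+ 2 / (N1%:R + m%:R).
Proof.
move=> m0 t0 N12 cf fM.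
set E := expR _.
apply: (@le_trans _ _ (\sum_(N1 <= k < N2) 4 * (M * E) ^+ 2 * (fr R k / (fr R k ^+ 2 + m%:R ^+ 2)) ^+ 2)).
  apply: ler_sum => k _; have h := duhamel_bdd k m0 t0 cf fM.
  rewrite -real_normK ?num_real//.
  rewrite (_ : 4 * _ * _ = (2 * M * (fr R k / (fr R k ^+ 2 + m%:R ^+ 2)) * E) ^+ 2); last by ring.
  by rewrite lerXn2r ?nnegrE// (le_trans _ h).
rewrite -mulr_sumr (_ : 32 * _ / _ = 4 * (M * E) ^+ 2 * (8 / (N1%:R + m%:R))); last by ring.
by apply: ler_wpM2l; [rewrite mulr_ge0// sqr_ge0|exact: sum_kernel].
Qed.

Variables (A : R) (msk : nat -> bool) (a0 : nat -> R) (z : R -> R -> R).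

(** The unknown [V] is the solution minus the stochastic convolution [z]; only [V] is cut off. *)
Definition nl V (s : R) : R -> R := fun x => cut A (V s) x + z s x.

(** The mask [msk] selects the coordinates that evolve, and yields the cut-off equation itself or
    its Galerkin approximations; [tp] keeps the path constant at negative times. *)
Definition picard_map V (t : R) (k : nat) : R :=
  if msk k then sgrp (tp t) a0 k + duhamel (fun s j => quad j (nl V s)) (tp t) k else 0.

Fixpoint picard_iter (j : nat) : R -> R -> R :=
  if j is i.+1 then fun t => synth (picard_map (picard_iter i) t) else fun=> fun=> 0.

Variable (Bz M0 : R).
Hypothesis A0 : 0 < A.
Hypothesis a0M : forall N, \sum_(k < N) a0 k ^+ 2 <= M0.
Hypothesis tz : tcont z.
Hypothesis zB : forall t, nrm mu (z t) <= Bz.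

Let L := A + Bz.

Let Bz0 : 0 <= Bz. Proof. exact: le_trans (nrm_ge0 _ _) (zB 0). Qed.

Let L0 : 0 < L. Proof. exact: ltr_pwDl A0 Bz0. Qed.

Let M00 : 0 <= M0. Proof. by have := a0M 0%N; rewrite big_ord0. Qed.

Lemma tcont_nl V : tcont V -> tcont (nl V).
Proof. by move=> tV; apply: tcontD => //; exact: tcont_cut. Qed.

Lemma nl_le V t : tcont V -> nrm mu (nl V t) <= L.
Proof.
move=> [sV _]; have [sz _] := tz.
apply: le_trans (ler_nrmD (sqi_cut A (sV t)) (sz t)) _.
by apply: lerD; [exact: cut_le|exact: zB].
Qed.

Lemma sum_sgrp t N : 0 <= t -> \sum_(k < N) sgrp t a0 k ^+ 2 <= 4 * M0.
Proof.
move=> t0; apply: (@le_trans _ _ (2 * (\sum_(k < N) a0 k ^+ 2 + \sum_(k < N) a0 (partner k) ^+ 2))).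
  by rewrite -big_split/= mulr_sumr; apply: ler_sum => k _; exact: sgrp_sqr.
have := a0M N; have := a0M N.*2.+1.
have := sum_partner_le N (fun k => sqr_ge0 (a0 k)); lra.
Qed.

Lemma cts_sgrp_t (a : nat -> R) k : continuous (fun t => sgrp t a k).
Proof.
move=> t; apply: cvgM; first exact: cts_expR_linN.
apply: cvgD; first by apply: cvgM; [exact: cts_cos_lin|exact: cvg_cst].
apply: cvgM; last exact: cvg_cst.
by apply: cvgM; [exact: cvg_cst|exact: cts_sin_lin].
Qed.

Lemma cts_tp g : continuous g -> continuous (fun t => g (tp t)).
Proof. by move=> cg t; apply: (continuous_comp (@cts_max0 R t)); exact: cg. Qed.

Lemma picard_map_ok V : tcont V -> tcont (fun t => synth (picard_map V t)) /\
  forall t k, ip mu (synth (picard_map V t)) (trig k) = picard_map V t k.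
Proof.
move=> tV; have tn := tcont_nl tV; have cq j := @tcont_quad R _ j tn.
apply: tcont_synth => [k|T].
  rewrite /picard_map; case: (msk k) => t; last exact: cvg_cst.
  apply: cvgD; first by apply: (@cts_tp (fun t => sgrp t a0 k)); exact: cts_sgrp_t.
  by apply: (@cts_tp (fun t => duhamel _ t k)); exact: duhamel_cts.
pose w k := 2 * L ^+ 2 * (fr R k / (fr R k ^+ 2 + 1%:R ^+ 2)) * expR (tp T).
exists (fun k => 4 * (a0 k ^+ 2 + a0 (partner k) ^+ 2) + 2 * w k ^+ 2); split.
  exists (8 * M0 + 2 * (4 * (L ^+ 2 * expR (tp T)) ^+ 2 * 8)) => N.
  rewrite big_split/= -!mulr_sumr big_split/=; apply: lerD.
    have := a0M N; have := a0M N.*2.+1.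
    have := sum_partner_le N (fun k => sqr_ge0 (a0 k)); lra.
  apply: ler_wpM2l => //.
  rewrite (eq_bigr (fun k : 'I_N => 4 * (L ^+ 2 * expR (tp T)) ^+ 2 *
     (fr R k / (fr R k ^+ 2 + 1%:R ^+ 2)) ^+ 2)); last by move=> k _; rewrite /w; ring.
  rewrite -mulr_sumr; apply: ler_wpM2l; first by rewrite mulr_ge0// sqr_ge0.
  have := sum_kernel R (ltn0Sn 0) (leq0n N); rewrite big_mkord => /le_trans; apply.
  by rewrite add0r divr1.
move=> t k tT; rewrite /picard_map; case: (msk k); last first.
  by rewrite expr0n/=; posi.
have h1 := sgrp_sqr a0 k (tp_ge0 t).
have h2 : duhamel (fun s j => quad j (nl V s)) (tp t) k ^+ 2 <= w k ^+ 2.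
  rewrite -real_normK ?num_real// lerXn2r ?nnegrE//.
    by rewrite /w; posi.
  apply: le_trans (duhamel_bdd (m := 1) (M := L ^+ 2) k (ltn0Sn 0) (tp_ge0 t) cq _) _.
    move=> s j /andP[s0 _]; apply: le_trans (quad_bdd j (tn.1 s)) _.
    apply: (@le_trans _ _ (L ^+ 2)); first by rewrite lerXn2r ?nnegrE ?nrm_ge0 ?(ltW L0)// nl_le.
    by rewrite ler_peMr ?sqr_ge0// ler1_expR// mulr_ge0// sqr_ge0.
  rewrite /w ler_wpM2l ?expr1n ?mul1r ?ler_expR//.
    by posi.
  by rewrite /tp ge_max !le_max lexx/= tT orbT.
set x := sgrp _ _ _ in h1 *; set y := duhamel _ _ _ in h2 *.
have := sqr_ge0 (x - y); nra.
Qed.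

(** Halving of distances in the weighted norm: [m >= 2048 L ^ 2] pays for the constant 32 of
    [duhamel_sum], the square of the Lipschitz constant [4 L] of the nonlinearity, and the square
    of the factor 2 gained. *)
Lemma contraction V W (m : nat) (dl : R) : tcont V -> tcont W -> (0 < m)%N ->
  2048 * L ^+ 2 <= m%:R -> 0 <= dl ->
  (forall t, nrm mu (fun x => V t x - W t x) <= dl * expR (m%:R ^+ 2 * tp t)) ->
  forall t, nrm mu (fun x => synth (picard_map V t) x - synth (picard_map W t) x) <=
    dl / 2 * expR (m%:R ^+ 2 * tp t).
Proof.
move=> tV tW m0 mL dl0 VW t; set E := expR _.
have E0 : 0 <= E by exact: expR_ge0.
have tnV := tcont_nl tV; have tnW := tcont_nl tW.
have [_ cV] := picard_map_ok tV; have [_ cW] := picard_map_ok tW.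
have sS (a : nat -> R) := sqi_synth a.
have sd := sqiB (sS (picard_map V t)) (sS (picard_map W t)).
rewrite -ler_sqr ?nnegrE ?nrm_ge0 ?mulr_ge0//.
apply: nrm_le_trig => // N.
have cqV j := @tcont_quad R _ j tnV; have cqW j := @tcont_quad R _ j tnW.
pose f s j := quad j (nl V s) - quad j (nl W s).
have cf j : continuous (fun s => f s j).
  by move=> s; apply: cvgB; [exact: cqV|exact: cqW].
apply: (@le_trans _ _ (\sum_(k < N) duhamel f (tp t) k ^+ 2)).
  apply: ler_sum => k _; rewrite ipBl//; last exact: sqi_trig.
  have -> : ip mu (synth (picard_map V t)) (trig k) - ip mu (synth (picard_map W t)) (trig k) =
      picard_map V t k - picard_map W t k by congr (_ - _); [exact: cV|exact: cW].
  rewrite /picard_map; case: (msk k).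
    rewrite opprD addrACA subrr add0r; rewrite (duhamelB (tp t) k cqV cqW); exact: lexx.
  by rewrite subrr [_ ^+ 2]expr0n; exact: sqr_ge0.
have fM s j : 0 <= s <= tp t -> `|f s j| <= 4 * L * dl * expR (m%:R ^+ 2 * s).
  move=> /andP[s0 _]; apply: le_trans (quadB j (tnV.1 s) (tnW.1 s)) _.
  have h1 : nrm mu (fun x => nl V s x - nl W s x) <= 2 * (dl * expR (m%:R ^+ 2 * s)).
    have -> : (fun x => nl V s x - nl W s x) = (fun x => cut A (V s) x - cut A (W s) x).
      by apply/funext => x; rewrite /nl; ring.
    apply: le_trans (cutB A0 (tV.1 s) (tW.1 s)) _.
    by rewrite ler_wpM2l//; have := VW s; rewrite tp_id.
  rewrite (_ : 4 * _ * _ * _ = 2 * (dl * expR (m%:R ^+ 2 * s)) * (L + L)); last by ring.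
  by apply: ler_pM; rewrite ?nrm_ge0 ?addr_ge0 ?nrm_ge0//; apply: lerD; exact: nl_le.
have := duhamel_sum m0 (tp_ge0 t) (leq0n N) cf fM; rewrite big_mkord => /le_trans; apply.
rewrite add0r -/E.
have m00 : 0 < m%:R :> R by rewrite ltr0n.
rewrite ler_pdivrMr//.
rewrite (_ : 32 * _ = (dl * E) ^+ 2 / 4 * (2048 * L ^+ 2)); last by field.
rewrite (_ : (dl / 2 * E) ^+ 2 = (dl * E) ^+ 2 / 4); last by field.
by rewrite ler_wpM2l// divr_ge0 ?sqr_ge0.
Qed.

(** Picard iteration; the convergence of the coordinates of the iterates is recorded for the sake
    of measurability in the noise. *)
Lemma cutoff_solution_ex : exists V, [/\ tcont V, forall t k, ip mu (V t) (trig k) = picard_map V t k &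
  forall t k, (fun j => ip mu (picard_iter j t) (trig k)) @ \oo --> ip mu (V t) (trig k)].
Proof.
have tpic j : tcont (picard_iter j).
  by elim: j => [|j /picard_map_ok[]//]; apply: tcont_cst; exact: sqi0.
have [m mL] : exists m : nat, (0 < m)%N /\ 2048 * L ^+ 2 <= m%:R.
  exists (Num.truncn (2048 * L ^+ 2)).+1; split => //; apply/ltW.
  by have := truncnS_gt (2048 * L ^+ 2).
have [m0 mL'] := mL.
pose E t := expR (m%:R ^+ 2 * tp t).
have E1 t : 1 <= E t by apply: ler1_expR; rewrite mulr_ge0 ?sqr_ge0 ?tp_ge0.
have E0 t : 0 < E t by exact: expR_gt0.
pose C := 1 + 8 * M0 + 64 * (L ^+ 2) ^+ 2.
have C1 : 1 <= C by rewrite /C -addrA lerDl; posi.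
have d0 t : nrm mu (fun x => picard_iter 1 t x - picard_iter 0 t x) <= C * E t.
  have -> : (fun x => picard_iter 1 t x - picard_iter 0 t x) = synth (picard_map (picard_iter 0) t).
    by apply/funext => x; rewrite /= subr0.
  have [_ cE] := picard_map_ok (tpic 0%N); have tn := tcont_nl (tpic 0%N).
  have cq j := @tcont_quad R _ j tn.
  have CE : 1 <= C * E t by rewrite -[leLHS]mulr1 ler_pM.
  rewrite -ler_sqr ?nnegrE ?nrm_ge0 ?(le_trans ler01 CE)//.
  apply: nrm_le_trig; first exact: sqi_synth.
  move=> N; under eq_bigr do rewrite cE.
  apply: (@le_trans _ _ (\sum_(k < N) (2 * sgrp (tp t) a0 k ^+ 2 +
      2 * duhamel (fun s j => quad j (nl (picard_iter 0) s)) (tp t) k ^+ 2))).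
    apply: ler_sum => k _; rewrite /picard_map; case: (msk k); last first.
      by rewrite expr0n/= addr_ge0// mulr_ge0// sqr_ge0.
    set x := sgrp _ _ _; set y := duhamel _ _ _; have := sqr_ge0 (x - y); nra.
  rewrite big_split/= -!mulr_sumr.
  have h1 := sum_sgrp N (tp_ge0 t).
  have h2 : \sum_(k < N) duhamel (fun s j => quad j (nl (picard_iter 0) s)) (tp t) k ^+ 2 <=
     32 * (L ^+ 2 * E t) ^+ 2.
    have := @duhamel_sum (fun s j => quad j (nl (picard_iter 0) s)) (tp t) (L ^+ 2) m 0 N m0 (tp_ge0 t)
      (leq0n N) cq.
    rewrite big_mkord => h; apply: le_trans (h _) _.
      move=> s j /andP[s0 _]; apply: le_trans (quad_bdd j (tn.1 s)) _.
      apply: (@le_trans _ _ (L ^+ 2)); first by rewrite lerXn2r ?nnegrE ?nrm_ge0 ?(ltW L0)// nl_le.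
      by rewrite ler_peMr ?sqr_ge0// ler1_expR// mulr_ge0// sqr_ge0.
    rewrite add0r; apply: ler_piMr; first by posi.
    by rewrite invf_le1 ?ltr0n ?ler1n.
  have h3 : 1 <= E t ^+ 2 by apply: exprn_ege1; exact: E1.
  have h4 : (C * E t) ^+ 2 = C ^+ 2 * E t ^+ 2 by ring.
  have h5 : C <= C ^+ 2 by rewrite expr2 ler_peMl// (le_trans ler01 C1).
  have h6 : C * E t ^+ 2 <= C ^+ 2 * E t ^+ 2 by rewrite ler_wpM2r// sqr_ge0.
  rewrite h4; apply: le_trans h6; rewrite /C.
  have -> : (1 + 8 * M0 + 64 * (L ^+ 2) ^+ 2) * E t ^+ 2 = E t ^+ 2 + 8 * M0 * E t ^+ 2 + 2 * (32 * (L ^+ 2 * E t) ^+ 2) by ring.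
  have : M0 <= M0 * E t ^+ 2 by rewrite ler_peMr.
  have := h3; lra.
have C0 : 0 < C by exact: lt_le_trans C1.
have hp j : 0 <= C * 2^-1 ^+ j by rewrite mulr_ge0 ?(ltW C0)// exprn_ge0.
have dj j t : nrm mu (fun x => picard_iter j.+1 t x - picard_iter j t x) <= C * 2^-1 ^+ j * E t.
  elim: j t => [|j ih] t; first by rewrite expr0 mulr1.
  have := contraction (tpic j.+1) (tpic j) m0 mL' (hp j) ih t.
  move=> h; rewrite (_ : C * 2^-1 ^+ j.+1 * E t = C * 2^-1 ^+ j / 2 * expR (m%:R ^+ 2 * tp t)).
      exact: h.
    by rewrite exprSr /E; ring.
have Vex t : exists g, sqi mu g /\ forall j,
    nrm mu (fun x => g x - picard_iter j t x) <= 2 * C * 2^-1 ^+ j * E t.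
  have [|||g sg hg] := @sqi_complete _ _ _ mu (fun j => picard_iter j t) (C * E t).
  - by rewrite mulr_gt0.
  - by move=> j; case: (tpic j).
  - by move=> j; apply: le_trans (dj j t) _; rewrite mulrAC.
  exists g; split=> // j; apply: le_trans (hg j) _.
  by rewrite le_eqVlt; apply/orP; left; apply/eqP; ring.
have [V HV] := choice Vex.
have sV t : sqi mu (V t) by case: (HV t).
have dV t j : nrm mu (fun x => V t x - picard_iter j t x) <= 2 * C * 2^-1 ^+ j * E t by case: (HV t).
have geo (c : R) : (fun j => c * 2^-1 ^+ j) @ \oo --> (0 : R).
  rewrite -(mulr0 c); apply: cvgM; first exact: cvg_cst.
  by apply: cvg_expr; rewrite ger0_norm ?invr_ge0// invf_lt1// ltr1n.
have tV : tcont V.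
  split=> // t; apply/cvgrPdist_le => e e0.
  have e3 : 0 < e / 3 by rewrite divr_gt0.
  have := geo (2 * C * E (t + 1)); move/cvgrPdist_le => /(_ _ e3)[j _ /(_ j (leqnn j))].
  rewrite sub0r normrN => /(le_trans (ler_norm _)) hj.
  have Emono s : s <= t + 1 -> E s <= E (t + 1).
    move=> st; rewrite ler_expR ler_wpM2l ?sqr_ge0// /tp ge_max !le_max lexx/=.
    by rewrite st orbT.
  have hj' s : s <= t + 1 -> nrm mu (fun x => V s x - picard_iter j s x) <= e / 3.
    move=> /Emono st; apply: le_trans (dV s j) (le_trans _ hj).
    rewrite (_ : 2 * C * E (t + 1) * _ = 2 * C * 2^-1 ^+ j * E (t + 1)); last by ring.
    by rewrite ler_wpM2l// !mulr_ge0 ?(ltW C0)// exprn_ge0.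
  have [spj cpj] := tpic j; have := cpj t; move/cvgrPdist_le => /(_ _ e3) cp.
  near=> s; rewrite sub0r normrN ger0_norm ?nrm_ge0//.
  have st : s <= t + 1.
    have : `|t - s| <= 1 by near: s; apply: cvgr_dist_le.
    by rewrite ler_norml => /andP[]; lra.
  have h1 : nrm mu (fun x => picard_iter j s x - picard_iter j t x) <= e / 3.
    have : `|0 - nrm mu (fun x => picard_iter j s x - picard_iter j t x)| <= e / 3 by near: s.
    by rewrite sub0r normrN; apply: le_trans; exact: ler_norm.
  have h2 := hj' s st; have h3 := hj' t; rewrite lerDl ler01 in h3; have {}h3 := h3 isT.
  have := nrm_tri (sV s) (spj s) (sV t); have := nrm_tri (spj s) (spj t) (sV t).
  rewrite (nrm_distC (spj t) (sV t)); lra.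
have cV t k : (fun j => ip mu (picard_iter j t) (trig k)) @ \oo --> ip mu (V t) (trig k).
  apply: cvg_bound (geo (2 * C * E t)) _ => j.
  rewrite distrC -ipBl//; [|by case: (tpic j)|exact: sqi_trig].
  apply: le_trans (coord_le_trig _ _) _; first by apply: sqiB => //; case: (tpic j).
  by apply: le_trans (dV t j) _; rewrite le_eqVlt; apply/orP; left; apply/eqP; ring.
exists V; split=> // t k.
have [_ cE] := picard_map_ok tV.
apply: (cvg_unique (@Rhausdorff R) (F := (fun j => ip mu (picard_iter j.+1 t) (trig k)) @ \oo)).
  by have := cV t k; rewrite -cvg_shiftS.
rewrite -cE; apply: cvg_bound (geo (C * E t)) _ => j.
rewrite distrC -ipBl//; [|exact: sqi_synth|exact: sqi_synth|exact: sqi_trig].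
apply: le_trans (coord_le_trig _ _) _; first by apply: sqiB; exact: sqi_synth.
have hp2 : 0 <= 2 * C * 2^-1 ^+ j by rewrite -mulrA mulr_ge0.
apply: le_trans (contraction tV (tpic j) m0 mL' hp2 (fun t => dV t j) t) _.
by rewrite le_eqVlt; apply/orP; left; apply/eqP; rewrite -/(E t); field.
Unshelve. all: by end_near.
Qed.

End Picard.

(** * The energy estimate *)

Ltac eqle := rewrite le_eqVlt; apply/orP; left; apply/eqP.

Section Energy.
Context (R : realType).
Notation leb := (@lebesgue_measure R).
Notation mu := (torus R).
Implicit Types (f g : R -> R) (U V W F : R -> R -> R).

Lemma is_derive_trig k (x : R) :
  is_derive x (1 : R) (trig k) (- sg R k * fr R k * trig (partner k) x).
Proof.
case: k => [|k].
  rewrite fr0 mulr0 mul0r; exact: is_derive_cst.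
have dc (n : nat) (y : R) : is_derive y (1 : R) (fun x => (Num.sqrt pi)^-1 * cosz n x)
   (- (n%:R) * ((Num.sqrt pi)^-1 * sinz n y)).
  by apply: is_derive_eq; rewrite /sinz /GRing.scale/= -pmulrn; ring.
have ds (n : nat) (y : R) : is_derive y (1 : R) (fun x => (Num.sqrt pi)^-1 * sinz n x)
   (n%:R * ((Num.sqrt pi)^-1 * cosz n y)).
  by apply: is_derive_eq; rewrite /cosz /GRing.scale/= -pmulrn; ring.
have [j [->|->]] : exists j, k.+1 = j.*2.+1 \/ k.+1 = j.*2.+2.
  have := odd_double_half k; case: (odd k) => h; exists k./2; [right|left]; lia.
  have -> : partner j.*2.+1 = j.*2.+2 by rewrite /partner /= odd_double.
  have -> : sg R j.*2.+1 = 1 by rewrite /sg /= odd_double.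
  have -> : fr R j.*2.+1 = j.+1%:R by rewrite /fr /freq; congr (_%:R); lia.
  by rewrite trig_odd trig_even mulN1r; exact: dc.
have -> : partner j.*2.+2 = j.*2.+1 by rewrite /partner /= odd_double.
have -> : sg R j.*2.+2 = -1 by rewrite /sg /= odd_double.
have -> : fr R j.*2.+2 = j.+1%:R by rewrite /fr /freq; congr (_%:R); lia.
by rewrite trig_odd trig_even opprK mul1r; exact: ds.
Qed.

Lemma trig_2pi k : trig k (2 * pi) = trig k 0 :> R.
Proof.
case: k => [|k] //=; congr (_ * _); case: ifP => _.
  by rewrite /cosz cosz_2pi mulr0 cos0.
by rewrite /sinz sinz_2pi mulr0 sin0.
Qed.

Definition tpsum (a : nat -> R) (M : nat) : R -> R := psum (@trig R) a M.

Lemma cts_tpsum a M : continuous (tpsum a M).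
Proof.
move=> x; rewrite /tpsum /psum; apply: (@cvg_ordsum _ _ _ _ _ (fun k x => a k * trig k x)
  (fun k => a k * trig k x)) => k.
by apply: cvgM; [exact: cvg_cst|exact: cts_trig].
Qed.

Lemma sqi_tpsum a M : sqi mu (tpsum a M).
Proof. exact: sqi_psum (@sqi_trig R) _ _. Qed.

Lemma nrm_tpsum a M : nrm mu (tpsum a M) ^+ 2 = \sum_(k < M) a k ^+ 2.
Proof.
rewrite nrm2 /tpsum ip_psum2; [|exact: sqi_trig|exact: orth_trig].
by apply: eq_bigr => k _; rewrite expr2.
Qed.

Lemma tpsum_bdd a M x : `|tpsum a M x| <= \sum_(k < M) `|a k|.
Proof.
rewrite /tpsum /psum (le_trans (ler_norm_sum _ _ _))//; apply: ler_sum => k _.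
by rewrite normrM ler_piMr// trig_bdd.
Qed.

Lemma mtpsum a M : measurable_fun [set: R] (tpsum a M).
Proof. by apply: continuous_measurable_fun; exact: cts_tpsum. Qed.

Lemma is_derive_ordsum (F dF : nat -> R -> R) (M : nat) (x : R) :
  (forall k, is_derive x (1 : R) (F k) (dF k x)) ->
  is_derive x (1 : R) (fun y => \sum_(k < M) F k y) (\sum_(k < M) dF k x).
Proof.
move=> h; elim: M => [|M ih].
  by rewrite big_ord0; under eq_fun do rewrite big_ord0; exact: is_derive_cst.
by rewrite big_ord_recr/=; under eq_fun do rewrite big_ord_recr/=; exact: is_deriveD.
Qed.

(** [dcoef v] are the coordinates of the derivative of the function with coordinates [v]. *)
Definition dcoef (v : nat -> R) (k : nat) : R := sg R k * fr R k * v (partner k).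

Lemma is_derive_tpsum (v : nat -> R) (N : nat) (x : R) :
  is_derive x (1 : R) (tpsum v N.*2.+1) (tpsum (dcoef v) N.*2.+1 x).
Proof.
have d k : is_derive x (1 : R) (fun y => v k * trig k y)
    (v k * (- sg R k * fr R k * trig (partner k) x)).
  by have := is_derive_trig k x => dk; apply: is_derive_eq; rewrite /GRing.scale/=; ring.
rewrite (_ : tpsum _ _ x = \sum_(k < N.*2.+1) v k * (- sg R k * fr R k * trig (partner k) x)).
  exact: (@is_derive_ordsum _ (fun k x => v k * (- sg R k * fr R k * trig (partner k) x))).
rewrite /tpsum /psum -(sum_partner (fun k => dcoef v k * trig k x)).
apply: eq_bigr => -[[|k] hk] _ /=; first by rewrite /dcoef /partner /= fr0; ring.
by rewrite /dcoef partnerK// sg_partner// fr_partner; ring.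
Qed.

(** [p ^ 2 p'] is the derivative of the periodic function [p ^ 3 / 3]. *)
Lemma int_cubic (v : nat -> R) N :
  ip mu (fun x => tpsum v N.*2.+1 x ^+ 2) (tpsum (dcoef v) N.*2.+1) = 0.
Proof.
set p := tpsum v _; set w := tpsum (dcoef v) _.
have cp : continuous p by exact: cts_tpsum.
have cw : continuous w by exact: cts_tpsum.
have cpw : continuous (fun x => p x ^+ 2 * w x).
  by move=> x; apply: cvgM; [apply: cvg_sqr; exact: cp|exact: cw].
rewrite /ip torus_itv; last by apply: continuous_measurable_fun; exact: cpw.
have dF (x : R) : is_derive x (1 : R) (fun y => 3^-1 * p y ^+ 3) (p x ^+ 2 * w x).
  have dp : is_derive x (1 : R) p (w x) by exact: is_derive_tpsum.
  by apply: is_derive_eq; rewrite /GRing.scale/=; field.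
rewrite (FTC2 (ltW (twopi_gt0 R)) cpw dF).
have -> : p (2 * pi) = p 0; last by rewrite subrr.
by apply: eq_bigr => k _; rewrite trig_2pi.
Qed.

Lemma nrm_bddMC f g C : sqi mu f -> measurable_fun [set: R] g -> 0 <= C ->
  (forall x, `|g x| <= C) -> nrm mu (fun x => f x * g x) <= C * nrm mu f.
Proof.
move=> sf mg C0 gC; have sfg : sqi mu (fun x => f x * g x) by exact: sqi_bddM sf mg gC.
rewrite -ler_sqr ?nnegrE ?nrm_ge0 ?mulr_ge0 ?nrm_ge0// exprMn !nrm2 -ipZl// /ip.
apply: le_Rintegral => //.
- exact: sqiM.
- by apply: sqiM => //; exact: sqiZ.
- move=> x _; rewrite -expr2 exprMn -mulrA -expr2 mulrC ler_wpM2r ?sqr_ge0//.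
  by rewrite -real_normK ?num_real// lerXn2r ?nnegrE.
Qed.

Lemma trig_ext f g : sqi mu f -> sqi mu g ->
  (forall k, ip mu f (trig k) = ip mu g (trig k)) -> {ae mu, forall x, f x = g x}.
Proof.
move=> sf sg fg; have : {ae mu, forall x, f x - g x = 0}.
  apply: trig_total; first exact: sqiB.
  by move=> k; rewrite ipBl ?fg ?subrr//; exact: sqi_trig.
by apply: (@filterS _ _ (ae_filter_ringOfSetsType mu)) => x /eqP; rewrite subr_eq0 => /eqP.
Qed.

Lemma tpsum_coord a M k : ip mu (tpsum a M) (trig k) = if (k < M)%N then a k else 0.
Proof. by rewrite /tpsum psum_coord//; [exact: sqi_trig|exact: orth_trig]. Qed.

Lemma quad_ae f g k : sqi mu f -> sqi mu g -> {ae mu, forall x, f x = g x} ->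
  quad k f = quad k g.
Proof.
move=> sf sg fg; rewrite /quad (ip_ae sf sg (sqi_trigM k sf) fg).
rewrite ipC [RHS]ipC (ip_ae (sqi_trigM k sf) (sqi_trigM k sg) sg)//.
by apply: (@filterS _ _ (ae_filter_ringOfSetsType mu)) fg => x ->.
Qed.

(** With [p] the Galerkin part, [q] the noise and [w = p'], the flux is the integral of
    [w (th p + q) ^ 2]. The term in [p ^ 2] vanishes by [int_cubic], and in the rest the derivative
    falls on [p], where the dissipation [fr ^ 2 v ^ 2] absorbs it, while [q] is bounded by the
    sum of the absolute values of its coordinates. *)
Lemma energy_flux (v ze : nat -> R) (N : nat) (th Bz : R) (f : R -> R) :
  sqi mu f -> 0 <= th <= 1 ->
  (forall k, ip mu f (trig k) = if (k < N.*2.+1)%N then th * v k + ze k else 0) ->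
  \sum_(k < N.*2.+1) ze k ^+ 2 <= Bz ^+ 2 -> 0 <= Bz ->
  2 * \sum_(k < N.*2.+1) v k * ddxc (quad (R:=R) ^~ f) k <=
  2 * \sum_(k < N.*2.+1) fr R k ^+ 2 * v k ^+ 2 +
    (\sum_(k < N.*2.+1) `|ze k|) ^+ 2 * (4 * \sum_(k < N.*2.+1) v k ^+ 2 + Bz ^+ 2).
Proof.
move=> sf /andP[th0 th1] fc zB Bz0; set M := N.*2.+1.
set p := tpsum v M; set q := tpsum ze M; set w := tpsum (dcoef v) M.
have sp : sqi mu p by exact: sqi_tpsum.
have sq : sqi mu q by exact: sqi_tpsum.
have sw : sqi mu w by exact: sqi_tpsum.
pose G x := th * p x + q x.
have sG : sqi mu G by apply: sqiD => //; exact: sqiZ.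
have fG : {ae mu, forall x, f x = G x}.
  apply: trig_ext => // k; rewrite fc /G ipDl ?ipZl//; try exact: sqi_trig; last exact: sqiZ.
  by rewrite !tpsum_coord; case: ifP => _ //; rewrite mulr0 addr0.
set S := \sum_(k < M) `|ze k|.
have S0 : 0 <= S by apply: sumr_ge0.
have bdd a (x : R) : `|tpsum a M x| <= \sum_(k < M) `|a k| by exact: tpsum_bdd.
have sM g a : sqi mu g -> sqi mu (fun x => g x * tpsum a M x).
  by move=> sg'; apply: (@sqi_bddM _ _ _ _ _ _ (\sum_(k < M) `|a k|)) => //; exact: mtpsum.
have -> : \sum_(k < M) v k * ddxc (quad (R:=R) ^~ f) k = ip mu G (fun x => G x * w x).
  have -> : (fun x => G x * w x) = (fun x => \sum_(k < M) (dcoef v k * (G x * trig k x))).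
    apply/funext => x; rewrite /w /tpsum /psum mulr_sumr.
    by apply: eq_bigr => k _; ring.
  rewrite ip_sumr//; last by move=> k; apply: sqiZ; exact: sqi_trigM.
  rewrite /M -(sum_partner (fun k => ip mu G (fun x => dcoef v k * (G x * trig k x)))).
  apply: eq_bigr => -[k hk] _ /=; rewrite ipZr//; last exact: sqi_trigM.
  rewrite /ddxc (quad_ae _ sf sG fG) -/(quad (partner k) G).
  case: k hk => [|k] _; first by rewrite /dcoef /partner /= fr0; ring.
  by rewrite /dcoef partnerK// sg_partner// fr_partner; ring.
have -> : ip mu G (fun x => G x * w x) =
    ip mu (fun x => w x * q x) (fun x => 2 * th * p x + q x).
  have sr : sqi mu (fun x => 2 * th * p x + q x) by apply: sqiD => //; exact: sqiZ.
  have sp2 : sqi mu (fun x => p x ^+ 2) by under eq_fun do rewrite expr2; exact: sM.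
  have swq : sqi mu (fun x => w x * q x) by exact: sM.
  rewrite -[RHS]addr0 -[X in _ + X](mulr0 (th ^+ 2)) -(int_cubic v N).
  rewrite -ipZl// /ip -RintegralD//; [|exact: sqiM|by apply: sqiM => //; exact: sqiZ].
  by apply: eq_Rintegral => x _; rewrite /G -/p -/w; ring.
set D2 := \sum_(k < M) fr R k ^+ 2 * v k ^+ 2.
have nw : nrm mu w ^+ 2 = D2.
  rewrite nrm_tpsum /D2 /M -(sum_partner (fun k => fr R k ^+ 2 * v k ^+ 2)).
  apply: eq_bigr => k _; rewrite /dcoef fr_partner !exprMn [sg R k ^+ 2]expr2 sg2; ring.
have np : nrm mu p ^+ 2 = \sum_(k < M) v k ^+ 2 by exact: nrm_tpsum.
have nq : nrm mu q <= Bz.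
  by rewrite -ler_sqr ?nnegrE ?nrm_ge0// nrm_tpsum.
rewrite -np -nw.
have h1 : nrm mu (fun x => w x * q x) <= S * nrm mu w.
  exact: (nrm_bddMC sw (mtpsum ze M) S0 (bdd ze)).
have h2 : nrm mu (fun x => 2 * th * p x + q x) <= 2 * nrm mu p + Bz.
  apply: le_trans (ler_nrmD (sqiZ _ sp) sq) _; apply: lerD => //.
  by rewrite nrmZ// ger0_norm ?mulr_ge0// ler_wpM2r ?nrm_ge0// ler_piMr.
have sr : sqi mu (fun x => 2 * th * p x + q x) by apply: sqiD => //; exact: sqiZ.
have h3 := cauchy_schwarz (sM w ze sw) sr.
have h4 : ip mu (fun x => w x * q x) (fun x => 2 * th * p x + q x) <=
   S * nrm mu w * (2 * nrm mu p + Bz).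
  apply: le_trans (ler_norm _) (le_trans h3 _).
  by apply: ler_pM => //; exact: nrm_ge0.
have := nrm_ge0 mu w; have := nrm_ge0 mu p; move: h4.
set X := ip _ _ _; set nW := nrm mu w; set nP := nrm mu p => h4 P0 W0.
have := sqr_ge0 (2 * nW - S * (2 * nP + Bz)).
have := mulr_ge0 (sqr_ge0 S) (sqr_ge0 (2 * nP - Bz)).
nra.
Qed.

(** The cross terms of partners cancel and [cos ^ 2 + sin ^ 2 = 1]: the Airy rotation preserves
    sums of squares that are weighted by the frequency. *)
Lemma rot_sum (c : nat -> R) (t : R) (p : nat -> R) N : (forall k, c (partner k) = c k) ->
  \sum_(k < N.*2.+1) c k * sgrp t p k ^+ 2 =
  \sum_(k < N.*2.+1) c k * (expR (- (2 * fr R k ^+ 2 * t)) * p k ^+ 2).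
Proof.
move=> cp; pose E k := expR (- (fr R k ^+ 2 * t)).
pose C k := cos (fr R k ^+ 3 * t); pose S k := sin (fr R k ^+ 3 * t).
have E_prt k : E (partner k) = E k by rewrite /E fr_partner.
have C_prt k : C (partner k) = C k by rewrite /C fr_partner.
have S_prt k : S (partner k) = S k by rewrite /S fr_partner.
have S0 : S 0%N = 0 by rewrite /S fr0 expr0n/= mul0r sin0.
have EE k : expR (- (2 * fr R k ^+ 2 * t)) = E k ^+ 2.
  by rewrite /E [RHS]expr2 -expRD; congr expR; ring.
have vE k : sgrp t p k = E k * (C k * p k + sg R k * S k * p (partner k)) by [].
have cs k : C k ^+ 2 + S k ^+ 2 = 1 by exact: cos2Dsin2.
clearbody E C S; under eq_bigr do rewrite vE; under [RHS]eq_bigr do rewrite EE.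
(* the cross terms: antisymmetric under [partner] *)
pose X k := c k * (sg R k * E k ^+ 2 * C k * S k * p k * p (partner k)).
have X0 : \sum_(k < N.*2.+1) X k = 0.
  have : \sum_(k < N.*2.+1) X (partner k) = - \sum_(k < N.*2.+1) X k.
    rewrite -sumrN; apply: eq_bigr => -[[|k] hk] _ /=; rewrite /X.
      by rewrite (_ : partner 0 = 0%N)// S0; ring.
    by rewrite partnerK// sg_partner// E_prt C_prt S_prt cp; ring.
  rewrite sum_partner; set x := \sum_(k < _) _; lra.
pose Z k := c k * (E k ^+ 2 * S k ^+ 2 * p k ^+ 2).
transitivity (\sum_(k < N.*2.+1) (c k * (E k ^+ 2 * C k ^+ 2 * p k ^+ 2)) +
    \sum_(k < N.*2.+1) Z (partner k) + 2 * \sum_(k < N.*2.+1) X k).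
  rewrite mulr_sumr -!big_split/=; apply: eq_bigr => -[k hk] _ /=.
  rewrite /Z /X E_prt S_prt cp.
  have := sg2 R k; set sk := sg R k => sk2.
  apply/eqP; rewrite -subr_eq0; apply/eqP.
  transitivity (c k * (sk * sk - 1) * (E k ^+ 2 * S k ^+ 2 * p (partner k) ^+ 2)); first by ring.
  by rewrite sk2 subrr mulr0 mul0r.
rewrite X0 mulr0 addr0 sum_partner -big_split/=; apply: eq_bigr => k _.
transitivity (c k * ((C k ^+ 2 + S k ^+ 2) * (E k ^+ 2 * p k ^+ 2))); first by rewrite /Z; ring.
by rewrite cs mul1r.
Qed.

Lemma rot_pair (t : R) (p b : nat -> R) N :
  \sum_(k < N.*2.+1) expR (- (fr R k ^+ 2 * t)) * p k *
      (cos (fr R k ^+ 3 * t) * b k - sg R k * sin (fr R k ^+ 3 * t) * b (partner k)) =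
  \sum_(k < N.*2.+1) sgrp t p k * b k.
Proof.
pose E k := expR (- (fr R k ^+ 2 * t)).
pose C k := cos (fr R k ^+ 3 * t); pose S k := sin (fr R k ^+ 3 * t).
have E_prt k : E (partner k) = E k by rewrite /E fr_partner.
have S_prt k : S (partner k) = S k by rewrite /S fr_partner.
have S0 : S 0%N = 0 by rewrite /S fr0 expr0n/= mul0r sin0.
pose X k := sg R k * E k * S k * p (partner k) * b k.
transitivity (\sum_(k < N.*2.+1) (E k * C k * p k * b k) + \sum_(k < N.*2.+1) X (partner k)).
  rewrite -big_split/=; apply: eq_bigr => -[[|k] hk] _ /=; rewrite /X.
    rewrite (_ : partner 0 = 0%N)// -/(E 0%N) -/(C 0%N) -/(S 0%N) S0; ring.
  by rewrite partnerK// sg_partner// E_prt S_prt -/(E k.+1) -/(C k.+1) -/(S k.+1); ring.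
rewrite sum_partner -big_split/=; apply: eq_bigr => k _.
by rewrite /X /sgrp -/(E k) -/(C k) -/(S k); ring.
Qed.

(** The energy is differentiated in the frame [P] rotating with the semigroup, where the unknown
    is continuously differentiable in time. *)
Lemma energy_derive (b : R -> nat -> R) (P : nat -> R -> R) (t : R) N :
  (forall k, is_derive t (1 : R) (P k) (rotf b k t)) ->
  is_derive t (1 : R) (fun t => \sum_(k < N.*2.+1) expR (- (2 * fr R k ^+ 2 * t)) * P k t ^+ 2)
  (- 2 * (\sum_(k < N.*2.+1) fr R k ^+ 2 * sgrp t (P ^~ t) k ^+ 2) +
   2 * \sum_(k < N.*2.+1) sgrp t (P ^~ t) k * b t k).
Proof.
move=> dP.
pose D k := - 2 * (fr R k ^+ 2 * (expR (- (2 * fr R k ^+ 2 * t)) * P k t ^+ 2)) +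
   2 * (expR (- (fr R k ^+ 2 * t)) * P k t *
    (cos (fr R k ^+ 3 * t) * b t k - sg R k * sin (fr R k ^+ 3 * t) * b t (partner k))).
have dk k : is_derive t (1 : R) (fun t => expR (- (2 * fr R k ^+ 2 * t)) * P k t ^+ 2) (D k).
  have d := dP k.
  have d1 : is_derive t (1 : R) (fun t : R => - (2 * fr R k ^+ 2 * t)) (- (2 * fr R k ^+ 2)).
    by apply: is_derive_eq; rewrite /GRing.scale/=; ring.
  apply: is_derive_eq; rewrite /GRing.scale/= /D /rotf.
  have -> : expR (- (2 * fr R k ^+ 2 * t)) = (expR (fr R k ^+ 2 * t))^-1 ^+ 2.
    by rewrite -expRN [RHS]expr2 -expRD; congr expR; ring.
  rewrite [expR (- (fr R k ^+ 2 * t))]expRN.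
  have := expR_gt0 (fr R k ^+ 2 * t); set E := expR _ => E0.
  by field; rewrite gt_eqF.
apply: is_derive_eq.
  exact: (@is_derive_ordsum (fun k t => expR (- (2 * fr R k ^+ 2 * t)) * P k t ^+ 2) (fun k _ => D k)).
transitivity (\sum_(k < N.*2.+1) (- 2 * (fr R k ^+ 2 * (expR (- (2 * fr R k ^+ 2 * t)) * P k t ^+ 2)) +
   2 * (expR (- (fr R k ^+ 2 * t)) * P k t *
    (cos (fr R k ^+ 3 * t) * b t k - sg R k * sin (fr R k ^+ 3 * t) * b t (partner k))))); first by [].
rewrite big_split/= -!mulr_sumr (rot_pair t (P ^~ t) (b t)).
congr (_ * _ + _); apply/esym/(@rot_sum (fun k => fr R k ^+ 2)) => k.
by rewrite fr_partner.
Qed.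

(** [(Y + K) exp (- pint g)] is nonincreasing. *)
Lemma gronwall (Y g : R -> R) (K t : R) : continuous Y -> continuous g -> 0 <= t ->
  (forall s : R, 0 < s -> exists2 y, is_derive s (1 : R) Y y & y <= g s * (Y s + K)) ->
  Y t + K <= (Y 0 + K) * expR (pint g t).
Proof.
move=> cY cg t0 dY; pose H s := (Y s + K) * expR (- pint g s).
have dH (s : R) : 0 < s -> exists2 h, is_derive s (1 : R) H h & h <= 0.
  move=> s0; have [y d1 yle] := dY s s0; have d2 := pint_derive cg s0.
  have d3 : is_derive s (1 : R) (fun s => - pint g s) (- g s) by apply: is_derive_eq.
  exists ((y - g s * (Y s + K)) * expR (- pint g s)).
    by apply: is_derive_eq; rewrite /GRing.scale/=; ring.
  by rewrite mulr_le0_ge0 ?expR_ge0// subr_le0.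
have cH : continuous H.
  move=> s; apply: cvgM; first by apply: cvgD; [exact: cY|exact: cvg_cst].
  apply: (continuous_comp (f := fun s => - pint g s) (g := @expR R)); last exact: continuous_expR.
  by apply: cvgN; exact: pint_cts.
have : H t <= H 0.
  apply: (@ler0_derive1_le_cc _ H 0 t) => //; rewrite ?in_itv/= ?lexx ?t0//.
  - by move=> s; rewrite in_itv/= => /andP[s0 _]; have [h [] ] := dH s s0.
  - move=> s; rewrite in_itv/= => /andP[s0 _]; have [h dh h0] := dH s s0.
    by rewrite derive1E derive_val.
  - exact: continuous_subspaceT.
by rewrite /H [pint g 0]pint_le0// oppr0 expR0 mulr1 expRN ler_pdivrMr ?expR_gt0.
Qed.

(** Only finitely many coordinates evolve, so the energy identity is a computation with finite
    sums, and the bound does not involve the cut-off level [A]. *)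
Lemma galerkin_energy (N : nat) (A : R) (a0 : nat -> R) (z V : R -> R -> R) (Bz M0 t : R)
  (M := N.*2.+1) : 0 < A ->
  (forall N, \sum_(k < N) a0 k ^+ 2 <= M0) ->
  tcont z -> (forall t, nrm mu (z t) <= Bz) ->
  (forall t k, (M <= k)%N -> ip mu (z t) (trig k) = 0) ->
  tcont V ->
  (forall t k, ip mu (V t) (trig k) = picard_map A (fun k => (k < M)%N) a0 z V t k) ->
  0 <= t ->
  nrm mu (V t) ^+ 2 <= (M0 + Bz ^+ 2) *
    expR (pint (fun s => 4 * (\sum_(k < M) `|ip mu (z s) (trig k)|) ^+ 2) t).
Proof.
move=> A0 a0M tz zB zM tV cV t0.
have Bz0 : 0 <= Bz by exact: le_trans (nrm_ge0 _ _) (zB 0).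
have tn : tcont (nl A z V) by exact: tcont_nl.
have cq j : continuous (fun s => quad j (nl A z V s)) by exact: tcont_quad.
pose b s := ddxc (fun j => quad j (nl A z V s)).
have cb j : continuous (fun s => b s j) by move=> s; apply: cvgM; [exact: cvg_cst|exact: cq].
(* the coordinates of [V] in the rotating frame, where they are differentiable in time *)
pose P k s := a0 k + pint (rotf b k) s.
have P0 k : P k 0 = a0 k by rewrite /P pint_le0// addr0.
have dP k (s : R) : 0 < s -> is_derive s (1 : R) (P k) (rotf b k s).
  move=> s0; have d := pint_derive (cts_rotf (k := k) cb) s0.
  by have := is_deriveD (is_derive_cst (a0 k) s 1) d; rewrite add0r.
have cP k : continuous (P k).
  by move=> s; apply: cvgD; [exact: cvg_cst|apply: pint_cts; exact: cts_rotf].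
pose v s k := ip mu (V s) (trig k).
have vE s k : 0 <= s -> (k < M)%N -> v s k = sgrp s (P ^~ s) k.
  move=> s0 kM.
  have -> : v s k = sgrp s a0 k + duhamel (fun s j => quad j (nl A z V s)) s k.
    by rewrite /v cV /picard_map kM tp_id.
  have alg (E C S a a' p p' : R) : E * (C * a + S * a') + E * (C * p + S * p') =
    E * (C * (a + p) + S * (a' + p')) by ring.
  by rewrite (duhamelE s k cq) /sgrp /P /b; exact: alg.
have v0 s k : (M <= k)%N -> v s k = 0 by move=> Mk; rewrite /v cV /picard_map ltnNge Mk.
have flux s : 0 <= s -> - 2 * (\sum_(k < M) fr R k ^+ 2 * v s k ^+ 2) +
    2 * (\sum_(k < M) v s k * b s k) <=
    4 * (\sum_(k < M) `|ip mu (z s) (trig k)|) ^+ 2 * (\sum_(k < M) v s k ^+ 2 + Bz ^+ 2).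
  move=> s0; pose th := A / Num.max A (nrm mu (V s)).
  have mx : 0 < Num.max A (nrm mu (V s)) by rewrite lt_max A0.
  have th01 : 0 <= th <= 1.
    by rewrite /th divr_ge0 ?(ltW A0) ?(ltW mx)//= ler_pdivrMr// mul1r le_max lexx.
  have sz := tz.1 s; have sV := tV.1 s.
  have := @energy_flux (v s) (fun k => ip mu (z s) (trig k)) N th Bz (nl A z V s) (tn.1 s) th01 _ _ Bz0.
  have h0 : 0 <= \sum_(k < M) v s k ^+ 2 by apply: sumr_ge0 => k _; exact: sqr_ge0.
  have := sqr_ge0 Bz; have := sqr_ge0 (\sum_(k < M) `|ip mu (z s) (trig k)|).
  rewrite -/M; move: h0.
  have -> : \sum_(k < M) v s k * ddxc (quad (R:=R) ^~ (nl A z V s)) k = \sum_(k < M) v s k * b s k by [].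
  set X1 := \sum_(k < M) v s k * _; set X2 := \sum_(k < M) fr R k ^+ 2 * _.
  set X3 := (\sum_(k < M) `|_|) ^+ 2; set X4 := \sum_(k < M) v s k ^+ 2 => h4 h3 hB h.
  (* the dissipation cancels the term [2 * X2] of the flux bound *)
  suff : 2 * X1 <= 2 * X2 + X3 * (4 * X4 + Bz ^+ 2) by have := mulr_ge0 h3 hB; nra.
  apply: h => [k|].
    rewrite /nl /cut ipDl//; [|exact: sqiZ|exact: sqi_trig].
    rewrite ipZl//; last exact: sqi_trig.
    case: ltnP => // Mk; rewrite zM// addr0 -/(v s k) v0// mulr0; done.
  apply: le_trans (bessel_trig _ (tz.1 s)) _.
  by rewrite lerXn2r ?nnegrE ?nrm_ge0.
pose Y s := \sum_(k < M) expR (- (2 * fr R k ^+ 2 * s)) * P k s ^+ 2.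
have YE s : 0 <= s -> Y s = \sum_(k < M) v s k ^+ 2.
  move=> s0; have := @rot_sum (fun=> 1) s (P ^~ s) N (fun=> erefl).
  under eq_bigr do rewrite mul1r; under [X in _ = X]eq_bigr do rewrite mul1r.
  rewrite /Y => h; apply: etrans (esym h) _.
  by apply: eq_bigr => -[k hk] _ /=; rewrite vE.
have cY : continuous Y.
  move=> s; apply: (@cvg_ordsum _ _ _ _ _ (fun k t => expR (- (2 * fr R k ^+ 2 * t)) * P k t ^+ 2)
    (fun k => expR (- (2 * fr R k ^+ 2 * s)) * P k s ^+ 2)) => k.
  by apply: cvgM; [exact: cts_expR_linN|apply: cvg_sqr; exact: cP].
pose g s := 4 * (\sum_(k < M) `|ip mu (z s) (trig k)|) ^+ 2.
have cg : continuous g.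
  move=> s; apply: cvgM; first exact: cvg_cst.
  apply: cvg_sqr; apply: (@cvg_ordsum _ _ _ _ _ (fun k s => `|ip mu (z s) (trig k)|)
     (fun k => `|ip mu (z s) (trig k)|)) => k.
  by apply: cvg_norm; apply: tcont_ip => //; exact: sqi_trig.
have gr := @gronwall Y g (Bz ^+ 2) t cY cg t0 _.
apply: (@le_trans _ _ (Y t + Bz ^+ 2)).
  apply: (@le_trans _ _ (Y t)); last by rewrite lerDl sqr_ge0.
  rewrite YE//; apply: nrm_le_trig; first exact: tV.1.
  move=> n; rewrite -(big_mkord xpredT (fun k => v t k ^+ 2)).
  have [nM|Mn] := leqP n M.
    rewrite -[leRHS](big_mkord xpredT (fun k => v t k ^+ 2)) [leRHS](big_cat_nat _ (n := n))//=.
    by rewrite lerDl sumr_ge0// => k _; exact: sqr_ge0.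
  rewrite (big_cat_nat _ (n := M))//=; last exact: ltnW.
  rewrite big_mkord [X in _ + X]big_nat_cond [X in _ + X]big1 ?addr0//.
  by move=> k /andP[/andP[Mk _] _]; rewrite v0// expr0n.
apply: le_trans (gr _) _.
  move=> s s0; exists (- 2 * (\sum_(k < M) fr R k ^+ 2 * sgrp s (P ^~ s) k ^+ 2) +
    2 * \sum_(k < M) sgrp s (P ^~ s) k * b s k).
    by apply: energy_derive => k; exact: dP.
  rewrite YE ?(ltW s0)//; have := flux s (ltW s0).
  have -> : \sum_(k < M) fr R k ^+ 2 * v s k ^+ 2 = \sum_(k < M) fr R k ^+ 2 * sgrp s (P ^~ s) k ^+ 2.
    by apply: eq_bigr => k _; rewrite vE// ltW.
  have -> // : \sum_(k < M) v s k * b s k = \sum_(k < M) sgrp s (P ^~ s) k * b s k.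
  by apply: eq_bigr => k _; rewrite vE// ltW.
rewrite ler_wpM2r ?expR_ge0// lerD2r; apply: le_trans (a0M M); apply: ler_sum => k _.
by rewrite mulr0 oppr0 expR0 mul1r P0.
Qed.

End Energy.

(** * Stability, passage to the limit, and uniqueness of paths *)

Section Stability.
Context (R : realType).
Notation mu := (torus R).
Implicit Types (f g : R -> R) (U V W X Y F G : R -> R -> R).

Lemma tcontB U V : tcont U -> tcont V -> tcont (fun t x => U t x - V t x).
Proof.
move=> tU [sV cV]; apply: tcontD => //; split=> [t|t]; first exact: sqiN.
apply: cvg_bound (cV t) _ => s; rewrite subr0 ger0_norm ?nrm_ge0//.
rewrite nrm_distC//; try exact: sqiN.
by eqle; congr nrm; apply/funext => x; ring.
Qed.

(** The factor [1 / m] gained by the weight [exp (m ^ 2 t)] absorbs the Lipschitz constant of the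
    nonlinearity, when the weighted distance is evaluated at the time where it is largest. The
    mask and the error [e] serve to compare Galerkin approximations with the limit; uniqueness is
    the case [e = 0]. *)
Lemma stability (L T : R) : 0 < L -> 0 <= T -> exists2 C, 0 < C &
  forall X Y F G (msk : nat -> bool) (e : R), tcont X -> tcont Y -> tcont F -> tcont G ->
  0 <= e ->
  (forall t, 0 <= t <= T -> nrm mu (F t) <= L /\ nrm mu (G t) <= L) ->
  (forall t, 0 <= t <= T -> nrm mu (fun x => F t x - G t x) <=
      2 * nrm mu (fun x => X t x - Y t x) + e) ->
  (forall t k, 0 <= t <= T -> msk k -> ip mu (fun x => X t x - Y t x) (trig k) =
     duhamel (fun s j => quad j (F s)) t k - duhamel (fun s j => quad j (G s)) t k) ->
  (forall t n, 0 <= t <= T ->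
     \sum_(k < n) (if msk k then 0 else ip mu (fun x => X t x - Y t x) (trig k) ^+ 2) <= e ^+ 2) ->
  forall t, 0 <= t <= T -> nrm mu (fun x => X t x - Y t x) <= C * e.
Proof.
move=> L0 T0.
have [m [m0 mL]] : exists m : nat, (0 < m)%N /\ 2048 * L ^+ 2 <= m%:R.
  exists (Num.truncn (2048 * L ^+ 2)).+1; split => //; apply/ltW.
  by have := truncnS_gt (2048 * L ^+ 2).
have m00 : 0 < m%:R :> R by rewrite ltr0n.
pose E (t : R) : R := expR (m%:R ^+ 2 * t).
have E0 (t : R) : 0 < E t by exact: expR_gt0.
have E1 (t : R) : 0 <= t -> 1 <= E t by move=> t0; apply: ler1_expR; rewrite mulr_ge0 ?sqr_ge0.
exists (3 * E T); first by rewrite mulr_gt0.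
move=> X Y F G msk e tX tY tF tG e0 FGL FGe dd tl.
have tD := tcontB tX tY.
pose w t := nrm mu (fun x => X t x - Y t x) * expR (- (m%:R ^+ 2 * t)).
have cw : continuous w.
  by move=> t; apply: cvgM; [exact: tcont_nrm|exact: cts_expR_linN].
have [c /[!in_itv]/= cT wc] := EVT_max T0 (continuous_subspaceT cw).
set dl := w c in wc.
have dl0 : 0 <= dl by rewrite mulr_ge0 ?nrm_ge0 ?expR_ge0.
have wE t : nrm mu (fun x => X t x - Y t x) = w t * E t.
  by rewrite /w /E -mulrA -expRD addNr expR0 mulr1.
have wle t : 0 <= t <= T -> nrm mu (fun x => X t x - Y t x) <= dl * E t.
  by move=> tT; rewrite wE ler_wpM2r ?(ltW (E0 t))// wc// in_itv.
have c0 : 0 <= c by case/andP: cT.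
(* [c] is the time at which the weighted distance [w] is largest, with value [dl] *)
have key : nrm mu (fun x => X c x - Y c x) <= (2 * dl + e) * E c / 4 + e.
  have hp : 0 <= (2 * dl + e) * E c / 4.
    by rewrite divr_ge0// mulr_ge0 ?(ltW (E0 c))// addr_ge0// mulr_ge0.
  rewrite -ler_sqr ?nnegrE ?nrm_ge0 ?addr_ge0//.
  apply: nrm_le_trig; first exact: tD.1.
  move=> n; pose f s j := quad j (F s) - quad j (G s).
  have cF j : continuous (fun s => quad j (F s)) by exact: tcont_quad.
  have cG j : continuous (fun s => quad j (G s)) by exact: tcont_quad.
  have cf j : continuous (fun s => f s j) by move=> s; apply: cvgB; [exact: cF|exact: cG].
  have fM s j : 0 <= s <= c -> `|f s j| <= 2 * L * (2 * dl + e) * expR (m%:R ^+ 2 * s).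
    move=> /andP[s0 sc]; have sT : 0 <= s <= T by rewrite s0 (le_trans sc)//; case/andP: cT.
    have [FL GL] := FGL s sT.
    apply: le_trans (quadB j (tF.1 s) (tG.1 s)) _.
    have h1 : nrm mu (fun x => F s x - G s x) <= (2 * dl + e) * E s.
      apply: le_trans (FGe s sT) _; rewrite [leRHS]mulrDl; apply: lerD.
        by rewrite -mulrA ler_wpM2l// wle.
      by rewrite ler_peMr// E1.
    rewrite (_ : 2 * L * _ * _ = (2 * dl + e) * E s * (L + L)); last by rewrite /E; ring.
    by apply: ler_pM; rewrite ?nrm_ge0 ?addr_ge0 ?nrm_ge0//; exact: lerD.
  apply: (@le_trans _ _ (\sum_(k < n) duhamel f c k ^+ 2 +
     \sum_(k < n) (if msk k then 0 else ip mu (fun x => X c x - Y c x) (trig k) ^+ 2))).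
    rewrite -big_split/=; apply: ler_sum => k _; case: ifP => mk.
      by rewrite addr0 dd// (duhamelB c k cF cG).
    by rewrite lerDr sqr_ge0.
  have h2 := tl c n cT.
  have h1 : \sum_(k < n) duhamel f c k ^+ 2 <= ((2 * dl + e) * E c / 4) ^+ 2.
    have := duhamel_sum m0 c0 (leq0n n) cf fM; rewrite big_mkord => /le_trans; apply.
    rewrite add0r ler_pdivrMr// -/(E c).
    rewrite (_ : 32 * _ = ((2 * dl + e) * E c / 4) ^+ 2 * (2048 * L ^+ 2)); last by field.
    by rewrite ler_wpM2l// sqr_ge0.
  have := mulr_ge0 hp e0; set x := (_ / 4) in h1 *; nra.
have : dl <= 3 * e.
  have : w c * E c <= (2 * dl + e) * E c / 4 + e * E c.
    rewrite -wE; apply: le_trans key _; rewrite lerD2l ler_peMr// E1//.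
  rewrite -/dl (_ : _ + _ = ((2 * dl + e) / 4 + e) * E c); last by field.
  rewrite ler_pM2r//; lra.
move=> dle t tT; apply: le_trans (wle t tT) _.
rewrite (_ : 3 * _ * _ = 3 * e * E T); last by ring.
apply: ler_pM => //; first exact: ltW.
by rewrite ler_expR ler_wpM2l ?sqr_ge0//; case/andP: tT.
Qed.

Definition proj n U t : R -> R := tpsum (fun k => ip mu (U t) (trig k)) n.

Lemma tpsumB (a b : nat -> R) n x :
  tpsum a n x - tpsum b n x = tpsum (fun k => a k - b k) n x.
Proof. by rewrite /tpsum /psum -sumrB; apply: eq_bigr => k _; rewrite mulrBl. Qed.

Lemma nrm_proj n f : sqi mu f ->
  nrm mu (tpsum (fun k => ip mu f (trig k)) n) <= nrm mu f.
Proof.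
by move=> sf; rewrite -ler_sqr ?nnegrE ?nrm_ge0// nrm_tpsum; exact: bessel_trig.
Qed.

Lemma proj_coord n U t k : ip mu (proj n U t) (trig k) =
  if (k < n)%N then ip mu (U t) (trig k) else 0.
Proof. exact: tpsum_coord. Qed.

Lemma tcont_proj n U : tcont U -> tcont (proj n U).
Proof.
move=> [sU cU]; split=> [t|t]; first exact: sqi_tpsum.
apply: cvg_bound (cU t) _ => s; rewrite subr0 ger0_norm ?nrm_ge0//.
have -> : (fun x => proj n U s x - proj n U t x) =
    tpsum (fun k => ip mu (fun x => U s x - U t x) (trig k)) n.
  apply/funext => x; rewrite /proj tpsumB; congr (tpsum _ _ _).
  by apply/funext => k; rewrite ipBl//; exact: sqi_trig.
by apply: nrm_proj; exact: sqiB.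
Qed.

(** The path over [[0, T]] is compact. *)
Lemma proj_unif U (T e : R) : tcont U -> 0 < e -> exists N, forall n t, (N <= n)%N ->
  0 <= t <= T -> nrm mu (fun x => U t x - proj n U t x) <= e.
Proof.
move=> tU e0; have [sU cU] := tU.
have cK : compact (`[0, T] : set R) by exact: segment_compact.
have e3 : 0 < e / 3 by rewrite divr_gt0.
have := (compact_near_coveringP _).1 cK nat \oo
  (fun n t => nrm mu (fun x => U t x - proj n U t x) <= e) _.
case.
  move=> t _; have := psum_cvg (@sqi_trig R) (@orth_trig R) (@trig_total R) (sU t).
  move/cvgrPdist_le => /(_ _ e3) hn; move/cvgrPdist_le : (cU t) => /(_ _ e3) ht.
  exists ([set s | `|0 - nrm mu (fun x => U s x - U t x)| <= e / 3],
     [set n | `|0 - nrm mu (fun x => U t x - proj n U t x)| <= e / 3]) => //=.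
  move=> [s n] /= []; rewrite !sub0r !normrN !ger0_norm ?nrm_ge0// => h1 h2.
  have sp i r : sqi mu (proj i U r) by exact: sqi_tpsum.
  have tp := tcont_proj n tU.
  have h3 := nrm_tri (sU s) (sU t) (sp n s).
  have h4 := nrm_tri (sU t) (sp n t) (sp n s).
  have h5 : nrm mu (fun x => proj n U t x - proj n U s x) <= e / 3.
    rewrite nrm_distC//; apply: le_trans h1.
    have -> : (fun x => proj n U s x - proj n U t x) =
        tpsum (fun k => ip mu (fun x => U s x - U t x) (trig k)) n.
      apply/funext => x; rewrite /proj tpsumB; congr (tpsum _ _ _).
      by apply/funext => k; rewrite ipBl//; exact: sqi_trig.
    by apply: nrm_proj; exact: sqiB.
  rewrite (_ : e = e / 3 + (e / 3 + e / 3)); last by field.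
  exact: le_trans h3 (lerD h1 (le_trans h4 (lerD h2 h5))).
move=> N _ HN; exists N => n t Nn tT; apply: (HN n Nn t); by rewrite /= in_itv.
Qed.

Lemma cauchy_sum (a b : nat -> R) n :
  (\sum_(k < n) a k * b k) ^+ 2 <= (\sum_(k < n) a k ^+ 2) * (\sum_(k < n) b k ^+ 2).
Proof.
have := cauchy_schwarz (sqi_tpsum a n) (sqi_tpsum b n).
rewrite -ler_sqr ?nnegrE ?mulr_ge0 ?nrm_ge0// exprMn !nrm_tpsum real_normK ?num_real//.
rewrite {1}/tpsum {1}/tpsum ip_psum2//; [exact: sqi_trig|exact: orth_trig].
Qed.

(** Cauchy-Schwarz against the summable sequence [1 / fr ^ 2]: the supremum norm of the noise is
    controlled by its [H1] norm. *)
Lemma sum_fr (ze : nat -> R) n : ze 0%N = 0 ->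
  (\sum_(k < n) `|ze k|) ^+ 2 <= 32 * \sum_(k < n) fr R k ^+ 2 * ze k ^+ 2.
Proof.
move=> z0; have -> : \sum_(k < n) `|ze k| = \sum_(k < n) (fr R k * `|ze k|) * (fr R k)^-1.
  apply: eq_bigr => -[[|k] hk] _ /=; first by rewrite z0 normr0 mulr0 mul0r.
  have k0 : fr R k.+1 != 0 by rewrite /fr pnatr_eq0 /freq; lia.
  by rewrite mulrAC mulfV// mul1r.
apply: le_trans (cauchy_sum (fun k => fr R k * `|ze k|) (fun k => (fr R k)^-1) n) _.
rewrite mulrC; apply: ler_pM.
- by apply: sumr_ge0 => k _; exact: sqr_ge0.
- by apply: sumr_ge0 => k _; exact: sqr_ge0.
- have := sum_kernel R (ltn0Sn 0) (leq0n n); rewrite big_mkord add0r divr1 => h.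
  apply: (@le_trans _ _ (4 * \sum_(k < n) (fr R k / (fr R k ^+ 2 + 1%:R ^+ 2)) ^+ 2)); last lra.
  rewrite mulr_sumr; apply: ler_sum => -[[|k] hk] _ /=.
    by rewrite fr0 invr0 expr0n/= mulr_ge0// sqr_ge0.
  have k1 : 1 <= fr R k.+1 by rewrite /fr ler1n /freq; lia.
  set y := fr R k.+1 in k1 *; rewrite expr1n.
  rewrite (_ : 4 * _ = (2 * y / (y ^+ 2 + 1)) ^+ 2); last by rewrite expr_div_n [RHS]expr_div_n; ring.
  have y0 : 0 < y by lra.
  have y2 : 0 < y ^+ 2 + 1 by nra.
  rewrite lerXn2r ?nnegrE ?invr_ge0 ?(ltW y0)//.
    by rewrite divr_ge0 ?(ltW y2)// mulr_ge0// ltW.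
  rewrite ler_pdivlMr// mulrC ler_pdivrMr//; nra.
- apply: ler_sum => k _; rewrite exprMn real_normK ?num_real//.
Qed.

Lemma pint_sum (h : nat -> R -> R) n (t : R) : (forall k, continuous (h k)) ->
  pint (fun s => \sum_(k < n) h k s) t = \sum_(k < n) pint (h k) t.
Proof.
move=> ch; elim: n => [|n ih].
  rewrite big_ord0 /pint; under eq_Rintegral do rewrite big_ord0.
  by rewrite Rintegral_cst//; rewrite mul0r.
rewrite big_ord_recr/= -ih -pintD//.
  by apply: pint_eq => s _; rewrite big_ord_recr.
by move=> s; apply: (@cvg_ordsum _ _ _ _ _ h (fun k => h k s)) => k; exact: ch.
Qed.

(** The Galerkin approximations obey [galerkin_energy] and converge to [V] uniformly, by
    [stability]. Since the bound does not depend on [A], the cut-off is inactive once [A] exceeds it. *)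
Lemma energy_bound (A : R) (a0 : nat -> R) (z V : R -> R -> R) (Bz M0 H T : R) :
  0 < A -> 0 <= T -> (forall N, \sum_(k < N) a0 k ^+ 2 <= M0) ->
  tcont z -> (forall t, nrm mu (z t) <= Bz) ->
  (forall t, ip mu (z t) (trig 0) = 0) ->
  (forall N t, 0 <= t <= T ->
    \sum_(k < N) fr R k ^+ 2 * pint (fun s => ip mu (z s) (trig k) ^+ 2) t <= H) ->
  tcont V ->
  (forall t k, ip mu (V t) (trig k) = picard_map A (fun=> true) a0 z V t k) ->
  forall t, 0 <= t <= T ->
  nrm mu (V t) ^+ 2 <= (M0 + Bz ^+ 2) * expR (128 * H).
Proof.
move=> A0 T0 a0M tz zB zm zH tV cV.
have Bz0 : 0 <= Bz by exact: le_trans (nrm_ge0 _ _) (zB 0).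
have M00 : 0 <= M0 by have := a0M 0%N; rewrite big_ord0.
have L0 : 0 < A + Bz by exact: ltr_pwDl.
set K := (M0 + _) * _; have K0 : 0 <= K by rewrite mulr_ge0 ?expR_ge0// addr_ge0// sqr_ge0.
have [C C0 HC] := stability L0 T0.
have approx (e : R) : 0 < e -> forall t, 0 <= t <= T -> nrm mu (V t) <= Num.sqrt K + C * e.
  move=> e0; have [N1 HN1] := proj_unif T tV e0; have [N2 HN2] := proj_unif T tz e0.
  pose N := maxn N1 N2; pose M := N.*2.+1.
  have NM : (N <= M)%N by rewrite /M -addnn -addnS leq_addr.
  have N1M : (N1 <= M)%N := leq_trans (leq_maxl N1 N2) NM.
  have N2M : (N2 <= M)%N := leq_trans (leq_maxr N1 N2) NM.
  pose zN := proj M z.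
  have tzN : tcont zN by exact: tcont_proj.
  have zNB t : nrm mu (zN t) <= Bz by apply: le_trans (nrm_proj _ (tz.1 t)) _.
  have zNM t k : (M <= k)%N -> ip mu (zN t) (trig k) = 0.
    by move=> Mk; rewrite proj_coord ltnNge Mk.
  have [VN [tVN cVN _]] := cutoff_solution_ex (fun k => (k < M)%N) A0 a0M tzN zNB.
  move=> t tT; have t0 : 0 <= t by case/andP: tT.
  have hN : nrm mu (VN t) <= Num.sqrt K.
    rewrite -ler_sqr ?nnegrE ?nrm_ge0 ?sqrtr_ge0// [Num.sqrt K ^+ 2]sqr_sqrtr//.
    apply: le_trans (galerkin_energy (N := N) A0 a0M tzN zNB zNM tVN cVN t0) _.
    rewrite ler_wpM2l ?addr_ge0 ?sqr_ge0// ler_expR.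
    have cz k : continuous (fun s => ip mu (z s) (trig k)) by apply: tcont_ip => //; exact: sqi_trig.
    have czN k : continuous (fun s => ip mu (zN s) (trig k)) by apply: tcont_ip => //; exact: sqi_trig.
    have c2 k : continuous (fun s => fr R k ^+ 2 * ip mu (z s) (trig k) ^+ 2).
      by move=> s; apply: cvgM; [exact: cvg_cst|apply: cvg_sqr; exact: cz].
    have cs : continuous (fun s => \sum_(k < M) fr R k ^+ 2 * ip mu (z s) (trig k) ^+ 2).
      move=> s; apply: (@cvg_ordsum _ _ _ _ _ (fun k s => fr R k ^+ 2 * ip mu (z s) (trig k) ^+ 2)
        (fun k => fr R k ^+ 2 * ip mu (z s) (trig k) ^+ 2)) => k; exact: c2.
    apply: (@le_trans _ _ (pint (fun s => 128 * \sum_(k < M) fr R k ^+ 2 * ip mu (z s) (trig k) ^+ 2) t)).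
      apply: le_pint.
      - move=> s; apply: cvgM; first exact: cvg_cst.
        apply: cvg_sqr; apply: (@cvg_ordsum _ _ _ _ _ (fun k s => `|ip mu (zN s) (trig k)|)
           (fun k => `|ip mu (zN s) (trig k)|)) => k.
        by apply: cvg_norm; exact: czN.
      - by move=> s; apply: cvgM; [exact: cvg_cst|exact: cs].
      - move=> s _; rewrite (_ : 128 = 4 * 32 :> R); last by ring.
        rewrite -mulrA ler_wpM2l//.
        have -> : \sum_(k < M) `|ip mu (zN s) (trig k)| = \sum_(k < M) `|ip mu (z s) (trig k)|.
          by apply: eq_bigr => k _; rewrite proj_coord ltn_ord.
        exact: (@sum_fr (fun k => ip mu (z s) (trig k))).
    rewrite pintZ//; apply: ler_wpM2l => //.
    rewrite (pint_sum M t c2); apply: le_trans (zH M t tT); apply: ler_sum => k _.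
    by rewrite pintZ// => s; apply: cvg_sqr; exact: cz.
  have hd : nrm mu (fun x => VN t x - V t x) <= C * e.
    apply: (HC VN V (nl A zN VN) (nl A z V) (fun k => (k < M)%N) e tVN tV).
    - exact: tcont_nl.
    - exact: tcont_nl.
    - exact: ltW.
    - by move=> s _; split; exact: nl_le.
    - move=> s sT.
      have -> : (fun x => nl A zN VN s x - nl A z V s x) =
          (fun x => (cut A (VN s) x - cut A (V s) x) + (zN s x - z s x)).
        by apply/funext => x; rewrite /nl; ring.
      apply: le_trans (ler_nrmD (sqiB (sqi_cut A (tVN.1 s)) (sqi_cut A (tV.1 s)))
         (sqiB (tzN.1 s) (tz.1 s))) _.
      apply: lerD; first by apply: cutB => //; [exact: tVN.1|exact: tV.1].
      rewrite nrm_distC; [|exact: tzN.1|exact: tz.1].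
      exact: HN2 N2M sT.
    - move=> s k /andP[s0 _] kM; rewrite ipBl; [|exact: tVN.1|exact: tV.1|exact: sqi_trig].
      rewrite cVN cV /picard_map kM (tp_id s0) opprD addrACA subrr add0r; exact: erefl.
    - move=> s n sT.
      apply: (@le_trans _ _ (\sum_(k < n) ip mu (fun x => V s x - proj M V s x) (trig k) ^+ 2)).
        apply: ler_sum => k _; case: ifP => kM; first exact: sqr_ge0.
        have sp : sqi mu (proj M V s) by exact: sqi_tpsum.
        rewrite !ipBl; try exact: sqi_trig; try exact: tVN.1; try exact: tV.1; try exact: sp.
        by rewrite proj_coord kM cVN /picard_map kM sub0r subr0 sqrrN.
      have sp : sqi mu (proj M V s) by exact: sqi_tpsum.
      apply: le_trans (bessel_trig _ (sqiB (tV.1 s) sp)) _.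
      rewrite lerXn2r ?nnegrE ?nrm_ge0 ?(ltW e0)//.
      exact: HN1 N1M sT.
    - exact: tT.
  have := ler_dist_nrm (tVN.1 t) (tV.1 t); rewrite ler_norml => /andP[]; lra.
move=> t tT.
have : nrm mu (V t) <= Num.sqrt K.
  apply/ler_addgt0Pr => e e0.
  have := approx (e / C) (divr_gt0 e0 C0) t tT.
  by rewrite mulrCA mulfV ?mulr1// gt_eqF.
by rewrite -ler_sqr ?nnegrE ?nrm_ge0 ?sqrtr_ge0// [Num.sqrt K ^+ 2]sqr_sqrtr.
Qed.

(** The case [e = 0] of [stability], in which [L] is a common bound of the two paths on [[0, T]]. *)
Lemma duhamel_uniq (T : R) U W : 0 <= T -> tcont U -> tcont W ->
  (forall t k, 0 <= t <= T -> ip mu (U t) (trig k) - duhamel (fun s j => quad j (U s)) t k =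
     ip mu (W t) (trig k) - duhamel (fun s j => quad j (W s)) t k) ->
  forall t, 0 <= t <= T -> {ae mu, forall x, U t x = W t x}.
Proof.
move=> T0 tU tW UW t tT.
have [L L0 HL] : exists2 L, 0 < L & forall t, 0 <= t <= T -> nrm mu (U t) <= L /\ nrm mu (W t) <= L.
  have [c _ hc] := EVT_max T0 (continuous_subspaceT (tcont_nrm tU)).
  have [d _ hd] := EVT_max T0 (continuous_subspaceT (tcont_nrm tW)).
  exists (1 + nrm mu (U c) + nrm mu (W d)).
    have := nrm_ge0 mu (U c); have := nrm_ge0 mu (W d); lra.
  move=> s sT; have := hc s; have := hd s; rewrite in_itv/= => /(_ sT) h1 /(_ sT) h2.
  have := nrm_ge0 mu (U c); have := nrm_ge0 mu (W d); split; lra.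
have [C C0 HC] := stability L0 T0.
have : nrm mu (fun x => U t x - W t x) <= C * 0.
  apply: (HC U W U W (fun=> true) 0) => //.
  - move=> s sT; rewrite addr0 mulr_natl mulr2n lerDl; exact: nrm_ge0.
  - move=> s k sT _; have swap (a b c d : R) : a - b = c - d -> a - c = b - d by lra.
    rewrite ipBl; [|exact: tU.1|exact: tW.1|exact: sqi_trig]; exact: swap (UW s k sT).
  - by move=> s n sT; rewrite big1 // expr0n.
rewrite mulr0 => h; have s := sqiB (tU.1 t) (tW.1 t).
have : nrm mu (fun x => U t x - W t x) = 0 by apply/eqP; rewrite eq_le h nrm_ge0.
move=> /(nrm_eq0 s); apply: (@filterS _ _ (ae_filter_ringOfSetsType mu)) => x /eqP.
by rewrite subr_eq0 => /eqP.
Qed.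

End Stability.

(** * Brownian increments *)

Section Gauss.
Context (R : realType).
Notation leb := (@lebesgue_measure R).

Lemma normal_sym (s : R) (A : set (measurableTypeR R)) : s != 0 -> measurable A ->
  normal_prob 0 s ((-%R : R -> R) @^-1` A) = normal_prob 0 s A.
Proof.
move=> s0 mA; have mN : measurable_fun [set: R] (-%R : measurableTypeR R -> measurableTypeR R).
  exact: oppr_measurable.
have mp : measurable_fun A (fun x : measurableTypeR R => (normal_pdf 0 s x)%:E).
  by apply: measurable_funTS; apply/measurable_EFinP; exact: measurable_normal_pdf.
rewrite /normal_prob; transitivity (\int[pushforward leb (-%R : R -> measurableTypeR R)]_(x in A) (normal_pdf 0 s x)%:E)%E.
  rewrite ge0_integral_pushforward//=; last by move=> x _; rewrite lee_fin normal_pdf_ge0.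
  by apply: eq_integral => x _ /=; rewrite !normal_pdfE// /normal_fun !subr0 sqrrN.
by apply: eq_measure_integral => B mB _; exact: lebesgue_measureN.
Qed.

Import HBNNSimple.

Lemma normal_int_le (s : R) (f : R -> R) : measurable_fun [set: R] f -> (forall x, 0 <= f x) ->
  (\int[normal_prob 0 s]_x (f x)%:E <= \int[leb]_x (f x * normal_pdf 0 s x)%:E)%E.
Proof.
move=> mf f0; rewrite ge0_integralTE//; apply: ge_ereal_sup => _ [h hf <-].
have mpdf := measurable_normal_pdf (0 : R) s.
rewrite sintegralE.
pose g (x : R) (y : measurableTypeR R) := (x * \1_((h : R -> R) @^-1` [set x]) y * normal_pdf 0 s y)%:E.
rewrite (eq_fsbigr (fun x => \int[leb]_y g x y)%E); last first.
  move=> x /[!inE] -[y _ <-]; set A : set (measurableTypeR R) := (h : R -> R) @^-1` _.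
  have mh : measurable_fun [set: measurableTypeR R] (h : R -> R) by [].
  have mA : measurable A by rewrite -[A]setTI; apply: mh => //; exact: measurable_set1.
  have h0 : 0 <= (h : R -> R) y by exact: fun_ge0.
  rewrite /= /normal_prob integral_mkcond epatch_indic -ge0_integralZl//.
  - by apply: eq_integral => z _; rewrite /g -!EFinM; congr EFin; ring.
  - apply/measurable_EFinP; apply: mfunM => //; exact: measurable_indic.
  - by move=> z _; rewrite mule_ge0// lee_fin ?normal_pdf_ge0.
have mg x : measurable_fun [set: R] (fun y => x * \1_((h : R -> R) @^-1` [set x]) y * normal_pdf 0 s y).
  have mh : measurable_fun [set: measurableTypeR R] (h : R -> R) by [].
  apply: mfunM => //; apply: mfunM => //; apply: measurable_indic.
  by rewrite -[_ @^-1` _]setTI; apply: mh => //; exact: measurable_set1.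
rewrite -ge0_integral_fsum//; last 2 first.
- by move=> x; apply/measurable_EFinP; exact: mg.
- move=> x y _; rewrite lee_fin mulr_ge0 ?normal_pdf_ge0//.
  rewrite indicE; case: (boolP (y \in _)) => /=; last by rewrite mulr0.
  by rewrite inE /= => <-; rewrite mulr1; exact: fun_ge0.
apply: ge0_le_integral => //.
- move=> x _; rewrite /g fsumEFin// lee_fin -mulr_fsuml.
  rewrite mulr_ge0 ?normal_pdf_ge0// -(fimfunE h); exact: fun_ge0.
- apply: emeasurable_fsum => // x; apply/measurable_EFinP; exact: mg.
- by apply/measurable_EFinP; exact: mfunM.
- move=> x _; rewrite /g fsumEFin// lee_fin -mulr_fsuml -(fimfunE h).
  by rewrite ler_wpM2r ?normal_pdf_ge0//; have := hf x; rewrite lee_fin.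
Qed.

(** A crude constant suffices: [x ^ 2 exp (- x ^ 2 / 2 s ^ 2)] is dominated by a multiple of the
    Gaussian of variance [2 s ^ 2]. *)
Lemma normal_m2 (s : R) : 0 < s ->
  (\int[normal_prob 0 s]_x (x ^+ 2)%:E <= (8 * s ^+ 2)%:E)%E.
Proof.
move=> s0; pose r := Num.sqrt 2 * s.
have q0 : 0 < Num.sqrt 2 :> R by rewrite sqrtr_gt0.
have q2 : Num.sqrt 2 ^+ 2 = 2 :> R by rewrite sqr_sqrtr.
have q3 : Num.sqrt 2 <= 2 :> R.
  by rewrite -ler_sqr ?nnegrE ?(ltW q0)// q2; lra.
have r0 : 0 < r by exact: mulr_gt0.
have mpdf := measurable_normal_pdf (0 : R) r.
apply: (@le_trans _ _ (\int[leb]_x ((8 * s ^+ 2)%:E * (normal_pdf 0 r x)%:E)%E)%E); last first.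
  rewrite ge0_integralZl//; [|exact/measurable_EFinP|by move=> x _; rewrite lee_fin normal_pdf_ge0|].
    by rewrite integral_normal_pdf mule1.
  by rewrite lee_fin mulr_ge0// sqr_ge0.
apply: le_trans (normal_int_le s _ _) _.
- by apply: measurable_funX.
- by move=> x; exact: sqr_ge0.
apply: ge0_le_integral => //.
- by move=> x _; rewrite lee_fin mulr_ge0 ?sqr_ge0 ?normal_pdf_ge0.
- apply/measurable_EFinP; apply: mfunM; [exact: measurable_funX|exact: measurable_normal_pdf].
- by apply/measurable_EFinP; apply: mfunM => //.
move=> x _; rewrite -EFinM lee_fin !normal_pdfE ?gt_eqF// /normal_fun !subr0.
have -> : normal_peak s = Num.sqrt 2 * normal_peak r.
  rewrite /normal_peak /r exprMn q2.
  have -> : 2 * s ^+ 2 * pi *+ 2 = 2 * (s ^+ 2 * pi *+ 2) :> R by rewrite mulrnAr !mulrA.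
  rewrite sqrtrM// invfM mulrA mulfV ?mul1r// gt_eqF//.
have p0 : 0 < normal_peak r by apply: normal_peak_gt0; rewrite gt_eqF.
set y := x ^+ 2 / (4 * s ^+ 2).
have y0 : 0 <= y by rewrite divr_ge0 ?sqr_ge0// mulr_ge0// sqr_ge0.
have s20 : 0 < s ^+ 2 by rewrite exprn_gt0.
have -> : - x ^+ 2 / (s ^+ 2 *+ 2) = - y - y by rewrite /y -mulr_natr; field; rewrite gt_eqF.
have -> : - x ^+ 2 / (r ^+ 2 *+ 2) = - y.
  by rewrite /y /r exprMn q2 -mulr_natr; field; rewrite gt_eqF.
have -> : x ^+ 2 = 4 * s ^+ 2 * y by rewrite /y; field; rewrite gt_eqF.
rewrite expRD; set E := expR (- y).
have E0 : 0 < E by exact: expR_gt0.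
have yE : y * E <= 1.
  rewrite /E expRN ler_pdivrMr ?expR_gt0// mul1r.
  by apply: le_trans (expR_ge1Dx y); lra.
rewrite (_ : _ * _ = (4 * s ^+ 2 * Num.sqrt 2 * (y * E)) * (normal_peak r * E)); last by ring.
rewrite ler_wpM2r ?mulr_ge0 ?(ltW p0) ?(ltW E0)//.
rewrite (_ : 8 * s ^+ 2 = 4 * s ^+ 2 * 2 * 1); last by ring.
apply: ler_pM => //; first by rewrite !mulr_ge0 ?(ltW s20)// ltW.
  by rewrite mulr_ge0// ltW.
by rewrite ler_wpM2l// mulr_ge0// ltW.
Qed.

End Gauss.

Section Adapted.
Context (R : realType) (d : measure_display) (T : measurableType d).
Variable (G : set (set T)).
Hypothesis sG : sigma_algebra [set: T] G.

(** Measurability for one element of a filtration, which is given as a set of events; [FmeasP]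
    turns it into measurability on the type of that sigma-algebra. *)
Definition Fmeas (Y : T -> R) := forall D : set (measurableTypeR R), measurable D -> G (Y @^-1` D).

Lemma FmeasP Y : Fmeas Y <-> measurable_fun [set: g_sigma_algebraType G] (Y : g_sigma_algebraType G -> measurableTypeR R).
Proof.
have E : @measurable _ (g_sigma_algebraType G) = G by exact: sigma_algebra_id.
split=> h.
  by move=> _ D mD; rewrite setTI E; exact: h.
by move=> D mD; have := h measurableT D mD; rewrite setTI E.
Qed.

Lemma FmeasD Y Z : Fmeas Y -> Fmeas Z -> Fmeas (fun w => Y w + Z w).
Proof. by move=> /FmeasP mY /FmeasP mZ; apply/FmeasP; exact: measurable_funD. Qed.

Lemma FmeasB Y Z : Fmeas Y -> Fmeas Z -> Fmeas (fun w => Y w - Z w).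
Proof. by move=> /FmeasP mY /FmeasP mZ; apply/FmeasP; exact: measurable_funB. Qed.

Lemma Fmeas_cst c : Fmeas (fun=> c).
Proof. by apply/FmeasP; exact: measurable_cst. Qed.

Lemma FmeasZ c Y : Fmeas Y -> Fmeas (fun w => c * Y w).
Proof. by move=> /FmeasP mY; apply/FmeasP; exact: measurable_funM. Qed.

Lemma Fmeas_max Y Z : Fmeas Y -> Fmeas Z -> Fmeas (fun w => Num.max (Y w) (Z w)).
Proof. by move=> /FmeasP mY /FmeasP mZ; apply/FmeasP; exact: measurable_maxr. Qed.

End Adapted.

Section RunningMax.
Context (R : realType) (T : Type).
Implicit Types (S : nat -> T -> R) (X : R -> T -> R).

(** The integral against [X] of the step function with value [c i] on the [i]-th interval. *)
Definition gsum (c : nat -> R) X (tn : nat -> R) (n : nat) (w : T) : R :=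
  \sum_(i < n) c i * (X (tn i.+1) w - X (tn i) w).

Lemma gsumS c X tn n :
  gsum c X tn n.+1 = (fun w => gsum c X tn n w + c n * (X (tn n.+1) w - X (tn n) w)).
Proof. by apply/funext => w; rewrite /gsum big_ord_recr. Qed.

Fixpoint rmax S (n : nat) (w : T) : R :=
  if n is m.+1 then Num.max (rmax S m w) (S n w) else S 0%N w.

Lemma rmax_ge S k n w : (k <= n)%N -> S k w <= rmax S n w.
Proof.
elim: n => [|n ih]; first by rewrite leqn0 => /eqP ->.
by rewrite leq_eqVlt => /predU1P[->|]; rewrite /= le_max ?lexx ?orbT// ltnS => /ih ->.
Qed.

End RunningMax.

Section Domination.
Context (R : realType) (d : measure_display) (T : measurableType d) (mu : {measure set T -> \bar R}).
Implicit Types f g : T -> R.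

Lemma sqi_dom f g : sqi mu g -> measurable_fun [set: T] f -> (forall w, `|f w| <= `|g w|) -> sqi mu f.
Proof.
move=> sg mf fg; apply/sqi_intP => //; apply: (@le_lt_trans _ _ (\int[mu]_w (g w ^+ 2)%:E)%E); last by rewrite ip_intE// ltry.
apply: ge0_le_integral => //.
- by move=> w _; rewrite lee_fin sqr_ge0.
- by apply/measurable_EFinP; exact: measurable_funX.
- by apply/measurable_EFinP; apply: measurable_funX; exact: sg.1.
- by move=> w _; rewrite lee_fin -real_normK ?num_real// -[leRHS]real_normK ?num_real// lerXn2r ?nnegrE.
Qed.

Lemma nrm_dom f g : sqi mu g -> measurable_fun [set: T] f -> (forall w, `|f w| <= `|g w|) ->
  nrm mu f <= nrm mu g.
Proof.
move=> sg mf fg; have sf := sqi_dom sg mf fg.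
rewrite -ler_sqr ?nnegrE ?nrm_ge0// !nrm2 /ip; apply: le_Rintegral => //; try exact: sqiM.
by move=> w _; rewrite -!expr2 -real_normK ?num_real// -[leRHS]real_normK ?num_real// lerXn2r ?nnegrE.
Qed.

End Domination.

Section Increments.
Context (R : realType) (d : measure_display) (T : measurableType d) (P : probability T R).
Variables (F : R -> set (set T)) (X : R -> T -> R).
Hypothesis hF : filtration F.
Implicit Types Y : T -> R.
Hypothesis hX : brownian P F X.

Let sF t : 0 <= t -> sigma_algebra [set: T] (F t). Proof. by case: hF => h _ _ /h. Qed.

Let Fm t : 0 <= t -> F t `<=` measurable. Proof. by case: hF => _ h _ /h. Qed.

Let mF s t : 0 <= s -> s <= t -> F s `<=` F t. Proof. by case: hF => _ _; exact. Qed.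

Let aX t : 0 <= t -> Fmeas (F t) (X t). Proof. by case: hX => h _ _ _ _ t0 D mD; exact: h. Qed.

Lemma Fmeas_mfun t Y : 0 <= t -> Fmeas (F t) Y -> measurable_fun [set: T] Y.
Proof. by move=> t0 h _ D mD; rewrite setTI; apply: (Fm t0); exact: h. Qed.

Lemma Fmeas_mono s t Y : 0 <= s -> s <= t -> Fmeas (F s) Y -> Fmeas (F t) Y.
Proof. by move=> s0 st h D mD; apply: (mF s0 st); exact: h. Qed.

Let mX t : 0 <= t -> measurable_fun [set: T] (X t).
Proof. by move=> t0; apply: (Fmeas_mfun t0); exact: aX. Qed.

Let mI s t : 0 <= s -> s <= t -> measurable_fun [set: T] (increment X s t).
Proof. by move=> s0 st; apply: measurable_funB; apply: mX => //; exact: le_trans st. Qed.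

Lemma incr_law s t (f : R -> R) : 0 <= s -> s < t -> measurable_fun [set: R] f ->
  (forall x, 0 <= f x) ->
  (\int[P]_w (f (increment X s t w))%:E = \int[normal_prob 0 (Num.sqrt (t - s))]_x (f x)%:E)%E.
Proof.
move=> s0 st mf f0; have m := mI s0 (ltW st).
transitivity (\int[pushforward P (increment X s t : T -> measurableTypeR R)]_x (f x)%:E)%E.
  have m' : measurable_fun [set: T] (increment X s t : T -> measurableTypeR R) by exact: m.
  rewrite (ge0_integral_pushforward m')//; last by move=> x _; rewrite lee_fin.
  by apply/measurable_EFinP.
by apply: eq_measure_integral => D mD _; case: hX => _ _ _ h _; exact: h.
Qed.

Lemma incr_sq s t : 0 <= s -> s <= t ->
  sqi P (increment X s t) /\ nrm P (increment X s t) ^+ 2 <= 8 * (t - s).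
Proof.
move=> s0; rewrite le_eqVlt => /predU1P[<-|st].
  have -> : increment X s s = fun=> 0 by apply/funext => w; rewrite /increment subrr.
  by split; [exact: sqi0|rewrite nrm0 subrr mulr0 expr0n].
have ts0 : 0 < t - s by rewrite subr_gt0.
have h : (\int[P]_w (increment X s t w ^+ 2)%:E <= (8 * (t - s))%:E)%E.
  rewrite (incr_law (f := fun x => x ^+ 2) s0 st); [|exact: measurable_funX|by move=> x; exact: sqr_ge0].
  have := @normal_m2 R (Num.sqrt (t - s)); rewrite sqr_sqrtr ?(ltW ts0)//; apply.
  by rewrite sqrtr_gt0.
have sI : sqi P (increment X s t).
  apply/sqi_intP; first exact: mI s0 (ltW st).
  exact: le_lt_trans h (ltry _).
by split => //; rewrite nrm2 -lee_fin -ip_intE.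
Qed.

(** Orthogonality of increments to the past, from independence and the symmetry of the Gaussian:
    [(Y, dX)] and [(Y, - dX)] have the same law, the product of the law of [Y] and the normal law. *)
Lemma incr_orth s t Y : 0 <= s -> s <= t -> Fmeas (F s) Y -> sqi P Y ->
  ip P Y (increment X s t) = 0.
Proof.
move=> s0; rewrite le_eqVlt => /predU1P[<- _ _|st aY sY].
  have -> : increment X s s = fun=> 0 by apply/funext => w; rewrite /increment subrr.
  by rewrite ipC ip0l.
have [sI _] := incr_sq s0 (ltW st).
have mY := Fmeas_mfun s0 aY; have m := mI s0 (ltW st).
(* [Y] as a random variable, in order to speak of its distribution *)
pose Yf : {mfun T >-> measurableTypeR R} := HB.pack Y
  (isMeasurableFun.Build _ _ T (measurableTypeR R) Y (mY : measurable_fun [set: T] (Y : T -> measurableTypeR R))).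
pose N : probability _ R := normal_prob 0 (Num.sqrt (t - s)).
have r0 : Num.sqrt (t - s) != 0 by rewrite gt_eqF// sqrtr_gt0 subr_gt0.
pose Z1 w : measurableTypeR R * measurableTypeR R := (Y w, increment X s t w).
pose Z2 w : measurableTypeR R * measurableTypeR R := (Y w, - increment X s t w).
have mZ1 : measurable_fun [set: T] Z1 by exact: measurable_fun_pair.
have mZ2 : measurable_fun [set: T] Z2.
  by apply: measurable_fun_pair => //; exact: measurable_funN.
have ind D : measurable D -> forall A, measurable A ->
   P ((Y @^-1` A) `&` (increment X s t @^-1` D)) = (distribution P Yf A * N D)%E.
  move=> mD A mA; case: hX => _ _ _ hl hi.
  by rewrite hi ?hl//; exact: aY.
pose m1 := pushforward P Z1; pose m2 := pushforward P Z2.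
have h1 B : measurable B -> m1 B = (distribution P Yf \x N)%E B.
  move=> mB; apply/esym/product_measure_unique => // A D mA mD.
  by rewrite -ind.
have h2 B : measurable B -> m2 B = (distribution P Yf \x N)%E B.
  move=> mB; apply/esym/product_measure_unique => // A D mA mD.
  have e : N ((-%R : R -> R) @^-1` D) = N D by exact: normal_sym.
  apply: etrans (congr1 (fun z => distribution P Yf A * z)%E e).
  apply: ind => //; rewrite -[_ @^-1` _]setTI; exact: oppr_measurable.
have i1 := sqiM sY sI.
have i2 : P.-integrable setT (EFin \o (fun w => Y w * - increment X s t w)).
  exact: sqiM sY (sqiN sI).
pose f (z : measurableTypeR R * measurableTypeR R) : \bar R := (z.1 * z.2)%:E.
have mf : measurable_fun setT f.
  by apply/measurable_EFinP; exact: measurable_funM.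
have e : (\int[P]_w (Y w * increment X s t w)%:E = \int[P]_w (Y w * - increment X s t w)%:E)%E.
  transitivity (\int[m1]_z f z)%E; first by rewrite integral_pushforward.
  transitivity (\int[m2]_z f z)%E; last by rewrite integral_pushforward.
  by apply: eq_measure_integral => B mB _; exact: etrans (h1 B mB) (esym (h2 B mB)).
have {e} : ip P Y (increment X s t) = - ip P Y (increment X s t).
  rewrite -[in RHS](ipNl sY sI) /ip /Rintegral e; congr fine.
  by apply: eq_integral => w _; congr EFin; ring.
by lra.
Qed.

Lemma incr_step s t Y (c : R) : 0 <= s -> s <= t -> Fmeas (F s) Y -> sqi P Y ->
  sqi P (fun w => Y w + c * increment X s t w) /\
  nrm P (fun w => Y w + c * increment X s t w) ^+ 2 <= nrm P Y ^+ 2 + 8 * (c ^+ 2 * (t - s)).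
Proof.
move=> s0 st aY sY; have [sI nI] := incr_sq s0 st.
have sc := sqiZ c sI; split; first exact: sqiD.
rewrite !nrm2 ipDl//; last exact: sqiD.
rewrite !ipDr// ipZr// (ipC P _ Y) !ipZr// ipZl// (incr_orth s0 st aY sY) -nrm2.
rewrite -(nrm2 P (increment X s t)).
have := ler_wpM2l (sqr_ge0 c) nI; lra.
Qed.

Variable (tn : nat -> R).
Hypothesis tn0 : forall i, 0 <= tn i.
Hypothesis tnS : forall i, tn i <= tn i.+1.

Lemma gsum_adapted c n : Fmeas (F (tn n)) (gsum c X tn n).
Proof.
have aI i : Fmeas (F (tn i.+1)) (fun w => X (tn i.+1) w - X (tn i) w).
  by apply: FmeasB; [exact: sF|exact: aX|apply: (Fmeas_mono (tn0 i) (tnS i)); exact: aX].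
elim: n => [|n ih].
  rewrite (_ : gsum _ _ _ _ = fun=> 0); first exact: Fmeas_cst (sF (tn0 0)) 0.
  by apply/funext => w; rewrite /gsum big_ord0.
rewrite gsumS; apply: FmeasD; first exact: sF.
  exact: (Fmeas_mono (tn0 n) (tnS n)).
by apply: FmeasZ; [exact: sF|exact: aI].
Qed.

Lemma gsum_sq c n : sqi P (gsum c X tn n) /\
  nrm P (gsum c X tn n) ^+ 2 <= 8 * \sum_(i < n) c i ^+ 2 * (tn i.+1 - tn i).
Proof.
elim: n => [|n [ihs ih]].
  rewrite (_ : gsum _ _ _ _ = fun=> 0).
    by split; [exact: sqi0|rewrite nrm0 big_ord0 mulr0 expr0n].
  by apply/funext => w; rewrite /gsum big_ord0.
rewrite gsumS; have [h1 h2] := incr_step (c n) (tn0 n) (tnS n) (gsum_adapted c n) ihs.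
split => //; apply: le_trans h2 _; rewrite big_ord_recr/= [leRHS]mulrDr lerD2r; exact: ih.
Qed.

(** Doob's inequality for the running maximum [M] of [S]: the distance [M - S] only grows by
    the new increment, since [|M' - S'| <= |M - S'|]. *)
Lemma rmax_sq c n : Fmeas (F (tn n)) (rmax (gsum c X tn) n) /\
  (sqi P (fun w => rmax (gsum c X tn) n w - gsum c X tn n w) /\
  nrm P (fun w => rmax (gsum c X tn) n w - gsum c X tn n w) ^+ 2 <=
    8 * \sum_(i < n) c i ^+ 2 * (tn i.+1 - tn i)).
Proof.
elim: n => [|n [iha [ihs ih]]].
  split; first exact: gsum_adapted.
  rewrite (_ : (fun w => _) = fun=> 0).
    by split; [exact: sqi0|rewrite nrm0 big_ord0 mulr0 expr0n].
  by apply/funext => w /=; rewrite subrr.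
have a' : Fmeas (F (tn n.+1)) (rmax (gsum c X tn) n.+1).
  apply: (Fmeas_max (sF (tn0 n.+1))); last exact: gsum_adapted.
  exact: (Fmeas_mono (tn0 n) (tnS n)).
have aB : Fmeas (F (tn n)) (fun w => rmax (gsum c X tn) n w - gsum c X tn n w).
  by apply: FmeasB; [exact: sF|exact: iha|exact: gsum_adapted].
have [h1 h2] := incr_step (- c n) (tn0 n) (tnS n) aB ihs.
have dom w : `|rmax (gsum c X tn) n.+1 w - gsum c X tn n.+1 w| <=
   `|rmax (gsum c X tn) n w - gsum c X tn n w + - c n * increment X (tn n) (tn n.+1) w|.
  rewrite gsumS /= gsumS /=; set M := rmax _ _ w; set S := gsum _ _ _ _ w; set D := c n * _.
  rewrite (_ : M - S + _ = M - (S + D)); last by rewrite /D /increment; ring.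
  by case: (leP M (S + D)) => [_|//]; rewrite subrr normr0.
split=> //; split.
  apply: (sqi_dom h1 _ dom); apply: measurable_funB; first exact: (Fmeas_mfun (tn0 n.+1)).
  by apply: (Fmeas_mfun (tn0 n.+1)); exact: gsum_adapted.
apply: (@le_trans _ _ (nrm P (fun w => rmax (gsum c X tn) n w - gsum c X tn n w + - c n * increment X (tn n) (tn n.+1) w) ^+ 2)).
  rewrite lerXn2r ?nnegrE ?nrm_ge0//; apply: (nrm_dom h1 _ dom).
  apply: measurable_funB; first exact: (Fmeas_mfun (tn0 n.+1)).
  by apply: (Fmeas_mfun (tn0 n.+1)); exact: gsum_adapted.
by apply: le_trans h2 _; rewrite sqrrN big_ord_recr/= [leRHS]mulrDr lerD2r.
Qed.

(** [|rmax S| <= |rmax S - S| + |S|], and both terms are controlled by the sum of squares. *)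
Lemma doob c n : sqi P (rmax (gsum c X tn) n) /\
  nrm P (rmax (gsum c X tn) n) ^+ 2 <= 32 * \sum_(i < n) c i ^+ 2 * (tn i.+1 - tn i).
Proof.
have [sS nS] := gsum_sq c n; have [_ [sD nD]] := rmax_sq c n.
have E : rmax (gsum c X tn) n = (fun w => gsum c X tn n w + (rmax (gsum c X tn) n w - gsum c X tn n w)).
  by apply/funext => w; ring.
have h := ler_nrmD sS sD; rewrite -E in h.
split; first by rewrite E; exact: sqiD.
move: nS nD h; set K := \sum_(i < n) _; set a := nrm P _; set b := nrm P _; set e := nrm P _.
move=> h1 h2 h3; have a0 : 0 <= a by exact: nrm_ge0.
have b0 : 0 <= b by exact: nrm_ge0.
have e0 : 0 <= e by exact: nrm_ge0.
have : e ^+ 2 <= (a + b) ^+ 2 by rewrite lerXn2r ?nnegrE ?addr_ge0.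
have := sqr_ge0 (a - b); nra.
Qed.

End Increments.

(** * Riemann sums against a continuous path *)

Section EinfReal.
Context (R : realType).
Implicit Types u v : nat -> \bar R.

Lemma le_limn_einf u v : (forall n, (u n <= v n)%E) -> (limn_einf u <= limn_einf v)%E.
Proof.
move=> uv; rewrite !limn_einf_lim; apply: lee_lim; [exact: is_cvg_einfs|exact: is_cvg_einfs|].
apply: nearW => n; apply: le_ereal_inf_tmp => _ [m nm <-].
by apply: le_trans (uv m); apply: ereal_inf_lbound; exists m.
Qed.

Lemma limn_einf_le u (c : \bar R) : (forall n, (u n <= c)%E) -> (limn_einf u <= c)%E.
Proof.
move=> uc; apply: le_trans (le_limn_einf uc) _.
by have [-> _] := @cvg_limn_einf_sup R (fun=> c) c (@cvg_cst _ _ _ _ _).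
Qed.

Lemma limn_einf_real (a : nat -> R) u (l : R) : a @ \oo --> l ->
  (forall n, ((a n)%:E <= u n)%E) -> (l%:E <= limn_einf u)%E.
Proof.
move=> al au; apply: le_trans (le_limn_einf au).
have : (EFin \o a) @ \oo --> l%:E by apply: cvg_comp al _.
by move=> /cvg_limn_einf_sup[-> _].
Qed.

End EinfReal.

Section Fatou.
Context (R : realType) (d : measure_display) (T : measurableType d) (mu : {measure set T -> \bar R}).

Lemma measurable_limn_einf (f : nat -> T -> \bar R) : (forall n, measurable_fun [set: T] (f n)) ->
  measurable_fun [set: T] (fun w => limn_einf (f ^~ w)).
Proof.
move=> mf; rewrite (_ : (fun w => _) = fun w => (- limn_esup (fun n => - f n w))%E); last first.
  apply/funext => w; rewrite -limn_einfN; congr limn_einf.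
  by apply/funext => n /=; rewrite oppeK.
apply: measurableT_comp => //; apply: measurable_fun_limn_esup => n.
exact: measurableT_comp.
Qed.

Lemma fatou_nrm (f : nat -> T -> R) (g : T -> R) (K : R) : (forall m, sqi mu (f m)) ->
  (forall m, nrm mu (f m) ^+ 2 <= K) -> (forall w, (f ^~ w) @ \oo --> g w) ->
  sqi mu g /\ nrm mu g ^+ 2 <= K.
Proof.
move=> sf fK fg.
have mg : measurable_fun [set: T] g.
  by apply: (measurable_fun_cvg (fun m => (sf m).1)) => w _; exact: fg.
have h : (\int[mu]_w (g w ^+ 2)%:E <= K%:E)%E.
  apply: (@le_trans _ _ (\int[mu]_w limn_einf (fun m => (f m w ^+ 2)%:E))%E).
    apply: ge0_le_integral => //.
    - by move=> w _; rewrite lee_fin sqr_ge0.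
    - by apply/measurable_EFinP; exact: measurable_funX.
    - apply: measurable_limn_einf => m; apply/measurable_EFinP; apply: measurable_funX.
      by case: (sf m).
    - by move=> w _; apply: (@limn_einf_real _ (fun m => f m w ^+ 2)); first exact: cvg_sqr (fg w).
  apply: le_trans (fatou mu measurableT _ _) _.
  - by move=> m; apply/measurable_EFinP; apply: measurable_funX; case: (sf m).
  - by move=> m w _; rewrite lee_fin sqr_ge0.
  by apply: limn_einf_le => m; rewrite ip_intE// -nrm2 lee_fin.
have sg : sqi mu g by apply: sqi_intP => //; exact: le_lt_trans h (ltry _).
by split => //; rewrite nrm2 -lee_fin -ip_intE.
Qed.

End Fatou.

Section UniformContinuity.
Context (R : realType).

Lemma heine (x : R -> R) (T C e : R) : continuous x -> 0 <= C -> 0 < e ->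
  exists N : nat, forall m s r, (N <= m)%N -> 0 <= s <= T -> `|r - s| <= C / m.+1%:R -> `|x r - x s| <= e.
Proof.
move=> cx C0 e0.
have cK : compact (`[0, T] : set R) by exact: segment_compact.
have := (compact_near_coveringP _).1 cK nat \oo
  (fun m s => forall r, `|r - s| <= C / m.+1%:R -> `|x r - x s| <= e) _.
case.
  move=> t _; have e2 : 0 < e / 2 by rewrite divr_gt0.
  have := cx t; move/cvgrPdist_le => /(_ _ e2) /nbhs_ballP[dl /= dl0 hb].
  have d2 : 0 < dl / 2 by rewrite divr_gt0.
  have : (fun m : nat => C * m.+1%:R^-1) @ \oo --> C * 0.
    apply: cvgM; first exact: cvg_cst.
    exact: cvg_harmonic.
  rewrite mulr0; move/cvgrPdist_lt => /(_ _ d2) hm.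
  exists (ball t (dl / 2), [set m : nat | `|0 - C * m.+1%:R^-1| < dl / 2]) => /=.
    by split=> //; exact: nbhsx_ballx.
  move=> [s m] /= [ts]; rewrite sub0r normrN => Cm r rs.
  have Cm' : C / m.+1%:R < dl / 2 by apply: le_lt_trans (ler_norm _) Cm.
  have hs : `|x t - x s| <= e / 2.
    by apply: hb; apply: le_ball ts; lra.
  have hr : `|x t - x r| <= e / 2.
    apply: hb; rewrite /ball/= in ts *; rewrite /ball_ in ts *.
    rewrite (_ : t - r = (t - s) - (r - s)); last by ring.
    apply: le_lt_trans (ler_normB _ _) _; rewrite (splitr dl).
    by apply: ltrD => //; exact: le_lt_trans Cm'.
  rewrite (_ : x r - x s = (x t - x s) - (x t - x r)); last by ring.
  apply: le_trans (ler_normB _ _) _; lra.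
move=> N _ HN; exists N => m s r Nm sT rs; exact: (HN m Nm s).
Qed.

Lemma pint_lip (g : R -> R) (a b K : R) : continuous g -> 0 <= a -> a <= b ->
  (forall s, a <= s <= b -> `|g s| <= K) -> `|pint g b - pint g a| <= K * (b - a).
Proof.
move=> cg a0; rewrite le_eqVlt => /predU1P[<- _|ab gK]; first by rewrite !subrr normr0 mulr0.
have dg (s : R) : s \in `]a, b[ -> is_derive s (1 : R) (pint g) (g s).
  rewrite in_itv/= => /andP[as' _]; apply: pint_derive => //; exact: le_lt_trans as'.
have [c] := MVT ab dg (continuous_subspaceT (pint_cts cg)).
rewrite in_itv/= => /andP[ac cb] ->; rewrite normrM (gtr0_norm (x := b - a)) ?subr_gt0//.
by rewrite ler_wpM2r ?subr_ge0 ?(ltW ab)// gK// !ltW.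
Qed.

End UniformContinuity.

Section PathIntegral.
Context (R : realType) (T : Type).
Implicit Types (X : R -> T -> R) (w : T).

(** The integral of a smooth [h], with derivative [dh], against a continuous path,
    through integration by parts. *)
Definition pathint (h dh : R -> R) X (t : R) (w : T) : R :=
  h t * X t w - pint (fun s => dh s * X s w) t.

(** On each interval the difference is the integral of [dh] against the oscillation of the path. *)
Lemma gsum_path (h dh : R -> R) X w (tn : nat -> R) n (H om : R) :
  continuous (X ^~ w) -> X 0 w = 0 -> continuous dh -> (forall s : R, is_derive s (1 : R) h (dh s)) ->
  tn 0%N = 0 -> (forall i, 0 <= tn i) -> (forall i, tn i <= tn i.+1) ->
  (forall s, 0 <= s <= tn n -> `|dh s| <= H) -> 0 <= H ->
  (forall i s, (i < n)%N -> tn i <= s <= tn i.+1 -> `|X (tn i.+1) w - X s w| <= om) ->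
  `|gsum (h \o tn) X tn n w - pathint h dh X (tn n) w| <= H * om * tn n.
Proof.
move=> cX X0 cd dh' t0 tn0 tnS.
have ch : continuous h.
  by move=> s; apply: differentiable_continuous; apply/derivable1_diffP; have [] := dh' s.
elim: n => [|n ih] hH H0 hom.
  by rewrite /gsum big_ord0 /pathint t0 X0 mulr0 pint_le0// !subrr normr0 mulr0.
have {}ih : `|gsum (h \o tn) X tn n w - pathint h dh X (tn n) w| <= H * om * tn n.
  apply: ih => // [s /andP[s0 sn]|i s i_n].
    by apply: hH; rewrite s0 (le_trans sn).
  by apply: hom; exact: ltnW.
rewrite gsumS /=; set a := tn n; set b := tn n.+1.
pose g s := dh s * (X b w - X s w).
have cdX : continuous (fun s => dh s * X s w) by move=> s; apply: cvgM; [exact: cd|exact: cX].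
have cg : continuous g.
  by move=> s; apply: cvgM; [exact: cd|apply: cvgB; [exact: cvg_cst|exact: cX]].
have pg t : 0 <= t -> pint g t = X b w * (h t - h 0) - pint (fun s => dh s * X s w) t.
  move=> tt; rewrite -(pint_FTC2 tt cd dh') -pintZ// -pintB//.
    by apply: pint_eq => s _; rewrite /g; ring.
  by move=> s; apply: cvgM; [exact: cvg_cst|exact: cd].
have hg : `|pint g b - pint g a| <= H * om * (b - a).
  apply: pint_lip => //; [exact: tn0|exact: tnS|] => s /andP[as' sb].
  rewrite normrM; apply: ler_pM => //.
    by apply: hH; rewrite sb (le_trans (tn0 n)).
  by apply: hom => //; rewrite as' sb.
have E : gsum (h \o tn) X tn n w + h a * (X b w - X a w) - pathint h dh X b w =
   (gsum (h \o tn) X tn n w - pathint h dh X a w) - (pint g b - pint g a).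
  by rewrite !pg ?tn0// /pathint; ring.
rewrite E; apply: le_trans (ler_normB _ _) _.
rewrite (_ : H * om * b = H * om * a + H * om * (b - a)); last by ring.
exact: lerD.
Qed.

Definition grid (t : R) (m k : nat) : R := t * k%:R / m.+1%:R.

Lemma grid_ge0 t m k : 0 <= t -> 0 <= grid t m k.
Proof. by move=> t0; rewrite /grid divr_ge0// mulr_ge0. Qed.

Lemma grid0 t m : grid t m 0 = 0. Proof. by rewrite /grid mulr0 mul0r. Qed.

Lemma gridS t m k : grid t m k.+1 - grid t m k = t / m.+1%:R.
Proof. by rewrite /grid -natr1; ring. Qed.

Lemma grid_mono t m k : 0 <= t -> grid t m k <= grid t m k.+1.
Proof. by move=> t0; rewrite -subr_ge0 gridS divr_ge0. Qed.

Lemma grid_end t m : grid t m m.+1 = t.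
Proof. by rewrite /grid mulfK// pnatr_eq0. Qed.

(** Index of the last grid point not beyond [t]. *)
Definition gidx (T0 : R) (m : nat) (t : R) : nat := Num.truncn (t * m.+1%:R / T0).

Lemma gidxP T0 m t : 0 < T0 -> 0 <= t <= T0 ->
  [/\ (gidx T0 m t <= m.+1)%N, grid T0 m (gidx T0 m t) <= t & t - grid T0 m (gidx T0 m t) <= T0 / m.+1%:R].
Proof.
move=> T0p /andP[t0 tT].
have m0 : 0 < m.+1%:R :> R by rewrite ltr0n.
have x0 : 0 <= t * m.+1%:R / T0 by rewrite divr_ge0 ?mulr_ge0// ltW.
have [h1 h2] := andP (truncn_itv x0); rewrite -/(gidx T0 m t) in h1 h2; set k := gidx T0 m t in h1 h2 *.
have h1' : grid T0 m k <= t by rewrite /grid ler_pdivrMr// mulrC -ler_pdivlMr.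
have h2' : t <= grid T0 m k.+1 by rewrite /grid ler_pdivlMr// [T0 * _]mulrC -ler_pdivrMr// ltW.
split => //; last by rewrite -(gridS T0 m k) lerD2r.
rewrite -(ler_nat R); apply: le_trans h1 _.
by rewrite ler_pdivrMr// mulrC ler_wpM2l.
Qed.

Lemma pathint_cts h dh X w : continuous (X ^~ w) -> continuous dh ->
  (forall s : R, is_derive s (1 : R) h (dh s)) -> continuous (fun t => pathint h dh X t w).
Proof.
move=> cX cd dh'.
have ch : continuous h.
  by move=> s; apply: differentiable_continuous; apply/derivable1_diffP; have [] := dh' s.
move=> t; apply: cvgB; first by apply: cvgM; [exact: ch|exact: cX].
by apply: pint_cts => s; apply: cvgM; [exact: cd|exact: cX].
Qed.

Lemma gsum_cvg (h dh : R -> R) X w (T0 t : R) :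
  continuous (X ^~ w) -> X 0 w = 0 -> continuous dh -> (forall s : R, is_derive s (1 : R) h (dh s)) ->
  0 < T0 -> 0 <= t <= T0 ->
  (fun m => gsum (h \o grid T0 m) X (grid T0 m) (gidx T0 m t) w) @ \oo --> pathint h dh X t w.
Proof.
move=> cX X0 cd dh' T0p tT; apply/cvgrPdist_le => e e0.
have T00 := ltW T0p.
have cdn : continuous (fun s => `|dh s|) by move=> s; apply: cvg_norm; exact: cd.
have [c _ hc] := EVT_max T00 (continuous_subspaceT cdn).
set H := `|dh c| in hc; have H0 : 0 <= H by exact: normr_ge0.
have e1 : 0 < e / (2 * (H * T0 + 1)).
  by rewrite divr_gt0// mulr_gt0// ltr_wpDl// mulr_ge0.
have e2 : 0 < e / 2 by rewrite divr_gt0.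
have [N1 HN1] := heine T0 cX T00 e1.
have [N2 HN2] := heine T0 (pathint_cts cX cd dh') T00 e2.
exists (maxn N1 N2) => // m /=; rewrite geq_max => /andP[Nm1 Nm2].
have [k1 k2 k3] := gidxP m T0p tT; set k := gidx T0 m t in k1 k2 k3 *.
have t0 : 0 <= t by case/andP: tT.
have gk0 i : 0 <= grid T0 m i by exact: grid_ge0.
have gT : grid T0 m k <= T0 by apply: le_trans k2 _; case/andP: tT.
have h1 : `|gsum (h \o grid T0 m) X (grid T0 m) k w - pathint h dh X (grid T0 m k) w| <=
    H * (e / (2 * (H * T0 + 1))) * grid T0 m k.
  apply: gsum_path => //.
  - exact: grid0.
  - by move=> i; exact: grid_mono.
  - move=> s /andP[s0 sk]; have := hc s; rewrite in_itv/= s0 (le_trans sk)//; exact.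
  - move=> i s ik /andP[is1 is2].
    have sT : 0 <= s <= T0.
      rewrite (le_trans (gk0 i))//= (le_trans is2)// (le_trans _ gT)//.
      by rewrite /grid ler_pdivrMr ?ltr0n// divfK ?pnatr_eq0// ler_wpM2l// ler_nat.
    apply: HN1 Nm1 sT _; rewrite ger0_norm ?subr_ge0// -(gridS T0 m i) lerD2l lerN2//.
have h2 : `|pathint h dh X t w - pathint h dh X (grid T0 m k) w| <= e / 2.
  by rewrite distrC; apply: HN2 Nm2 tT _; rewrite distrC ger0_norm ?subr_ge0.
rewrite (_ : _ - _ = (pathint h dh X t w - pathint h dh X (grid T0 m k) w) -
  (gsum (h \o grid T0 m) X (grid T0 m) k w - pathint h dh X (grid T0 m k) w)); last by ring.
apply: le_trans (ler_normB _ _) _.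
have h3 : H * (e / (2 * (H * T0 + 1))) * grid T0 m k <= e / 2.
  apply: (@le_trans _ _ (H * (e / (2 * (H * T0 + 1))) * T0)).
    by rewrite ler_wpM2l// mulr_ge0// ltW.
  rewrite (_ : _ * T0 = e / 2 * (H * T0 / (H * T0 + 1))); last by field; rewrite gt_eqF// ltr_wpDl// mulr_ge0.
  rewrite ler_piMr ?(ltW e2)// ler_pdivrMr ?ltr_wpDl ?mulr_ge0//; lra.
lra.
Qed.

(** Abel summation: the increasing weights [exp (n ^ 2 s)] of the semigroup are removed, at the
    cost of a factor 2, from sums whose partial sums are controlled by the maximal inequality. *)
Lemma gsum_abel (a c : nat -> R) X (tn : nat -> R) n w (Q : R) :
  0 <= a 0%N -> (forall i, a i <= a i.+1) ->
  (forall k, (k <= n)%N -> `|gsum c X tn k w| <= Q) ->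
  `|gsum (fun i => a i * c i) X tn n w| <= 2 * (a n * Q).
Proof.
move=> a0 aS cQ.
have am k : a 0%N <= a k by elim: k => // k ih; exact: le_trans ih (aS k).
have key : `|gsum (fun i => a i * c i) X tn n w - a n * gsum c X tn n w| <= (a n - a 0%N) * Q.
  elim: n cQ => [|n ih] cQ.
    by rewrite /gsum !big_ord0 mulr0 !subrr mul0r normr0.
  have {}ih := ih (fun k kn => cQ k (leqW kn)).
  have Cn := cQ n.+1 (leqnn _).
  rewrite (_ : _ - _ = (gsum (fun i => a i * c i) X tn n w - a n * gsum c X tn n w) +
     (a n - a n.+1) * gsum c X tn n.+1 w); last by rewrite !gsumS; ring.
  apply: le_trans (ler_normD _ _) _.
  rewrite (_ : (a n.+1 - a 0%N) * Q = (a n - a 0%N) * Q + (a n.+1 - a n) * Q); last by ring.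
  apply: lerD => //; rewrite normrM ler0_norm ?subr_le0// opprB ler_wpM2l ?subr_ge0//.
have Q0 : 0 <= Q by exact: le_trans (normr_ge0 _) (cQ 0%N (leq0n _)).
have Cn := cQ n (leqnn _); have an0 : 0 <= a n := le_trans a0 (am n).
have h : `|a n * gsum c X tn n w| <= a n * Q by rewrite normrM (ger0_norm an0) ler_wpM2l.
rewrite -[gsum (fun i => _) _ _ _ _](subrK (a n * gsum c X tn n w)).
apply: le_trans (ler_normD _ _) _; have := mulr_ge0 a0 Q0; lra.
Qed.

(** A step function on a coarse grid is one on any refinement; this puts Riemann sums on two grids
    on a common one. *)
Lemma gsum_refine (c : nat -> R) X (tn : nat -> R) n p w : (0 < p)%N ->
  gsum c X (fun k => tn (k * p)%N) n w = gsum (fun i => c (i %/ p)%N) X tn (n * p) w.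
Proof.
move=> p0; elim: n => [|n ih]; first by rewrite /gsum !big_ord0.
rewrite gsumS ih /gsum -!(big_mkord xpredT (fun i => c (i %/ p)%N * (X (tn i.+1) w - X (tn i) w))).
rewrite [RHS](big_cat_nat _ (n := (n * p)%N))//=; last by rewrite leq_mul2r leqnSn orbT.
congr (_ + _); rewrite big_nat.
rewrite (eq_bigr (fun i => c n * (X (tn i.+1) w - X (tn i) w))); last first.
  move=> i /andP[ni iS]; congr (c _ * _); apply/eqP.
  rewrite eqn_leq leq_divRL// ni andbT -ltnS ltn_divLR//.
rewrite -big_nat -mulr_sumr telescope_sumr//; by rewrite leq_mul2r leqnSn orbT.
Qed.

Lemma rmaxN_ge (S : nat -> T -> R) k n w : S 0%N w = 0 -> (k <= n)%N ->
  `|S k w| <= rmax S n w + rmax (fun i w => - S i w) n w.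
Proof.
move=> S0 kn; have h1 := rmax_ge S w kn; have h2 := rmax_ge (fun i w => - S i w) w kn.
have := rmax_ge S w (leq0n n); have := rmax_ge (fun i w => - S i w) w (leq0n n).
rewrite S0 oppr0 ler_norml => h3 h4; rewrite /= in h2; apply/andP; split; lra.
Qed.

Lemma gsumN (c : nat -> R) X tn n w : gsum (fun i => - c i) X tn n w = - gsum c X tn n w.
Proof. by rewrite /gsum -sumrN; apply: eq_bigr => i _; rewrite mulNr. Qed.

Lemma gsumB (c c' : nat -> R) X tn n w :
  gsum c X tn n w - gsum c' X tn n w = gsum (fun i => c i - c' i) X tn n w.
Proof. by rewrite /gsum -sumrB; apply: eq_bigr => i _; rewrite mulrBl. Qed.

End PathIntegral.

Section Riemann.
Context (R : realType).

Lemma riemann_cvg (f : R -> R) (t : R) : continuous f -> 0 <= t ->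
  (fun m => \sum_(i < m.+1) f (grid t m i) * (t / m.+1%:R)) @ \oo --> pint f t.
Proof.
move=> cf t0; apply/cvgrPdist_le => e e0.
have e1 : 0 < e / (t + 1) by rewrite divr_gt0// ltr_wpDl.
have [N HN] := heine t cf t0 e1; exists N => // m /= Nm.
have gk0 i : 0 <= grid t m i by exact: grid_ge0.
have key n : (n <= m.+1)%N ->
    `|pint f (grid t m n) - \sum_(i < n) f (grid t m i) * (t / m.+1%:R)| <= e / (t + 1) * grid t m n.
  elim: n => [|n ih] nm; first by rewrite grid0 pint_le0// big_ord0 subrr normr0 mulr0.
  have {}ih := ih (ltnW nm); rewrite big_ord_recr/=.
  set a := grid t m n in ih *; set b := grid t m n.+1.
  pose g s := f s - f a.
  have cg : continuous g by move=> s; apply: cvgB; [exact: cf|exact: cvg_cst].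
  have ab : a <= b by exact: grid_mono.
  have pg s : 0 <= s -> pint g s = pint f s - f a * s.
    move=> s0; rewrite pintB//; last by move=> ?; exact: cvg_cst.
    have dl (y : R) : is_derive y (1 : R) (fun s => f a * s) (f a).
      by apply: is_derive_eq; rewrite /GRing.scale/= mulr1.
    have cc : continuous (fun _ : R => f a) by move=> ?; exact: cvg_cst.
    by rewrite (pint_FTC2 s0 cc dl) mulr0 subr0.
  have hg : `|pint g b - pint g a| <= e / (t + 1) * (b - a).
    apply: pint_lip => //; first exact: gk0.
    move=> s /andP[as' sb]; apply: HN Nm _ _.
      rewrite gk0/=; apply: (@le_trans _ _ (grid t m m.+1)); last by rewrite grid_end.
      by rewrite /a /grid ler_wpM2r ?invr_ge0// ler_wpM2l// ler_nat ltnW.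
    by rewrite ger0_norm ?subr_ge0// -(gridS t m n) lerD2r.
  have E : pint f b - (\sum_(i < n) f (grid t m i) * (t / m.+1%:R) + f a * (t / m.+1%:R)) =
     (pint f a - \sum_(i < n) f (grid t m i) * (t / m.+1%:R)) + (pint g b - pint g a).
    by rewrite !pg ?gk0// -(gridS t m n) -/a -/b; ring.
  rewrite E; apply: le_trans (ler_normD _ _) _.
  rewrite (_ : _ * b = e / (t + 1) * a + e / (t + 1) * (b - a)); last by ring.
  exact: lerD.
have := key m.+1 (leqnn _); rewrite grid_end => /le_trans; apply.
by rewrite mulrAC ler_pdivrMr ?ltr_wpDl// ler_wpM2l ?(ltW e0)// lerDl.
Qed.

Context (d : measure_display) (T : measurableType d).

Lemma measurable_pint (f : R -> T -> R) (t : R) : (forall w, continuous (f ^~ w)) ->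
  (forall s, 0 <= s -> measurable_fun [set: T] (f s)) ->
  measurable_fun [set: T] (fun w => pint (f ^~ w) t).
Proof.
move=> cf mf; have [t0|t0] := leP t 0.
  by rewrite (_ : (fun w => _) = fun=> 0) //; apply/funext => w; rewrite pint_le0.
apply: (@measurable_fun_cvg _ _ _ _ (fun m w => \sum_(i < m.+1) f (grid t m i) w * (t / m.+1%:R))).
  move=> m; apply: measurable_sum => i; apply: measurable_funM => //.
  by apply: mf; apply: grid_ge0; exact: ltW.
by move=> w _; apply: riemann_cvg => //; exact: ltW.
Qed.

(** Fatou's lemma along Riemann sums plays the role of Tonelli's theorem for integrands that are
    measurable at each time. *)
Lemma pint_expectation (mu : {measure set T -> \bar R}) (f : R -> T -> R) (t K : R) :
  0 <= t -> (forall w, continuous (f ^~ w)) ->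
  (forall s, 0 <= s -> measurable_fun [set: T] (f s)) -> (forall s w, 0 <= f s w) -> 0 <= K ->
  (forall s, 0 <= s <= t -> (\int[mu]_w (f s w)%:E <= K%:E)%E) ->
  (\int[mu]_w (pint (f ^~ w) t)%:E <= (K * t)%:E)%E.
Proof.
move=> t0 cf mf f0 K0 fK.
pose S m w := \sum_(i < m.+1) f (grid t m i) w * (t / m.+1%:R).
have gt i m : (i < m.+1)%N -> 0 <= grid t m i <= t.
  move=> im; rewrite grid_ge0//= -{2}(grid_end t m).
  by rewrite /grid ler_wpM2r ?invr_ge0// ler_wpM2l// ler_nat ltnW.
have tm m : 0 <= t / m.+1%:R by rewrite divr_ge0.
have mS m : measurable_fun [set: T] (S m).
  apply: measurable_sum => i; apply: measurable_funM => //.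
  by apply: mf; apply: grid_ge0.
have S0 m w : 0 <= S m w by apply: sumr_ge0 => i _; rewrite mulr_ge0.
apply: (@le_trans _ _ (\int[mu]_w limn_einf (fun m => (S m w)%:E))%E).
  apply: ge0_le_integral => //.
  - by move=> w _; rewrite lee_fin; apply: pint_ge0 => s _.
  - by apply/measurable_EFinP; exact: measurable_pint.
  - by apply: measurable_limn_einf => m; apply/measurable_EFinP.
  - by move=> w _; apply: (limn_einf_real (riemann_cvg (cf w) t0)).
apply: le_trans (fatou mu measurableT _ _) _.
- by move=> m; apply/measurable_EFinP.
- by move=> m w _; rewrite lee_fin.
apply: limn_einf_le => m; rewrite /S; under eq_integral do rewrite -sumEFin.
rewrite ge0_integral_sum//; last 2 first.
- move=> i; apply/measurable_EFinP; apply: measurable_funM => //.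
  by apply: mf; apply: grid_ge0.
- by move=> i w _; rewrite lee_fin mulr_ge0.
apply: (@le_trans _ _ (\sum_(i < m.+1) (K * (t / m.+1%:R))%:E)%E).
  apply: lee_sum => i _; under eq_integral do rewrite EFinM.
  rewrite ge0_integralZr//; last 3 first.
  - by apply/measurable_EFinP; apply: mf; apply: grid_ge0.
  - by move=> w _; rewrite lee_fin.
  - by rewrite lee_fin.
  by rewrite [leRHS]EFinM lee_wpmul2r ?lee_fin//; apply: fK; apply: gt.
have -> : (\sum_(i < m.+1) (K * (t / m.+1%:R))%:E)%E = (\sum_(i < m.+1) (K * (t / m.+1%:R)))%:E.
  by rewrite -sumEFin.
rewrite lee_fin sumr_const card_ord -mulrnAr -[t / _ *+ _]mulr_natr divfK ?pnatr_eq0//.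
Qed.

End Riemann.

(** * Convolutions of the semigroup with Brownian motion *)

Lemma gsum_cvg_end (R : realType) (T : Type) (X : R -> T -> R) (h dh : R -> R) w (t : R) :
  continuous (X ^~ w) -> X 0 w = 0 -> continuous dh -> (forall s : R, is_derive s (1 : R) h (dh s)) ->
  0 < t -> (fun k => gsum (h \o grid t k) X (grid t k) k.+1 w) @ \oo --> pathint h dh X t w.
Proof.
move=> cX X0 cd dh' t0; have tT : 0 <= t <= t by rewrite (ltW t0) lexx.
have -> : (fun k => gsum (h \o grid t k) X (grid t k) k.+1 w) =
    (fun k => gsum (h \o grid t k) X (grid t k) (gidx t k t) w).
  apply/funext => k; congr gsum.
  by rewrite /gidx mulrAC mulfV ?gt_eqF// mul1r natrK.
exact: gsum_cvg.
Qed.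

Section GaussianNoise.
Context (R : realType) (d : measure_display) (T : measurableType d) (P : probability T R).
Implicit Types X : R -> T -> R.

(** What the construction needs of a Brownian motion: the second moments of integrals of step
    functions and of their running maxima. Every path is continuous, so that pathwise statements
    hold for all outcomes. *)
Definition gnoise X : Prop :=
  [/\ forall w, continuous (X ^~ w), forall w t, t <= 0 -> X t w = 0,
      forall t, measurable_fun [set: T] (X t)
    & forall c tn n, (forall i, 0 <= tn i) -> (forall i, tn i <= tn i.+1) ->
      (sqi P (gsum c X tn n) /\
       nrm P (gsum c X tn n) ^+ 2 <= 8 * \sum_(i < n) c i ^+ 2 * (tn i.+1 - tn i)) /\
      (sqi P (rmax (gsum c X tn) n) /\
       nrm P (rmax (gsum c X tn) n) ^+ 2 <= 32 * \sum_(i < n) c i ^+ 2 * (tn i.+1 - tn i))].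

Lemma within_tp (f : R -> R) : {within `[0, +oo[, continuous f} -> continuous (fun t => f (tp t)).
Proof.
move=> /subspace_continuousP cf t.
have tp_in (s : R) : `[0, +oo[%classic (tp s) by rewrite /= in_itv/= andbT tp_ge0.
move=> U hU; have h : nbhs (tp t) [set s | `[0, +oo[%classic s -> U (f s)] := cf (tp t) (tp_in t) U hU.
have := @cts_max0 R t _ h; apply: (@filterS _ (nbhs t)) => s; apply; exact: tp_in.
Qed.

(** The path is set to zero on the null set where it is not continuous or does not start at 0. *)
Lemma brownian_mod (F : R -> set (set T)) X : filtration F -> brownian P F X ->
  exists X', gnoise X' /\ {ae P, forall w, forall t, 0 <= t -> X' t w = X t w}.
Proof.
move=> hF hX; have [aX h0 hc _ _] := hX.
have [N [mN PN sub]] := @filterI _ _ (ae_filter_ringOfSetsType P) _ _ h0 hc.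
have good w : ~ N w -> X 0 w = 0 /\ {within `[0, +oo[, continuous (fun t => X t w)}.
  by move=> nN; apply: contrapT => h; apply: nN; exact: sub.
pose i w : R := \1_(~` N) w.
have i1 w : ~ N w -> i w = 1 by move=> nN; rewrite /i indicE mem_set.
have i0 w : N w -> i w = 0 by move=> Nw; rewrite /i indicE memNset//= => /(_ Nw).
pose X' t w := i w * X (tp t) w.
have mi : measurable_fun [set: T] i by apply: measurable_indic; exact: measurableC.
have mX t : 0 <= t -> measurable_fun [set: T] (X t).
  move=> t0; apply: (Fmeas_mfun hF t0) => D mD; exact: aX.
have mX' t : measurable_fun [set: T] (X' t).
  by apply: measurable_funM => //; apply: mX; exact: tp_ge0.
exists X'; split; last first.
  exists N; split => // w /= h; apply: contrapT => nN; apply: h => t t0.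
  by rewrite /X' i1// mul1r tp_id.
have gE c tn n w : (forall i, 0 <= tn i) -> gsum c X' tn n w = i w * gsum c X tn n w.
  move=> tn0; rewrite /gsum mulr_sumr; apply: eq_bigr => j _.
  by rewrite /X' !tp_id//; ring.
have iN w : `|i w| <= 1.
  by case: (pselect (N w)) => Nw; [rewrite i0// normr0|rewrite i1// normr1].
have rE c tn n w : (forall i, 0 <= tn i) -> rmax (gsum c X' tn) n w = i w * rmax (gsum c X tn) n w.
  move=> tn0; elim: n => [|n ih] /=; first exact: gE.
  rewrite ih gE//; case: (pselect (N w)) => Nw; first by rewrite i0// !mul0r maxxx.
  by rewrite i1// !mul1r.
have mg c tn n : measurable_fun [set: T] (gsum c X' tn n).
  apply: measurable_sum => j; apply: measurable_funM => //; exact: measurable_funB.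
have mr c tn n : measurable_fun [set: T] (rmax (gsum c X' tn) n).
  by elim: n => [|n ih] /=; [exact: mg|exact: measurable_maxr].
split => //.
- move=> w; case: (pselect (N w)) => Nw.
    rewrite (_ : X' ^~ w = fun=> 0); first by move=> ?; exact: cvg_cst.
    by apply/funext => t; rewrite /X' i0// mul0r.
  rewrite (_ : X' ^~ w = fun t => X (tp t) w); first by case: (good w Nw) => _ /within_tp.
  by apply/funext => t; rewrite /X' i1// mul1r.
- move=> w t t0; rewrite /X' /tp; have -> : Num.max 0 t = 0 by apply/max_idPl.
  case: (pselect (N w)) => Nw; first by rewrite i0// mul0r.
  by case: (good w Nw) => -> _; rewrite mulr0.
- move=> c tn n tn0 tnS.
  have [s1 n1] := gsum_sq hF hX tn0 tnS c n; have [s2 n2] := doob hF hX tn0 tnS c n.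
  have d1 w : `|gsum c X' tn n w| <= `|gsum c X tn n w|.
    by rewrite gE// normrM ler_piMl.
  have d2 w : `|rmax (gsum c X' tn) n w| <= `|rmax (gsum c X tn) n w|.
    by rewrite rE// normrM ler_piMl.
  split; split.
  + exact: (sqi_dom s1 _ d1).
  + by apply: le_trans n1; rewrite lerXn2r ?nnegrE ?nrm_ge0//; exact: (nrm_dom s1 _ d1).
  + exact: (sqi_dom s2 _ d2).
  + by apply: le_trans n2; rewrite lerXn2r ?nnegrE ?nrm_ge0//; exact: (nrm_dom s2 _ d2).
Qed.

(** The difference of the sums on a grid and on a refinement of it is the integral of a step
    function of size [H t / m]; Fatou's lemma passes to the limit of the refinements. *)
Lemma gnoise_riemann X (h dh : R -> R) (t H : R) m : gnoise X -> 0 <= t ->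
  continuous dh -> (forall s : R, is_derive s (1 : R) h (dh s)) ->
  (forall s, 0 <= s <= t -> `|dh s| <= H) -> 0 <= H ->
  sqi P (fun w => gsum (h \o grid t m) X (grid t m) m.+1 w - pathint h dh X t w) /\
  nrm P (fun w => gsum (h \o grid t m) X (grid t m) m.+1 w - pathint h dh X t w) ^+ 2 <=
    8 * (H ^+ 2 * t ^+ 3) / m.+1%:R ^+ 2.
Proof.
move=> [cX X0 mX gX] t0 cd dh' hH H0.
have [<-|tp] := eqVneq 0 t.
  have -> : (fun w => gsum (h \o grid 0 m) X (grid 0 m) m.+1 w - pathint h dh X 0 w) = fun=> 0.
    apply/funext => w; rewrite /gsum big1 => [|i _]; last by rewrite /grid !mul0r subrr mulr0.
    by rewrite /pathint pint_le0// X0// mulr0 !subr0.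
  by split; [exact: sqi0|rewrite nrm0 !expr0n/= !mulr0 mul0r].
have {}tp : 0 < t by rewrite lt_def eq_sym tp.
(* grids with [m.+1 * j.+1] steps, all of them refinements of the grid with [m.+1] steps *)
pose M j := (m.+1 * j.+1).-1.
have MS j : (M j).+1 = (m.+1 * j.+1)%N by rewrite /M prednK// muln_gt0.
have gE j i : grid t (M j) (i * j.+1) = grid t m i.
  by rewrite /grid MS !natrM mulrA -mulf_div mulfV ?pnatr_eq0// mulr1.
pose c j i := h (grid t m (i %/ j.+1)) - h (grid t (M j) i).
pose D j := gsum (c j) X (grid t (M j)) (M j).+1.
have DE j w : D j w = gsum (h \o grid t m) X (grid t m) m.+1 w -
    gsum (h \o grid t (M j)) X (grid t (M j)) (M j).+1 w.
  rewrite /D /c -(gsumB (fun i => h (grid t m (i %/ j.+1))) (h \o grid t (M j))); congr (_ - _).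
  rewrite MS -(@gsum_refine _ _ (h \o grid t m) X (grid t (M j)) m.+1 j.+1)//.
  by congr gsum; apply/funext => i; rewrite gE.
have ch : continuous h.
  by move=> s; apply: differentiable_continuous; apply/derivable1_diffP; have [] := dh' s.
have m0 : 0 < m.+1%:R :> R by rewrite ltr0n.
have lip a b : 0 <= a -> a <= b -> b <= t -> `|h a - h b| <= H * (b - a).
  move=> a0; rewrite le_eqVlt => /predU1P[<- _|ab bt]; first by rewrite !subrr normr0 mulr0.
  have [x] := MVT ab (fun x _ => dh' x) (continuous_subspaceT ch).
  rewrite in_itv/= => /andP[ax xb]; rewrite distrC => ->.
  rewrite normrM (gtr0_norm (x := b - a)) ?subr_gt0// ler_wpM2r ?subr_ge0 ?(ltW ab)//.
  by apply: hH; rewrite (le_trans a0 (ltW ax)) (le_trans (ltW xb)).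
have cle j i : (i < (M j).+1)%N -> c j i ^+ 2 <= (H * (t / m.+1%:R)) ^+ 2.
  move=> iM; rewrite -real_normK ?num_real// lerXn2r ?nnegrE ?mulr_ge0 ?divr_ge0//.
  have ij : (i %/ j.+1 * j.+1 <= i)%N := leq_trunc_div i j.+1.
  have ij2 : (i <= (i %/ j.+1).+1 * j.+1)%N by apply: ltnW; rewrite ltn_ceil.
  have gm a b : (a <= b)%N -> grid t (M j) a <= grid t (M j) b.
    by move=> ab; rewrite /grid ler_wpM2r ?invr_ge0// ler_wpM2l// ler_nat.
  apply: le_trans (lip _ _ _ _ _) _.
  - exact: grid_ge0.
  - by rewrite -(gE j); exact: gm.
  - by rewrite -{2}(grid_end t (M j)); apply: gm; exact: ltnW.
  - by apply: ler_wpM2l => //; rewrite -(gridS t m (i %/ j.+1)) lerD2r -(gE j); exact: gm.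
have gr0 j i : 0 <= grid t (M j) i by exact: grid_ge0.
have grS j i : grid t (M j) i <= grid t (M j) i.+1 by exact: grid_mono.
apply: (@fatou_nrm _ _ _ _ D).
- by move=> j; have [[]] := gX (c j) (grid t (M j)) (M j).+1 (gr0 j) (grS j).
- move=> j; have [[_ hn] _] := gX (c j) (grid t (M j)) (M j).+1 (gr0 j) (grS j).
  apply: le_trans hn _; rewrite -mulrA ler_wpM2l//.
  apply: (@le_trans _ _ (\sum_(i < (M j).+1) (H * (t / m.+1%:R)) ^+ 2 * (t / (M j).+1%:R))).
    by apply: ler_sum => i _; rewrite gridS ler_wpM2r ?divr_ge0//; exact: cle.
  rewrite sumr_const card_ord -mulrnAr -[(t / _) *+ _]mulr_natr divfK ?pnatr_eq0//.
  by eqle; field; rewrite gt_eqF.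
move=> w; under eq_fun do rewrite DE.
apply: cvgB; first exact: cvg_cst.
have gc : (fun k => gsum (h \o grid t k) X (grid t k) k.+1 w) @ \oo --> pathint h dh X t w.
  exact: gsum_cvg_end (cX w) (X0 w 0 (lexx _)) cd dh' tp.
have Mc : M @ \oo --> \oo.
  apply/cvgnyPge => A; exists A => // j /= Aj; rewrite /M -ltnS prednK ?muln_gt0//.
  by apply: (@leq_trans j.+1) => //; rewrite mulSn leq_addr.
exact: (cvg_comp _ _ Mc gc).
Qed.

Lemma pathint_sq X (h dh : R -> R) (t K : R) : gnoise X -> 0 <= t ->
  continuous dh -> (forall s : R, is_derive s (1 : R) h (dh s)) ->
  (forall m, 8 * \sum_(i < m.+1) h (grid t m i) ^+ 2 * (t / m.+1%:R) <= K) ->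
  sqi P (pathint h dh X t) /\ nrm P (pathint h dh X t) ^+ 2 <= K.
Proof.
move=> [cX X0 mX gX] t0 cd dh' hK.
have [<-|tp] := eqVneq 0 t.
  have -> : pathint h dh X 0 = fun=> 0.
    by apply/funext => w; rewrite /pathint pint_le0// X0// mulr0 !subr0.
  split; [exact: sqi0|rewrite nrm0 expr0n/=]; apply: le_trans (hK 0%N).
  by rewrite mulr_ge0// sumr_ge0// => i _; rewrite mulr_ge0 ?sqr_ge0 ?divr_ge0.
have {}tp : 0 < t by rewrite lt_def eq_sym tp.
have gr0 m i : 0 <= grid t m i by exact: grid_ge0.
have grS m i : grid t m i <= grid t m i.+1 by exact: grid_mono.
apply: (@fatou_nrm _ _ _ _ (fun m => gsum (h \o grid t m) X (grid t m) m.+1)).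
- by move=> m; have [[]] := gX (h \o grid t m) (grid t m) m.+1 (gr0 m) (grS m).
- move=> m; have [[_ hn] _] := gX (h \o grid t m) (grid t m) m.+1 (gr0 m) (grS m).
  apply: le_trans hn (le_trans _ (hK m)); rewrite ler_wpM2l//.
  by apply: ler_sum => i _; rewrite gridS.
by move=> w; exact: gsum_cvg_end (cX w) (X0 w 0 (lexx _)) cd dh' tp.
Qed.

Section Kernel.
Variable n : R.
Hypothesis n1 : 1 <= n.

(** [kc] and [ks] are the real and imaginary parts of [exp (n ^ 2 s + i n ^ 3 s)]. For suitable
    [al] and [be], [kn al be t s] is the real or the imaginary part of the semigroup at time [t - s]. *)
Definition kc (s : R) : R := expR (n ^+ 2 * s) * cos (n ^+ 3 * s).
Definition ks (s : R) : R := expR (n ^+ 2 * s) * sin (n ^+ 3 * s).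
Definition dkc (s : R) : R := n ^+ 2 * kc s - n ^+ 3 * ks s.
Definition dks (s : R) : R := n ^+ 2 * ks s + n ^+ 3 * kc s.
Definition kn (al be t s : R) : R := expR (- (n ^+ 2 * t)) * (al * kc s + be * ks s).
Definition dkn (al be t s : R) : R := expR (- (n ^+ 2 * t)) * (al * dkc s + be * dks s).

(** The real and imaginary parts of the convolution of [dX] with the semigroup at frequency [n]
    are of this form. *)
Definition conv (al be : R) X (t : R) : T -> R := pathint (kn al be t) (dkn al be t) X t.

Let n0 : 0 < n. Proof. exact: lt_le_trans n1. Qed.

Lemma is_derive_kc (s : R) : is_derive s (1 : R) kc (dkc s).
Proof. by apply: is_derive_eq; rewrite /GRing.scale/= /dkc /kc /ks; ring. Qed.

Lemma is_derive_ks (s : R) : is_derive s (1 : R) ks (dks s).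
Proof. by apply: is_derive_eq; rewrite /GRing.scale/= /dks /kc /ks; ring. Qed.

Lemma cts_kc : continuous kc.
Proof. by move=> s; apply: cvgM; [exact: cts_expR_lin|exact: cts_cos_lin]. Qed.

Lemma cts_ks : continuous ks.
Proof. by move=> s; apply: cvgM; [exact: cts_expR_lin|exact: cts_sin_lin]. Qed.

Lemma cts_dkc : continuous dkc.
Proof.
move=> s; apply: cvgB; apply: cvgM; try exact: cvg_cst; [exact: cts_kc|exact: cts_ks].
Qed.

Lemma cts_dks : continuous dks.
Proof.
move=> s; apply: cvgD; apply: cvgM; try exact: cvg_cst; [exact: cts_ks|exact: cts_kc].
Qed.

Lemma is_derive_kn al be t (s : R) : is_derive s (1 : R) (kn al be t) (dkn al be t s).
Proof.
have d1 := is_derive_kc s; have d2 := is_derive_ks s.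
by apply: is_derive_eq; rewrite /GRing.scale/= /dkn; ring.
Qed.

Lemma cts_dkn al be t : continuous (dkn al be t).
Proof.
move=> s; apply: cvgM; first exact: cvg_cst.
by apply: cvgD; apply: cvgM; try exact: cvg_cst; [exact: cts_dkc|exact: cts_dks].
Qed.

Lemma kn_bdd al be t s : `|al| <= 1 -> `|be| <= 1 ->
  `|kn al be t s| <= 2 * expR (- (n ^+ 2 * (t - s))).
Proof.
move=> al1 be1; rewrite /kn /kc /ks.
rewrite (_ : _ * _ = expR (- (n ^+ 2 * (t - s))) * (al * cos (n ^+ 3 * s) + be * sin (n ^+ 3 * s))); last first.
  rewrite (_ : - (n ^+ 2 * (t - s)) = - (n ^+ 2 * t) + n ^+ 2 * s); last by ring.
  by rewrite expRD; ring.
rewrite normrM ger0_norm ?expR_ge0// mulrC ler_wpM2r ?expR_ge0//.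
apply: le_trans (ler_normD _ _) _; rewrite (_ : 2 = 1 * 1 + 1 * 1 :> R); last by ring.
by rewrite !normrM; apply: lerD; apply: ler_pM => //; [exact: cos_max|exact: sin_max].
Qed.

(** [dkn] is again of the form [kn], for other coefficients, up to the factor [2 n ^ 3]. *)
Lemma dkn_bdd al be t s : `|al| <= 1 -> `|be| <= 1 -> 0 <= s <= t ->
  `|dkn al be t s| <= 4 * n ^+ 3.
Proof.
move=> al1 be1 /andP[s0 st].
have n23 : n ^+ 2 <= n ^+ 3 by rewrite [leRHS]exprS ler_peMl// sqr_ge0.
(* coefficients of [dkn] as a combination of [kc] and [ks], normalised to be at most 1 *)
pose al' := (n ^+ 2 * al + n ^+ 3 * be) / (2 * n ^+ 3).
pose be' := (n ^+ 2 * be - n ^+ 3 * al) / (2 * n ^+ 3).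
have n30 : 0 < 2 * n ^+ 3 by rewrite mulr_gt0// exprn_gt0.
have n2p : 0 <= n ^+ 2 by exact: sqr_ge0.
have n3p : 0 <= n ^+ 3 by rewrite exprn_ge0// ltW.
have b1 x y : `|x| <= 1 -> `|y| <= 1 -> `|(n ^+ 2 * x + n ^+ 3 * y) / (2 * n ^+ 3)| <= 1.
  move=> x1 y1; rewrite normrM (gtr0_norm (x := _^-1)) ?invr_gt0// ler_pdivrMr// mul1r.
  apply: le_trans (ler_normD _ _) _; rewrite (normrM (n ^+ 2)) (normrM (n ^+ 3)) (ger0_norm n2p) (ger0_norm n3p).
  rewrite mulr_natl mulr2n; apply: lerD; last by rewrite ler_piMr.
  by apply: le_trans n23; rewrite ler_piMr.
have -> : dkn al be t s = 2 * n ^+ 3 * kn al' be' t s.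
  rewrite /dkn /dkc /dks /kn /al' /be'; set E := expR _; set c := kc s; set d' := ks s.
  by field; rewrite gt_eqF.
rewrite normrM (gtr0_norm n30) (_ : 4 * n ^+ 3 = 2 * n ^+ 3 * 2); last by ring.
apply: ler_wpM2l; first exact: ltW.
apply: le_trans (kn_bdd _ _ _ _) _.
- exact: b1.
- by rewrite /be' -mulrN; apply: b1 => //; rewrite normrN.
- rewrite ler_piMr// -[leRHS]expR0 ler_expR oppr_le0 mulr_ge0// subr_ge0//.
Qed.

(** The sum of [exp (- 2 n ^ 2 (t - s))] over the grid is compared with a telescoping sum, which
    gains the factor [1 / n ^ 2]. *)
Lemma conv_sq al be X t : gnoise X -> 0 <= t -> `|al| <= 1 -> `|be| <= 1 ->
  sqi P (conv al be X t) /\ nrm P (conv al be X t) ^+ 2 <= 16 / n ^+ 2.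
Proof.
move=> gX t0 al1 be1; apply: pathint_sq => //; [exact: cts_dkn|exact: is_derive_kn|].
move=> m; pose a := 2 * n ^+ 2.
have a0 : 0 < a by rewrite mulr_gt0// exprn_gt0.
pose e i := expR (- (a * (t - grid t m i))).
have step i : kn al be t (grid t m i) ^+ 2 * (t / m.+1%:R) <= 4 / a * (e i.+1 - e i).
  apply: (@le_trans _ _ (4 * e i * (t / m.+1%:R))).
    rewrite ler_wpM2r ?divr_ge0//.
    rewrite (_ : 4 * e i = (2 * expR (- (n ^+ 2 * (t - grid t m i)))) ^+ 2); last first.
      rewrite exprMn [expR _ ^+ 2]expr2 -expRD (_ : 2 ^+ 2 = 4 :> R); last by ring.
      by congr (_ * expR _); rewrite /a; ring.
    rewrite -real_normK ?num_real// lerXn2r ?nnegrE ?mulr_ge0 ?expR_ge0//.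
    exact: kn_bdd.
  rewrite (_ : e i.+1 = e i * expR (a * (t / m.+1%:R))); last first.
    by rewrite /e -expRD -(gridS t m i); congr expR; ring.
  rewrite (_ : 4 / a * _ = 4 * e i * ((expR (a * (t / m.+1%:R)) - 1) / a)); last by field; rewrite gt_eqF.
  rewrite ler_wpM2l ?mulr_ge0 ?expR_ge0// ler_pdivlMr// mulrC.
  by rewrite lerBrDr addrC; exact: expR_ge1Dx.
apply: (@le_trans _ _ (8 * \sum_(i < m.+1) 4 / a * (e i.+1 - e i))).
  by rewrite ler_wpM2l//; apply: ler_sum => i _; exact: step.
rewrite -mulr_sumr -(big_mkord xpredT (fun i => e i.+1 - e i)) telescope_sumr//.
rewrite /e grid_end subrr mulr0 oppr0 expR0.
have h : 1 - expR (- (a * (t - grid t m 0))) <= 1 by rewrite gerBl expR_ge0.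
rewrite (_ : 16 / n ^+ 2 = 8 * (4 / a * 1)); last by rewrite /a; field; rewrite gt_eqF.
by rewrite ler_wpM2l// ler_wpM2l// divr_ge0// ltW.
Qed.

Lemma conv_riemann al be X t m : gnoise X -> 0 <= t -> `|al| <= 1 -> `|be| <= 1 ->
  sqi P (fun w => gsum (kn al be t \o grid t m) X (grid t m) m.+1 w - conv al be X t w) /\
  nrm P (fun w => gsum (kn al be t \o grid t m) X (grid t m) m.+1 w - conv al be X t w) ^+ 2 <=
    8 * ((4 * n ^+ 3) ^+ 2 * t ^+ 3) / m.+1%:R ^+ 2.
Proof.
move=> gX t0 al1 be1; apply: gnoise_riemann => //; [exact: cts_dkn|exact: is_derive_kn| |].
  by move=> s; exact: dkn_bdd.
by rewrite mulr_ge0// exprn_ge0// ltW.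
Qed.

Lemma convE al be X t w : gnoise X ->
  conv al be X t w = expR (- (n ^+ 2 * t)) * (al * pathint kc dkc X t w + be * pathint ks dks X t w).
Proof.
move=> [cX _ _ _].
have c1 : continuous (fun s => dkc s * X s w) by move=> s; apply: cvgM; [exact: cts_dkc|exact: cX].
have c2 : continuous (fun s => dks s * X s w) by move=> s; apply: cvgM; [exact: cts_dks|exact: cX].
have cc (c : R) (f : R -> R) : continuous f -> continuous (fun s => c * f s).
  by move=> cf s; apply: cvgM; [exact: cvg_cst|exact: cf].
rewrite /conv /pathint.
have -> : pint (fun s => dkn al be t s * X s w) t =
    expR (- (n ^+ 2 * t)) * (al * pint (fun s => dkc s * X s w) t + be * pint (fun s => dks s * X s w) t).
  rewrite -!pintZ// -pintD; [|exact: cc|exact: cc].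
  rewrite -pintZ; last by move=> s; apply: cvgD; [exact: (cc al _ c1)|exact: (cc be _ c2)].
  by apply: pint_eq => s _; rewrite /dkn; ring.
by rewrite /kn; ring.
Qed.

Lemma conv_cts (al be : R -> R) X w : gnoise X -> continuous al -> continuous be ->
  continuous (fun t => conv (al t) (be t) X t w).
Proof.
move=> gX ca cb; under eq_fun do rewrite convE//.
have [cX _ _ _] := gX; move=> t; apply: cvgM; first exact: cts_expR_linN.
apply: cvgD; apply: cvgM; [exact: ca| |exact: cb|].
  by apply: pathint_cts => //; [exact: cts_dkc|exact: is_derive_kc].
by apply: pathint_cts => //; [exact: cts_dks|exact: is_derive_ks].
Qed.

(** The decaying exponential in front of the convolution compensates the growing weight inside, so
    that, after Abel summation, only the maximal functions of the integrals of [cos] and [sin]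
    remain. The bound does not depend on [n]. *)
Lemma conv_sup X (T0 : R) : gnoise X -> 0 < T0 -> exists Q : T -> \bar R,
  [/\ measurable_fun [set: T] Q, forall w, (0 <= Q w)%E, (\int[P]_w Q w <= (2 ^+ 11 * T0)%:E)%E
    & forall w t al be, 0 <= t <= T0 -> `|al| <= 1 -> `|be| <= 1 ->
       ((conv al be X t w ^+ 2)%:E <= Q w)%E].
Proof.
move=> gX T0p; have [cX X0 mX gS] := gX; have T00 := ltW T0p.
pose C1 s := cos (n ^+ 3 * s); pose S1 s := sin (n ^+ 3 * s).
(* a bound for the absolute value needs the running maxima of a sum and of its opposite *)
pose run (c : R -> R) m : T -> R := rmax (gsum (c \o grid T0 m) X (grid T0 m)) m.+1.
have hrun (c : R -> R) m : (forall s, `|c s| <= 1) -> sqi P (run c m) /\ nrm P (run c m) <= Num.sqrt (32 * T0).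
  move=> c1; have [_ [s1 s2]] := gS (c \o grid T0 m) (grid T0 m) m.+1
    (fun i => grid_ge0 m i T00) (fun i => grid_mono m i T00).
  split => //; rewrite -ler_sqr ?nnegrE ?nrm_ge0 ?sqrtr_ge0// [Num.sqrt (32 * T0) ^+ 2]sqr_sqrtr ?mulr_ge0//.
  apply: le_trans s2 _; apply: ler_wpM2l => //.
  apply: (@le_trans _ _ (\sum_(i < m.+1) T0 / m.+1%:R)).
    apply: ler_sum => i _; rewrite gridS ler_piMl ?divr_ge0//.
    by rewrite -real_normK ?num_real// expr_le1//; exact: c1.
  by rewrite sumr_const card_ord -[(T0 / _) *+ _]mulr_natr divfK ?pnatr_eq0.
pose Q m w := (run C1 m w + run (fun s => - C1 s) m w) + (run S1 m w + run (fun s => - S1 s) m w).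
have hQ m : sqi P (Q m) /\ nrm P (Q m) ^+ 2 <= 512 * T0.
  have eq_le1 (x y : R) : x = y -> y <= 1 -> x <= 1 by move=> ->.
  have [a1 b1] := hrun C1 m (fun s => cos_max _).
  have [a2 b2] := hrun (fun s => - C1 s) m (fun s => eq_le1 _ _ (normrN _) (cos_max _)).
  have [a3 b3] := hrun S1 m (fun s => sin_max _).
  have [a4 b4] := hrun (fun s => - S1 s) m (fun s => eq_le1 _ _ (normrN _) (sin_max _)).
  have sq : sqi P (Q m) by apply: sqiD; exact: sqiD.
  split => //; have h : nrm P (Q m) <= 4 * Num.sqrt (32 * T0).
    apply: le_trans (ler_nrmD (sqiD a1 a2) (sqiD a3 a4)) _.
    have := ler_nrmD a1 a2; have := ler_nrmD a3 a4; lra.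
  apply: (@le_trans _ _ ((4 * Num.sqrt (32 * T0)) ^+ 2)).
    by rewrite lerXn2r ?nnegrE ?nrm_ge0 ?mulr_ge0 ?sqrtr_ge0.
  by rewrite exprMn sqr_sqrtr ?mulr_ge0//; lra.
have Q0 m w : forall k, (k <= m.+1)%N ->
   `|gsum (C1 \o grid T0 m) X (grid T0 m) k w| <= run C1 m w + run (fun s => - C1 s) m w /\
   `|gsum (S1 \o grid T0 m) X (grid T0 m) k w| <= run S1 m w + run (fun s => - S1 s) m w.
  have E (c : R -> R) : run (fun s => - c s) m w =
      rmax (fun i w => - gsum (c \o grid T0 m) X (grid T0 m) i w) m.+1 w.
    rewrite /run; congr (rmax _ _ _); apply/funext => i; apply/funext => w'.
    by rewrite -gsumN.
  move=> k km; rewrite !E; split; apply: rmaxN_ge => //; by rewrite /gsum big_ord0.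
exists (fun w => limn_einf (fun m => (4 * Q m w ^+ 2)%:E)); split.
- apply: measurable_limn_einf => m; apply/measurable_EFinP; apply: measurable_funM => //.
  by apply: measurable_funX; case: (hQ m) => -[].
- move=> w; apply: (@limn_einf_real _ (fun=> 0)); first exact: cvg_cst.
  by move=> m; rewrite lee_fin mulr_ge0// sqr_ge0.
- apply: le_trans (fatou P measurableT _ _) _.
  + move=> m; apply/measurable_EFinP; apply: measurable_funM => //.
    by apply: measurable_funX; case: (hQ m) => -[].
  + by move=> m w _; rewrite lee_fin mulr_ge0// sqr_ge0.
  apply: limn_einf_le => m; have [sq nq] := hQ m.
  under eq_integral do rewrite EFinM.
  rewrite ge0_integralZl//; last 2 first.
  + by apply/measurable_EFinP; apply: measurable_funX; case: sq.
  + by move=> w _; rewrite lee_fin sqr_ge0.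
  rewrite ip_intE// -nrm2 -EFinM lee_fin (_ : 2 ^+ 11 * T0 = 4 * (512 * T0)); last by ring.
  by rewrite ler_wpM2l.
- move=> w t al be tT al1 be1.
  have t0 : 0 <= t by case/andP: tT.
  pose u m := expR (- (n ^+ 2 * t)) *
    (al * gsum (kc \o grid T0 m) X (grid T0 m) (gidx T0 m t) w +
     be * gsum (ks \o grid T0 m) X (grid T0 m) (gidx T0 m t) w).
  apply: (@limn_einf_real _ (fun m => u m ^+ 2)).
    rewrite convE//; apply: cvg_sqr; apply: cvgM; first exact: cvg_cst.
    have X00 : X 0 w = 0 by exact: X0.
    by apply: cvgD; apply: cvgM; try exact: cvg_cst; apply: gsum_cvg => //;
      [exact: cts_dkc|exact: is_derive_kc|exact: cts_dks|exact: is_derive_ks].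
  move=> m; rewrite lee_fin.
  have [k1 k2 _] := gidxP m T0p tT; set k := gidx T0 m t in k1 k2 *.
  pose a i := expR (n ^+ 2 * grid T0 m i).
  have aS i : a i <= a i.+1 by rewrite ler_expR ler_wpM2l ?sqr_ge0// grid_mono.
  have h1 := @gsum_abel R T a (C1 \o grid T0 m) X (grid T0 m) k w _ (expR_ge0 _) aS
    (fun i ik => (Q0 m w i (leq_trans ik k1)).1).
  have h2 := @gsum_abel R T a (S1 \o grid T0 m) X (grid T0 m) k w _ (expR_ge0 _) aS
    (fun i ik => (Q0 m w i (leq_trans ik k1)).2).
  have E1 : expR (- (n ^+ 2 * t)) * a k <= 1.
    by rewrite /a -expRD -[leRHS]expR0 ler_expR addrC subr_le0 ler_wpM2l ?sqr_ge0.
  have Qc0 : 0 <= run C1 m w + run (fun s => - C1 s) m w.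
    exact: le_trans (normr_ge0 _) (Q0 m w 0%N isT).1.
  have Qs0 : 0 <= run S1 m w + run (fun s => - S1 s) m w.
    exact: le_trans (normr_ge0 _) (Q0 m w 0%N isT).2.
  have Qm0 : 0 <= Q m w by exact: addr_ge0.
  have ub : `|u m| <= 2 * Q m w.
    rewrite /u normrM ger0_norm ?expR_ge0//.
    apply: (@le_trans _ _ (expR (- (n ^+ 2 * t)) * (2 * (a k * Q m w)))).
      rewrite ler_wpM2l ?expR_ge0//; apply: le_trans (ler_normD _ _) _.
      rewrite (_ : 2 * _ = 2 * (a k * (run C1 m w + run (fun s => - C1 s) m w)) +
         2 * (a k * (run S1 m w + run (fun s => - S1 s) m w))); last by rewrite /Q; ring.
      by apply: lerD; rewrite normrM; [apply: le_trans h1|apply: le_trans h2]; rewrite ler_piMl.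
    rewrite (_ : _ * _ = 2 * (expR (- (n ^+ 2 * t)) * a k * Q m w)); last by ring.
    by rewrite ler_wpM2l// ler_piMl.
  rewrite -real_normK ?num_real// (_ : 4 * _ = (2 * Q m w) ^+ 2); last by ring.
  by rewrite lerXn2r ?nnegrE ?mulr_ge0.
Qed.

End Kernel.

End GaussianNoise.

(** * The coordinates of the stochastic convolution *)

Lemma ae_summable (R : realType) (d : measure_display) (T : measurableType d)
    (mu : {measure set T -> \bar R}) (F : nat -> T -> \bar R) (c : nat -> R) (C : R) :
  (forall k, measurable_fun [set: T] (F k)) -> (forall k w, (0 <= F k w)%E) ->
  (forall k, (\int[mu]_w F k w <= (c k)%:E)%E) -> (forall N, \sum_(k < N) c k <= C) ->
  {ae mu, forall w, exists M : R, forall N, (\sum_(k < N) F k w <= M%:E)%E}.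
Proof.
move=> mF F0 Fc cC.
pose S w : \bar R := (\sum_(0 <= k <oo) F k w)%E.
have mS : measurable_fun [set: T] S by apply: ge0_emeasurable_sum => // k w _ _; exact: F0.
have S0 w : (0 <= S w)%E by apply: nneseries_ge0 => k _ _; exact: F0.
have iS : (\int[mu]_w S w <= C%:E)%E.
  rewrite integral_nneseries//; apply: lime_le.
    by apply: is_cvg_nneseries => k _ _; apply: integral_ge0 => w _; exact: F0.
  apply: nearW => N; rewrite big_mkord; apply: (@le_trans _ _ (\sum_(k < N) (c k)%:E)%E).
    by apply: lee_sum => k _; exact: Fc.
  by rewrite sumEFin lee_fin.
have intS : mu.-integrable setT S.
  apply/integrableP; split => //; under eq_integral do rewrite gee0_abs//.
  exact: le_lt_trans iS (ltry _).
have := integrable_ae measurableT intS.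
apply: (@filterS _ _ (ae_filter_ringOfSetsType mu)) => w /(_ I) fS.
exists (fine (S w)) => N; rewrite fineK// -(big_mkord xpredT (fun k => F k w)).
by apply: nneseries_lim_ge => k _ _; exact: F0.
Qed.

Section NoiseCoordinates.
Context (R : realType) (d : measure_display) (T : measurableType d) (P : probability T R).
Variable phi : int -> R.
Hypothesis hphi : hilbert_schmidt_L2_H1 phi.

(** The amplitude of the noise at the [k]-th real coordinate. The factor [2 sqrt pi] is the ratio
    between a coordinate in the orthonormal basis and the real or imaginary part of the Fourier
    coefficient; the minus sign comes from the [i] of the derivative. *)
Definition amp (k : nat) : R := - (2 * Num.sqrt pi) * (fr R k * phi (freq k)).

Lemma hs_sum : exists C, 0 <= C /\ forall N, \sum_(k < N) amp k ^+ 2 <= C.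
Proof.
pose a (n : int) : \bar R := ((1 + n%:~R ^+ 2) * phi n ^+ 2)%:E.
have a0 n : (0 <= a n)%E by rewrite lee_fin mulr_ge0 ?sqr_ge0// addr_ge0// sqr_ge0.
pose b (n : nat) : R := n%:R ^+ 2 * phi n ^+ 2.
have b0 n : 0 <= b n by rewrite mulr_ge0 ?sqr_ge0.
have fE : (\esum_(n in [set: int]) a n)%E \is a fin_num.
  by rewrite ge0_fin_numE; [exact: hphi|apply: esum_ge0 => n _; exact: a0].
have hb N : \sum_(n < N) b n <= fine (\esum_(n in [set: int]) a n)%E.
  rewrite -lee_fin fineK// -sumEFin.
  apply: (@le_trans _ _ (\sum_(n < N) a (Posz n))%E).
    by apply: lee_sum => n _; rewrite lee_fin ler_wpM2r ?sqr_ge0// lerDr.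
  rewrite -(big_mkord xpredT (fun n => a (Posz n))); apply: le_trans (nneseries_lim_ge _ _) _; first by move=> n _ _; exact: a0.
  rewrite nneseries_esumT; last by move=> n; exact: a0.
  rewrite -(@reindex_esum _ _ _ [set: nat] (range Posz) Posz a); last first.
    by split; [move=> n _; exists n|move=> x y _ _ []|move=> _ [n _ <-]; exists n].
  rewrite esum_mkcond [leRHS]esum_mkcond; apply: le_esum => n _.
  by rewrite [in leRHS]ifT ?inE//; case: ifP => // _; exact: a0.
set C0 := fine _ in hb.
have C00 : 0 <= C0 by have := hb 0%N; rewrite big_ord0.
exists (4 * pi * (2 * C0)); split; first by rewrite !mulr_ge0// pi_ge0.
move=> N; apply: (@le_trans _ _ (4 * pi * \sum_(k < N) b (freq k))).
  rewrite mulr_sumr; apply: ler_sum => k _; rewrite /amp /b /fr.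
  rewrite !exprMn sqrrN exprMn sqr_sqrtr ?pi_ge0//; eqle; ring.
apply: ler_wpM2l; first by rewrite mulr_ge0// pi_ge0.
have h2 j : \sum_(k < j.*2.+1) b (freq k) = b 0%N + 2 * \sum_(n < j) b n.+1.
  elim: j => [|j ih]; first by rewrite big_ord0 mulr0 addr0 big_ord1.
  rewrite doubleS [LHS]big_ord_recr/= [in LHS]big_ord_recr/= ih [in RHS]big_ord_recr/=.
  rewrite doubleK uphalf_double; ring.
apply: (@le_trans _ _ (\sum_(k < N.*2.+1) b (freq k))).
  rewrite -(big_mkord xpredT (fun k => b (freq k))) -[leRHS](big_mkord xpredT (fun k => b (freq k))).
  rewrite [leRHS](big_cat_nat _ (n := N))//=; last by lia.
  by rewrite lerDl sumr_ge0.
rewrite h2; have := hb N.+1; rewrite big_ord_recl; have := b0 0%N.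
have -> : \sum_(i < N) b (lift ord0 i) = \sum_(n < N) b n.+1 by apply: eq_bigr.
lra.
Qed.

Variable X : nat -> R -> T -> R.
Hypothesis gX : forall k, (0 < k)%N -> gnoise P (X k).

Definition cos_conv (k l : nat) (t : R) : T -> R :=
  conv (fr R k) (cos (fr R k ^+ 3 * t)) (sin (fr R k ^+ 3 * t)) (X l) t.
Definition sin_conv (k l : nat) (t : R) : T -> R :=
  conv (fr R k) (sin (fr R k ^+ 3 * t)) (- cos (fr R k ^+ 3 * t)) (X l) t.

(** The driving motions are indexed by coordinates: [X (2m+1)] stands for the imaginary part and
    [X (2m+2)] for the real part of the complex Brownian motion at frequency [m+1]. A coordinate
    of the convolution involves both, as the phase of the semigroup mixes them. *)
Definition conv_coord (k : nat) (t : R) (w : T) : R :=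
  if k is 0%N then 0 else amp k * (cos_conv k k t w + sg R k * sin_conv k (partner k) t w).

Lemma partner_gt0 k : (0 < k)%N -> (0 < partner k)%N.
Proof. by case: k => // k _; rewrite /partner /=; case ok: (odd k) => //=; case: k ok. Qed.

Lemma fr_ge1 k : (0 < k)%N -> 1 <= fr R k.
Proof. by move=> k0; rewrite /fr ler1n /freq; lia. Qed.

Lemma nsin_max (x : R) : `|- cos x| <= 1. Proof. by rewrite normrN cos_max. Qed.

Lemma conv_coord_cts k w : continuous (conv_coord k ^~ w).
Proof.
case: k => [|k] /=; first by move=> ?; exact: cvg_cst.
have cs := @cts_cos_lin R; have ss := @cts_sin_lin R.
move=> t; apply: cvgM; first exact: cvg_cst.
apply: cvgD.
  have h : continuous (fun t => cos_conv k.+1 k.+1 t w) := conv_cts (gX (ltn0Sn k)) (cs _) (ss _).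
  exact: h.
apply: cvgM; first exact: cvg_cst.
have ncs : continuous (fun t => - cos (fr R k.+1 ^+ 3 * t)) by move=> s; apply: cvgN; exact: cs.
have h : continuous (fun t => sin_conv k.+1 (partner k.+1) t w) :=
  conv_cts (gX (partner_gt0 (ltn0Sn k))) (ss _) ncs.
exact: h.
Qed.

Lemma nrm_comb (f g : T -> R) (a s : R) : sqi P f -> sqi P g -> `|s| = 1 ->
  sqi P (fun w => a * (f w + s * g w)) /\
  nrm P (fun w => a * (f w + s * g w)) ^+ 2 <= a ^+ 2 * (2 * (nrm P f ^+ 2 + nrm P g ^+ 2)).
Proof.
move=> sf sg' s1; have h1 := sqiZ s sg'; have h2 := sqiD sf h1.
split; first exact: sqiZ.
rewrite nrmZ// exprMn real_normK ?num_real// ler_wpM2l ?sqr_ge0//.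
have := ler_nrmD sf h1; rewrite nrmZ// s1 mul1r.
have := nrm_ge0 P f; have := nrm_ge0 P g; have := nrm_ge0 P (fun x => f x + s * g x).
set x := nrm P _; set y := nrm P _; set z := nrm P _ => x0 y0 z0 h.
have : x ^+ 2 <= (z + y) ^+ 2 by rewrite lerXn2r ?nnegrE ?addr_ge0.
have := sqr_ge0 (z - y); nra.
Qed.

(** The smoothing of the semigroup gains exactly the derivative that the noise loses. *)
Lemma conv_coord_sq k t : 0 <= t -> sqi P (conv_coord k t) /\
  fr R k ^+ 2 * nrm P (conv_coord k t) ^+ 2 <= 64 * amp k ^+ 2.
Proof.
move=> t0; case: k => [|k].
  rewrite (_ : conv_coord 0 t = fun=> 0)//; split; first exact: sqi0.
  by rewrite fr0 expr0n/= mul0r mulr_ge0// sqr_ge0.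
have k0 := ltn0Sn k; have n1 := fr_ge1 k0.
have [s1 h1] := conv_sq n1 (gX k0) t0 (cos_max (fr R k.+1 ^+ 3 * t)) (sin_max (fr R k.+1 ^+ 3 * t)).
have [s2 h2] := conv_sq n1 (gX (partner_gt0 k0)) t0 (sin_max (fr R k.+1 ^+ 3 * t)) (nsin_max (fr R k.+1 ^+ 3 * t)).
have [h3 h4] := nrm_comb (amp k.+1) s1 s2 (sg_norm R k.+1).
split; first exact: h3.
have n0 : 0 < fr R k.+1 ^+ 2 by rewrite exprn_gt0// (lt_le_trans ltr01 n1).
have arith (m a x y z : R) : 0 < m -> x <= a ^+ 2 * (2 * (y + z)) -> y <= 16 / m -> z <= 16 / m ->
    m * x <= 64 * a ^+ 2.
  move=> m0 hx hy hz; apply: (@le_trans _ _ (m * (a ^+ 2 * (2 * (16 / m + 16 / m))))).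
    rewrite ler_wpM2l ?(ltW m0)//; apply: le_trans hx _.
    by rewrite ler_wpM2l ?sqr_ge0// ler_wpM2l// lerD.
  by eqle; field; rewrite gt_eqF.
exact: arith n0 h4 h1 h2.
Qed.

Lemma conv_coord_meas k t : 0 <= t -> measurable_fun [set: T] (conv_coord k t).
Proof. by move=> t0; case: (conv_coord_sq k t0) => -[]. Qed.

(** Both series converge in expectation: the suprema in time by [conv_sup], and the [H1] norms by
    [conv_coord_sq]; the Hilbert-Schmidt norm of the noise bounds their sums. *)
Lemma conv_coord_ae_bound (T0 : R) : 0 < T0 -> {ae P, forall w, exists (b : nat -> R) (M : R),
  [/\ forall N, \sum_(k < N) b k <= M,
      forall t k, 0 <= t <= T0 -> conv_coord k t w ^+ 2 <= b k
    & forall N, \sum_(k < N) fr R k ^+ 2 * pint (fun s => conv_coord k s w ^+ 2) T0 <= M]}.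
Proof.
move=> T0p; have T00 := ltW T0p; have [C [C0 hC]] := hs_sum.
have [c c0 hc] : exists2 c : R, 0 <= c & c = 2 ^+ 11 by exists (2 ^+ 11) => //; exact: exprn_ge0.
have Qex k : exists Q : T -> \bar R,
   [/\ measurable_fun [set: T] Q, forall w, (0 <= Q w)%E,
       (\int[P]_w Q w <= (4 * c * T0 * amp k ^+ 2)%:E)%E
     & forall w t, 0 <= t <= T0 -> ((conv_coord k t w ^+ 2)%:E <= Q w)%E].
  case: k => [|k].
    exists (fun=> 0%E); split => //.
    - by rewrite integral0 lee_fin; posi.
    - by move=> w t _; rewrite /= expr0n.
  have k0 := ltn0Sn k; have n1 := fr_ge1 k0.
  have [Q1 [m1 p1 i1 u1]] := conv_sup (fr R k.+1) (gX k0) T0p.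
  have [Q2 [m2 p2 i2 u2]] := conv_sup (fr R k.+1) (gX (partner_gt0 k0)) T0p.
  exists (fun w => ((2 * amp k.+1 ^+ 2)%:E * (Q1 w + Q2 w))%E).
  have a0 : (0 <= (2 * amp k.+1 ^+ 2)%:E)%E by rewrite lee_fin mulr_ge0 ?sqr_ge0.
  split.
  - by apply: emeasurable_funM => //; exact: emeasurable_funD.
  - by move=> w; rewrite mule_ge0// adde_ge0.
  - rewrite ge0_integralZl//; [|exact: emeasurable_funD|by move=> w _; rewrite adde_ge0].
    rewrite ge0_integralD//.
    rewrite (_ : 4 * c * T0 * _ = (2 * amp k.+1 ^+ 2) * (c * T0 + c * T0)); last by ring.
    by rewrite [leRHS]EFinM lee_wpmul2l// EFinD hc leeD.
  - move=> w t tT.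
    have v1 := u1 w t _ _ tT (cos_max (fr R k.+1 ^+ 3 * t)) (sin_max (fr R k.+1 ^+ 3 * t)).
    have v2 := u2 w t _ _ tT (sin_max (fr R k.+1 ^+ 3 * t)) (nsin_max (fr R k.+1 ^+ 3 * t)).
    apply: (@le_trans _ _ ((2 * amp k.+1 ^+ 2)%:E * ((cos_conv k.+1 k.+1 t w ^+ 2)%:E + (sin_conv k.+1 (partner k.+1) t w ^+ 2)%:E))%E).
      rewrite -EFinD -EFinM lee_fin /=.
      set x := cos_conv _ _ _ _; set y := sin_conv _ _ _ _; set a := amp _; set g := sg _ _.
      rewrite exprMn (_ : 2 * a ^+ 2 * _ = a ^+ 2 * (2 * (x ^+ 2 + y ^+ 2))); last by ring.
      rewrite ler_wpM2l ?sqr_ge0//.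
      have g2 : g * g = 1 by exact: sg2.
      have : (x + g * y) ^+ 2 + (x - g * y) ^+ 2 = 2 * x ^+ 2 + 2 * (g * g) * y ^+ 2 by ring.
      by rewrite g2; have := sqr_ge0 (x - g * y); lra.
    by rewrite lee_wpmul2l// leeD.
have [Q hQ] := choice Qex.
pose G k w : \bar R := (Q k w + (fr R k ^+ 2 * pint (fun s => conv_coord k s w ^+ 2) T0)%:E)%E.
have cz k w : continuous (fun s => conv_coord k s w ^+ 2).
  by move=> s; apply: cvg_sqr; exact: conv_coord_cts.
have pz k w : 0 <= pint (fun s => conv_coord k s w ^+ 2) T0 by apply: pint_ge0 => s _; exact: sqr_ge0.
have mp k : measurable_fun [set: T] (fun w => pint (fun s => conv_coord k s w ^+ 2) T0).
  apply: measurable_pint => // s s0; apply: measurable_funX; exact: conv_coord_meas.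
pose C' := (4 * c + 64) * T0.
have C'0 : 0 <= C' by rewrite /C'; posi.
have hG : {ae P, forall w, exists M : R, forall N, (\sum_(k < N) G k w <= M%:E)%E}.
  apply: (@ae_summable R d T P G (fun k => C' * amp k ^+ 2) (C' * C)).
  - move=> k; have [mQ _ _ _] := hQ k; apply: emeasurable_funD => //.
    by apply/measurable_EFinP; exact: measurable_funM.
  - by move=> k w; have [_ Q0 _ _] := hQ k; rewrite adde_ge0// lee_fin mulr_ge0// sqr_ge0.
  - move=> k; have [mQ Q0 iQ _] := hQ k.
    rewrite ge0_integralD//; last 2 first.
    + by move=> w _; rewrite lee_fin mulr_ge0// sqr_ge0.
    + by apply/measurable_EFinP; exact: measurable_funM.
    rewrite (_ : C' * _ = 4 * c * T0 * amp k ^+ 2 + 64 * amp k ^+ 2 * T0); last by rewrite /C'; ring.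
    rewrite EFinD leeD//.
    rewrite (eq_integral (fun w => (pint (fun s => fr R k ^+ 2 * conv_coord k s w ^+ 2) T0)%:E)); last first.
      by move=> w _; rewrite pintZ.
    apply: (@pint_expectation _ _ _ P (fun s w => fr R k ^+ 2 * conv_coord k s w ^+ 2)) => //.
    + by move=> w s; apply: cvgM; [exact: cvg_cst|exact: cz].
    + by move=> s s0; apply: measurable_funM => //; apply: measurable_funX; exact: conv_coord_meas.
    + by move=> s w; rewrite mulr_ge0 ?sqr_ge0.
    + by rewrite mulr_ge0 ?sqr_ge0.
    + move=> s /andP[s0 _]; have [sz hz] := conv_coord_sq k s0.
      under eq_integral do rewrite EFinM.
      rewrite ge0_integralZl//; last 3 first.
      * by apply/measurable_EFinP; apply: measurable_funX; case: sz.
      * by move=> w _; rewrite lee_fin sqr_ge0.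
      * by rewrite lee_fin sqr_ge0.
      by rewrite ip_intE// -nrm2 -EFinM lee_fin.
  - by move=> N; rewrite -mulr_sumr ler_wpM2l.
apply: (@filterS _ _ (ae_filter_ringOfSetsType P)) hG => w [M hM].
have Q0 k : (0 <= Q k w)%E by case: (hQ k).
have G0 k : (0 <= (fr R k ^+ 2 * pint (fun s => conv_coord k s w ^+ 2) T0)%:E)%E.
  by rewrite lee_fin mulr_ge0// sqr_ge0.
have GM k : (G k w <= M%:E)%E.
  apply: le_trans (hM k.+1); rewrite big_ord_recr/= leeDr//.
  by apply: sume_ge0 => i _; rewrite adde_ge0.
have Qf k : Q k w \is a fin_num.
  rewrite ge0_fin_numE//; apply: le_lt_trans (ltry M); apply: le_trans (GM k).
  by rewrite leeDl.
exists (fun k => fine (Q k w)), M; split.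
- move=> N; rewrite -lee_fin -sumEFin; apply: le_trans (hM N); apply: lee_sum => k _.
  by rewrite fineK// leeDl.
- by move=> t k tT; rewrite -lee_fin fineK//; case: (hQ k) => _ _ _; exact.
- move=> N; rewrite -lee_fin -sumEFin; apply: le_trans (hM N); apply: lee_sum => k _.
  by rewrite leeDr.
Qed.

End NoiseCoordinates.

(** * Measurability and removal of the cut-off *)

Lemma picard_map_uncut (R : realType) (A : R) a0 (z V : R -> R -> R) (t : R) k : 0 < A -> 0 <= t ->
  (forall s, 0 <= s <= t -> nrm (torus R) (V s) <= A) ->
  picard_map A (fun=> true) a0 z V t k =
    sgrp t a0 k + duhamel (fun s j => quad j (fun x => V s x + z s x)) t k.
Proof.
move=> A0 t0 VA; rewrite /picard_map (tp_id t0).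
have -> : duhamel (fun s j => quad j (nl A z V s)) t k =
    duhamel (fun s j => quad j (fun x => V s x + z s x)) t k; last by [].
apply: pint_eq => s st.
have -> : nl A z V s = fun x => V s x + z s x; last by [].
by rewrite /nl (cut_id A0 (VA s st)).
Qed.

Section RandomFields.
Context (R : realType) (d : measure_display) (Omega : measurableType d).
Notation mu := (torus R).
Implicit Types (U V : Omega -> R -> R) (f g : R -> R).

(** Measurability of a random element of [L2], through its coordinates; every other form of
    measurability follows, since norms and squares are limits of polynomials in the coordinates. *)
Definition cmeas U := (forall w, sqi mu (U w)) /\
  forall k, measurable_fun [set: Omega] (fun w => ip mu (U w) (trig k)).

Lemma cmeas_cst f : sqi mu f -> cmeas (fun=> f).
Proof. by move=> sf; split => // k; exact: measurable_cst. Qed.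

Lemma cmeasD U V : cmeas U -> cmeas V -> cmeas (fun w x => U w x + V w x).
Proof.
move=> [sU mU] [sV mV]; split => [w|k]; first exact: sqiD.
under eq_fun do rewrite (ipDl (sU _) (sV _) (sqi_trig R k)).
exact: measurable_funD.
Qed.

Lemma cmeasZ (a : Omega -> R) U : measurable_fun [set: Omega] a -> cmeas U ->
  cmeas (fun w x => a w * U w x).
Proof.
move=> ma [sU mU]; split => [w|k]; first exact: sqiZ.
under eq_fun do rewrite (ipZl _ (sU _) (sqi_trig R k)).
exact: measurable_funM.
Qed.

Lemma cmeasB U V : cmeas U -> cmeas V -> cmeas (fun w x => U w x - V w x).
Proof.
move=> [sU mU] [sV mV]; split => [w|k]; first exact: sqiB.
under eq_fun do rewrite (ipBl (sU _) (sV _) (sqi_trig R k)).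
exact: measurable_funB.
Qed.

Lemma cmeas_nrm U : cmeas U -> measurable_fun [set: Omega] (fun w => nrm mu (U w)).
Proof.
move=> [sU mU].
apply: (@measurable_fun_cvg _ _ _ _
  (fun N w => Num.sqrt (\sum_(k < N) ip mu (U w) (trig k) ^+ 2))).
- move=> N; apply: (@measurableT_comp _ _ _ _ _ _ (@Num.sqrt R)) => //.
    apply: continuous_measurable_fun; exact: sqrt_continuous.
  by apply: measurable_sum => k; apply: measurable_funX; exact: mU.
- move=> w _; have h := parseval (@sqi_trig R) (@orth_trig R) (@trig_total R) (sU w).
  have -> : nrm mu (U w) = Num.sqrt (nrm mu (U w) ^+ 2) by rewrite sqrtr_sqr ger0_norm ?nrm_ge0.
  apply: (continuous_cvg _ _ h); exact: sqrt_continuous.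
Qed.

(** The square of the partial sums of the Fourier series converges to the square of the function
    in [L1]. *)
Lemma cmeas_quad U k : cmeas U -> measurable_fun [set: Omega] (fun w => quad k (U w)).
Proof.
move=> [sU mU].
pose S N w := psum (@trig R) (fun i => ip mu (U w) (trig i)) N.
have sS N w : sqi mu (S N w) by apply: sqi_psum; exact: sqi_trig.
apply: (@measurable_fun_cvg _ _ _ _ (fun N w => quad k (S N w))).
- move=> N.
  have E w : quad k (S N w) = \sum_(i < N) \sum_(j < N)
      ip mu (U w) (trig i) * ip mu (U w) (trig j) * ip mu (trig i) (fun x => trig j x * trig k x).
    rewrite /quad /S ip_psum//; last 2 first.
    + exact: sqi_trig.
    + by apply: sqi_trigM; exact: sS.
    apply: eq_bigr => i _; rewrite (_ : (fun x => _ * trig k x) = fun x => \sum_(j < N)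
        ip mu (U w) (trig j) * (trig j x * trig k x)); last first.
      by apply/funext => x; rewrite /psum mulr_suml; apply: eq_bigr => j _; rewrite mulrA.
    have st (j : nat) : sqi mu (fun x => trig j x * trig k x) by apply: sqi_trigM; exact: sqi_trig.
    rewrite (@ip_sumr _ _ _ mu _ (index_enum 'I_N) (fun (j : 'I_N) x => ip mu (U w) (trig j) * (trig j x * trig k x))); last 2 first.
    + by move=> j; apply: sqiZ.
    + exact: sqi_trig.
    rewrite mulr_sumr; apply: eq_bigr => j _; rewrite ipZr//; last exact: sqi_trig.
    by rewrite mulrA.
  under eq_fun do rewrite E.
  by apply: measurable_sum => i; apply: measurable_sum => j; apply: measurable_funM => //;
     apply: measurable_funM; exact: mU.
- move=> w _; have h := psum_cvg (@sqi_trig R) (@orth_trig R) (@trig_total R) (sU w).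
  have b N : nrm mu (S N w) <= nrm mu (U w).
    rewrite -ler_sqr ?nnegrE ?nrm_ge0// nrm_tpsum; exact: bessel_trig.
  have h2 : (fun N => nrm mu (fun x => U w x - S N w x) * (nrm mu (U w) + nrm mu (U w))) @ \oo --> (0 : R).
    by rewrite -(mul0r (nrm mu (U w) + nrm mu (U w))); apply: cvgM => //; exact: cvg_cst.
  apply: cvg_bound h2 _ => N; rewrite distrC; apply: le_trans (quadB k (sU w) (sS N w)) _.
  by rewrite ler_wpM2l ?nrm_ge0// lerD2l.
Qed.

Lemma cmeas_cut A U : 0 < A -> cmeas U -> cmeas (fun w => cut A (U w)).
Proof.
move=> A0 mU; apply: cmeasZ => //.
apply: (@measurableT_comp _ _ _ _ _ _ (fun s => A / Num.max A s)); last exact: cmeas_nrm.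
apply: continuous_measurable_fun => s; apply: cvgM; first exact: cvg_cst.
apply: cvgV; first by rewrite gt_eqF// lt_max A0.
by apply: (@continuous_max _ _ (cst A) id s); [exact: cvg_cst|exact: cvg_id].
Qed.

Lemma cmeas_ball U g (r : R) : cmeas U -> sqi mu g ->
  measurable [set w | (L2dist (U w) g < r%:E)%E].
Proof.
move=> mU sg'; have [sU _] := mU.
have -> : [set w | (L2dist (U w) g < r%:E)%E] =
    (fun w => nrm mu (fun x => U w x - g x)) @^-1` [set x | x < r].
  by apply/seteqP; split => w /=; rewrite L2distE// lte_fin.
rewrite -[X in measurable X]setTI.
have m := cmeas_nrm (cmeasB mU (cmeas_cst sg')).
apply: m => //; rewrite (_ : [set x | x < r] = `]-oo, r[%classic); first exact: measurable_itv.
by apply/seteqP; split => x /=; rewrite in_itv.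
Qed.

Lemma measurable_duhamel (f : Omega -> R -> nat -> R) (t : R) k :
  (forall w j, continuous (fun s => f w s j)) ->
  (forall s j, 0 <= s -> measurable_fun [set: Omega] (fun w => f w s j)) ->
  measurable_fun [set: Omega] (fun w => duhamel (f w) t k).
Proof.
move=> cf mf; apply: (@measurable_pint _ _ _ (fun s w => sgrp (t - s) (ddxc (f w s)) k)).
  move=> w; apply: (@cts_sgrpB R t k (fun s => ddxc (f w s))) => j s.
  by apply: cvgM; [exact: cvg_cst|exact: cf].
move=> s s0; have md j : measurable_fun [set: Omega] (fun w => ddxc (f w s) j).
  by apply: measurable_funM => //; exact: mf.
apply: measurable_funM => //; apply: measurable_funD; apply: measurable_funM => //; exact: md.
Qed.

Section CutoffSolutions.
Variables (a0 : nat -> R) (M0 T : R) (z : Omega -> R -> R -> R) (Bz H : Omega -> R).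
Hypothesis T0 : 0 <= T.
Hypothesis a0M : forall N, \sum_(k < N) a0 k ^+ 2 <= M0.
Hypothesis tz : forall w, tcont (z w).
Hypothesis mz : forall t, cmeas (z ^~ t).
Hypothesis zB : forall w t, nrm mu (z w t) <= Bz w.
Hypothesis z0 : forall w t, ip mu (z w t) (trig 0) = 0.
Hypothesis zH : forall w N t, 0 <= t <= T ->
  \sum_(k < N) fr R k ^+ 2 * pint (fun s => ip mu (z w s) (trig k) ^+ 2) t <= H w.

Let msk : nat -> bool := fun=> true.

Lemma cmeas_picard_iter A j t : 0 < A -> cmeas (fun w => picard_iter A msk a0 (z w) j t).
Proof.
move=> A0.
suff : (forall w, tcont (picard_iter A msk a0 (z w) j)) /\ forall t, cmeas (fun w => picard_iter A msk a0 (z w) j t).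
  by case.
elim: j {t} => [|j [ihc ihm]]; split => [w|t].
- by apply: tcont_cst; exact: sqi0.
- by apply: cmeas_cst; exact: sqi0.
- by case: (picard_map_ok msk A0 a0M (tz w) (zB w) (ihc w)).
- split => [w|k]; first exact: sqi_synth.
  have E w : ip mu (picard_iter A msk a0 (z w) j.+1 t) (trig k) = picard_map A msk a0 (z w) (picard_iter A msk a0 (z w) j) t k.
    by have [_] := picard_map_ok msk A0 a0M (tz w) (zB w) (ihc w); exact.
  under eq_fun do rewrite E.
  rewrite /picard_map; apply: measurable_funD => //.
  apply: (@measurable_duhamel (fun w s i => quad i (nl A (z w) (picard_iter A msk a0 (z w) j) s))).
    by move=> w i; apply: tcont_quad; exact: tcont_nl (tz w) _ (ihc w).
  by move=> s i _; apply: cmeas_quad; apply: cmeasD => //; exact: cmeas_cut.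
Qed.

(** By [energy_bound], for each outcome the cut-off at level [N] is inactive for all large [N], and
    then the solutions for different levels agree. The solution is the eventual value of this
    sequence, and as such it is measurable. *)
Lemma mild_coords : exists V : Omega -> R -> R -> R,
  [/\ forall w, tcont (V w), forall t, 0 <= t <= T -> cmeas (V ^~ t) &
   forall w t k, 0 <= t <= T -> ip mu (V w t) (trig k) =
     sgrp t a0 k + duhamel (fun s j => quad j (fun x => V w s x + z w s x)) t k].
Proof.
have A0 (N : nat) : 0 < N.+1%:R :> R by rewrite ltr0n.
have VNex (N : nat) : exists V : Omega -> R -> R -> R, forall w,
    [/\ tcont (V w), forall t k, ip mu (V w t) (trig k) = picard_map N.+1%:R msk a0 (z w) (V w) t k &
     forall t k, (fun j => ip mu (picard_iter N.+1%:R msk a0 (z w) j t) (trig k)) @ \oo --> ip mu (V w t) (trig k)].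
  have h w := cutoff_solution_ex msk (A0 N) a0M (tz w) (zB w).
  by have [V hV] := choice h; exists V.
have [V hV] := choice VNex.
have mV N t : cmeas (fun w => V N w t).
  split => [w|k]; first by have [[s _] _ _] := hV N w; exact: s.
  apply: (@measurable_fun_cvg _ _ _ _
    (fun j w => ip mu (picard_iter N.+1%:R msk a0 (z w) j t) (trig k))).
    by move=> j; have [_] := cmeas_picard_iter j t (A0 N); exact.
  by move=> w _; have [_ _] := hV N w; exact.
(* [K] bounds the square of the norm at every cut-off level, and [K <= N + 1 <= (N + 1) ^ 2]. *)
have N0ex w : exists N0 : nat, forall N t, (N0 <= N)%N -> 0 <= t <= T -> nrm mu (V N w t) <= N.+1%:R.
  pose K := (M0 + Bz w ^+ 2) * expR (128 * H w).
  exists (Num.truncn K) => N t N0N tT; have [tV cV _] := hV N w.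
  have h := energy_bound (A0 N) T0 a0M (tz w) (zB w) (z0 w) (zH w) tV cV tT.
  have hK : K <= N.+1%:R by apply/ltW; apply: lt_le_trans (truncnS_gt K) _; rewrite ler_nat.
  rewrite -ler_sqr ?nnegrE ?nrm_ge0 ?(ltW (A0 N))//; apply: le_trans h (le_trans hK _).
  by rewrite expr2 ler_peMl// ler1n.
have [N0 hN0] := choice N0ex.
have mild N w t k : (N0 w <= N)%N -> 0 <= t <= T -> ip mu (V N w t) (trig k) =
     sgrp t a0 k + duhamel (fun s j => quad j (fun x => V N w s x + z w s x)) t k.
  move=> N0N tT; have /andP[t0 tT'] := tT; have [_ -> _] := hV N w.
  apply: (picard_map_uncut a0 (z w) k (A0 N) t0) => s /andP[s0 st].
  by apply: hN0 => //; rewrite s0 (le_trans st tT').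
have same N w t k : (N0 w <= N)%N -> 0 <= t <= T ->
    ip mu (V N w t) (trig k) = ip mu (V (N0 w) w t) (trig k).
  move=> N0N tT.
  have tS M : tcont (fun s x => V M w s x + z w s x).
    by apply: tcontD => //; case: (hV M w).
  have sV M s : sqi mu (V M w s) by have [[]] := hV M w.
  have sz s : sqi mu (z w s) by have [] := tz w.
  have sS M s : sqi mu (fun x => V M w s x + z w s x) by exact: sqiD.
  have coord M s j : (N0 w <= M)%N -> 0 <= s <= T -> ip mu (fun x => V M w s x + z w s x) (trig j) -
      duhamel (fun r i => quad i (fun x => V M w r x + z w r x)) s j = sgrp s a0 j + ip mu (z w s) (trig j).
    move=> MN sT; rewrite ipDl//; last exact: sqi_trig.
    rewrite mild//; ring.
  have ae := @duhamel_uniq R T _ _ T0 (tS N) (tS (N0 w)) (fun s j sT =>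
    etrans (coord N s j N0N sT) (esym (coord (N0 w) s j (leqnn _) sT))) t tT.
  have := ip_ae (sS N t) (sS (N0 w) t) (sqi_trig R k) ae.
  by rewrite !ipDl//; try exact: sqi_trig; move/addIr.
exists (fun w => V (N0 w) w); split.
- by move=> w; case: (hV (N0 w) w).
- move=> t tT; split => [w|k]; first by have [[s _] _ _] := hV (N0 w) w; exact: s.
  apply: (@measurable_fun_cvg _ _ _ _ (fun N w => ip mu (V N w t) (trig k))).
    by move=> N; case: (mV N t).
  move=> w _; apply: cvg_near_cst; exists (N0 w) => // N /= N0N; exact: same.
- by move=> w t k tT; exact: mild.
Qed.

End CutoffSolutions.

End RandomFields.

(** * Complex Fourier coefficients and real coordinates *)

Local Open Scope complex_scope.

Section ComplexCoordinates.
Context (R : realType).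
Notation mu := (torus R).
Notation leb := (@lebesgue_measure R).
Implicit Types (a b : nat -> R) (f u : R -> R) (n : int).

(** Ratios between complex Fourier coefficients and coordinates in the real orthonormal basis. *)
Definition nc0 : R := (2 * pi)^-1 * Num.sqrt (2 * pi).
Definition nc1 : R := (2 * pi)^-1 * Num.sqrt pi.

Lemma nc0_gt0 : 0 < nc0.
Proof. by rewrite mulr_gt0 ?invr_gt0 ?sqrtr_gt0 ?twopi_gt0. Qed.

Lemma nc1_gt0 : 0 < nc1.
Proof. by rewrite mulr_gt0 ?invr_gt0 ?sqrtr_gt0 ?twopi_gt0 ?pi_gt0. Qed.

(** The complex Fourier coefficients of the function with real coordinates [a]. *)
Definition cpx a n : R[i] := match n with
  | Posz 0 => (nc0 * a 0%N) +i* 0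
  | Posz m.+1 => (nc1 * a m.*2.+1) +i* (- (nc1 * a m.*2.+2))
  | Negz m => (nc1 * a m.*2.+1) +i* (nc1 * a m.*2.+2)
  end.

Lemma cpxD a b n : cpx a n + cpx b n = cpx (fun k => a k + b k) n.
Proof.
by case: n => [[|m]|m]; apply/eqP; rewrite eq_complex /=; apply/andP; split; apply/eqP; ring.
Qed.

Lemma cpxN a n : - cpx a n = cpx (fun k => - a k) n.
Proof.
by case: n => [[|m]|m]; apply/eqP; rewrite eq_complex /=; apply/andP; split; apply/eqP; ring.
Qed.

Lemma cpx_inj a b : (forall n, cpx a n = cpx b n) -> forall k, a k = b k.
Proof.
move=> ab [|k].
  by have := congr1 (@complex.Re R) (ab 0%N) => /(mulfI (lt0r_neq0 nc0_gt0)).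
have n1 := lt0r_neq0 nc1_gt0.
have h m := congr1 (@complex.Re R) (ab m.+1); have g m := congr1 (@complex.Im R) (ab m.+1).
have [m [->|->]] : exists m, k = m.*2 \/ k = m.*2.+1.
  by exists k./2; have := odd_double_half k; case: (odd k) => /= e; [right|left]; rewrite -{1}e.
- by have /(mulfI n1) := h m.
- by have /oppr_inj/(mulfI n1) := g m.
Qed.

(** Integrability against the basis, rather than square integrability, makes this apply to [u ^ 2]. *)
Lemma fourierE f n : (forall k, mu.-integrable setT (EFin \o (fun x => f x * trig k x))) ->
  fourier f n = cpx (fun k => ip mu f (trig k)) n.
Proof.
move=> hi.
have E : fourier f n = ((2 * pi)^-1 * \int[mu]_x (f x * cosz n x)) +i*
    ((2 * pi)^-1 * \int[mu]_x (- (f x * sinz n x))).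
  rewrite /fourier /cRintegral; apply/eqP; rewrite eq_complex /=; apply/andP; split; apply/eqP.
    rewrite mul0r subr0; congr (_ * _).
    by apply: eq_Rintegral => x _; rewrite /= expR0 !mul1r !mul0r !subr0 cosN.
  rewrite mul0r addr0; congr (_ * _).
  by apply: eq_Rintegral => x _; rewrite /= expR0 !mul1r !mul0r !addr0 sinN mulrN.
have s0 : Num.sqrt pi != 0 :> R by rewrite gt_eqF// sqrtr_gt0 pi_gt0.
have s2 : Num.sqrt (2 * pi) != 0 :> R by rewrite gt_eqF// sqrtr_gt0 twopi_gt0.
have C (m : nat) : \int[mu]_x (f x * cosz m.+1 x) = Num.sqrt pi * ip mu f (trig m.*2.+1).
  rewrite /ip -RintegralZl//; apply: eq_Rintegral => x _.
  by rewrite trig_odd; field.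
have S (m : nat) (c : R) : \int[mu]_x (c * (f x * sinz m.+1 x)) = c * Num.sqrt pi * ip mu f (trig m.*2.+2).
  rewrite /ip -RintegralZl//; apply: eq_Rintegral => x _.
  by rewrite trig_even; field.
have S1 (m : nat) : \int[mu]_x (- (f x * sinz m.+1 x)) = - (Num.sqrt pi * ip mu f (trig m.*2.+2)).
  have := S m (-1); rewrite mulN1r mulNr => <-; apply: eq_Rintegral => x _; by rewrite mulN1r.
have S2 (m : nat) : \int[mu]_x (f x * sinz m.+1 x) = Num.sqrt pi * ip mu f (trig m.*2.+2).
  have := S m 1; rewrite mul1r => <-; apply: eq_Rintegral => x _; by rewrite mul1r.
rewrite E; case: n {E} => [[|m]|m] /=; apply/eqP; rewrite eq_complex /=; apply/andP; split; apply/eqP.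
- rewrite /nc0 -mulrA; congr (_ * _); rewrite /ip -RintegralZl//; last exact: (hi 0%N).
  by apply: eq_Rintegral => x _; rewrite /= /cosz mul0r cos0; field.
- rewrite (_ : (fun x => - (f x * sinz 0 x)) = fun=> 0).
    by rewrite /Rintegral integral0 mulr0.
  by apply/funext => x; rewrite /sinz mul0r sin0 mulr0 oppr0.
- by rewrite C /nc1 mulrA.
- by rewrite S1 /nc1 mulrN mulrA.
- rewrite (_ : cosz (Negz m) = cosz m.+1) ?C /nc1 ?mulrA//.
  by apply/funext => x; rewrite /cosz NegzE mulrNz mulNr cosN.
- rewrite (_ : (fun x => - (f x * sinz (Negz m) x)) = fun x => f x * sinz m.+1 x) ?S2 /nc1 ?mulrA//.
  by apply/funext => x; rewrite /sinz NegzE mulrNz mulNr sinN mulrN opprK.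
Qed.

Lemma fourier_cpx f n : sqi mu f -> fourier f n = cpx (fun k => ip mu f (trig k)) n.
Proof. by move=> sf; apply: fourierE => k; apply: sqiM => //; exact: sqi_trig. Qed.

Lemma fourier_sq_cpx u n : sqi mu u ->
  fourier (fun x => u x ^+ 2) n = cpx (fun k => quad k u) n.
Proof.
move=> su; rewrite fourierE; last first.
  move=> k; have := sqiM su (sqi_trigM k su).
  by congr (integrable _ _ _); apply/funext => x; rewrite /= expr2 mulrA.
congr (cpx _ n); apply/funext => k; apply: eq_Rintegral => x _; by rewrite expr2 mulrA.
Qed.

Lemma intC n : n%:~R = (n%:~R : R) +i* 0.
Proof. by rewrite -(rmorph_int (real_complex R)). Qed.

Lemma frP m : fr R m.*2.+1 = m.+1%:R /\ fr R m.*2.+2 = m.+1%:R.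
Proof. by split; rewrite /fr /freq; congr (_%:R); lia. Qed.

Lemma partnerP m : partner m.*2.+1 = m.*2.+2 /\ partner m.*2.+2 = m.*2.+1.
Proof. by rewrite /partner /= odd_double. Qed.

Lemma sgP m : sg R m.*2.+1 = 1 /\ sg R m.*2.+2 = -1.
Proof. by rewrite /sg /= odd_double. Qed.

Lemma ddx_cpx a n : ddx (cpx a) n = cpx (fun k => - ddxc a k) n.
Proof.
rewrite /ddx /ddxc intC; case: n => [[|m]|m] /=.
- by rewrite fr0; apply/eqP; rewrite eq_complex /=; apply/andP; split; apply/eqP; ring.
- have [-> ->] := frP m; have [-> ->] := partnerP m; have [-> ->] := sgP m.
  by apply/eqP; rewrite eq_complex /=; apply/andP; split; apply/eqP; ring.
- have [-> ->] := frP m; have [-> ->] := partnerP m; have [-> ->] := sgP m; rewrite NegzE mulrNz.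
  by apply/eqP; rewrite eq_complex /=; apply/andP; split; apply/eqP; ring.
Qed.

Lemma semigroup_cpx t a n : 0 <= t -> semigroup t (cpx a) n = cpx (sgrp t a) n.
Proof.
move=> t0; rewrite /semigroup /cexp (ger0_norm t0).
case: n => [[|m]|m] /=.
- rewrite /sgrp fr0 !expr0n /= !mul0r !oppr0 expR0 cos0 sin0.
  by apply/eqP; rewrite eq_complex /=; apply/andP; split; apply/eqP; ring.
- rewrite /sgrp; have [-> ->] := frP m; have [-> ->] := partnerP m; have [-> ->] := sgP m.
  by apply/eqP; rewrite eq_complex /=; apply/andP; split; apply/eqP; ring.
- rewrite /sgrp; have [-> ->] := frP m; have [-> ->] := partnerP m; have [-> ->] := sgP m.
  rewrite NegzE mulrNz sqrrN [(- _) ^+ 3](_ : _ = - (m.+1%:R ^+ 3)); last by ring.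
  rewrite mulNr cosN sinN.
  by apply/eqP; rewrite eq_complex /=; apply/andP; split; apply/eqP; ring.
Qed.

Lemma pint_cpx (c : R -> nat -> R) t n : (forall k, continuous (fun s => c s k)) ->
  cRintegral leb `[0, t] (fun s => cpx (c s) n) = cpx (fun k => pint (fun s => c s k) t) n.
Proof.
move=> cc; rewrite /cRintegral; apply/eqP; rewrite eq_complex; case: n => [[|m]|m] /=.
- by rewrite -/(pint _ _) pintZ// Rintegral_cst// mul0r !eqxx.
- rewrite -!/(pint _ _) pintZ// -mulNr eqxx /=.
  by apply/eqP; rewrite -pintZ//; apply: pint_eq => s _; rewrite mulNr.
- by rewrite -!/(pint _ _) !pintZ// !eqxx.
Qed.

(** [cpx] intertwines the derivative, the semigroup and the time integral with their real forms, and
    it is injective. *)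
Lemma mild_cpx (U : R -> R -> R) (U0 Z : R -> R) (t : R) : tcont U -> sqi mu U0 -> sqi mu Z -> 0 <= t ->
  (forall n, fourier (U t) n = semigroup t (fourier U0) n
     - cRintegral leb `[0, t] (fun s => semigroup (t - s) (ddx (fourier (fun x => U s x ^+ 2))) n)
     + fourier Z n) <->
  (forall k, ip mu (U t) (trig k) = sgrp t (fun k => ip mu U0 (trig k)) k +
     duhamel (fun s j => quad j (U s)) t k + ip mu Z (trig k)).
Proof.
move=> tU s0 sZ t0.
have cq j := @tcont_quad R U j tU.
have E n : semigroup t (fourier U0) n
     - cRintegral leb `[0, t] (fun s => semigroup (t - s) (ddx (fourier (fun x => U s x ^+ 2))) n)
     + fourier Z n = cpx (fun k => sgrp t (fun k => ip mu U0 (trig k)) k +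
     duhamel (fun s j => quad j (U s)) t k + ip mu Z (trig k)) n.
  have -> : fourier U0 = cpx (fun k => ip mu U0 (trig k)) by apply/funext => m; exact: fourier_cpx.
  rewrite semigroup_cpx// fourier_cpx//.
  have -> : cRintegral leb `[0, t] (fun s => semigroup (t - s) (ddx (fourier (fun x => U s x ^+ 2))) n) =
      cRintegral leb `[0, t] (fun s => cpx (fun k => - sgrp (t - s) (ddxc (fun j => quad j (U s))) k) n).
    have h s : 0 <= s <= t -> semigroup (t - s) (ddx (fourier (fun x => U s x ^+ 2))) n =
        cpx (fun k => - sgrp (t - s) (ddxc (fun j => quad j (U s))) k) n.
      move=> /andP[_ st].
      have -> : ddx (fourier (fun x => U s x ^+ 2)) = cpx (fun k => - ddxc (fun j => quad j (U s)) k).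
        apply/funext => m; rewrite -ddx_cpx /ddx fourier_sq_cpx//; exact: tU.1.
      rewrite semigroup_cpx ?subr_ge0//; congr (cpx _ n); apply/funext => k; rewrite /sgrp; ring.
    rewrite /cRintegral; congr (_ +i* _); apply: eq_Rintegral => s; rewrite inE /= in_itv /= => st;
      by rewrite h.
  rewrite pint_cpx; last first.
    move=> k s; apply: cvgN; apply: (@cts_sgrpB R t k (fun s => ddxc (fun j => quad j (U s)))) => j r.
    by apply: cvgM; [exact: cvg_cst|exact: cq].
  rewrite cpxN !cpxD; congr (cpx _ n); apply/funext => k; congr (_ + _ + _).
  rewrite /duhamel -mulN1r -pintZ; last first.
    move=> s; apply: cvgN; apply: (@cts_sgrpB R t k (fun s => ddxc (fun j => quad j (U s)))) => j r.
    by apply: cvgM; [exact: cvg_cst|exact: cq].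
  by apply: pint_eq => s _; rewrite mulN1r opprK.
have sU : sqi mu (U t) by exact: tU.1.
split => [h k|h n]; last by rewrite E fourier_cpx//; congr (cpx _ n); apply/funext.
apply: (@cpx_inj (fun k => ip mu (U t) (trig k)) (fun k =>
  sgrp t (fun k => ip mu U0 (trig k)) k + duhamel (fun s j => quad j (U s)) t k + ip mu Z (trig k))) => n.
by rewrite -E -h fourier_cpx.
Qed.

End ComplexCoordinates.

Section Clamp.
Context (R : realType).
Notation mu := (torus R).

(** Projection of the line onto [[0, T]], by which a path on [[0, T]] is extended to all times. *)
Definition clamp (T t : R) : R := T - tp (T - tp t).

Lemma clampP (T t : R) : 0 <= T -> 0 <= clamp T t <= T.
Proof.
move=> T0; rewrite /clamp; have h1 := tp_ge0 t; have h2 := tp_ge0 (T - tp t).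
have h3 : tp (T - tp t) <= T by rewrite {1}/tp ge_max T0 lerBlDr lerDl.
by apply/andP; split; lra.
Qed.

Lemma clamp_id (T t : R) : 0 <= t <= T -> clamp T t = t.
Proof. by move=> /andP[t0 tT]; rewrite /clamp (tp_id t0) tp_id ?subr_ge0// opprB addrC subrK. Qed.

Lemma cts_clamp (T : R) : continuous (clamp T).
Proof.
move=> t; apply: cvgB; first exact: cvg_cst.
apply: (@cts_tp R (fun t => tp (T - t))) => s.
have := @continuous_comp R R R (fun r => T - r) (@tp R) s; apply; last exact: cts_max0.
by apply: cvgB; [exact: cvg_cst|exact: cvg_id].
Qed.

Lemma CL20_tcont d (Omega : measurableType d) (T : R) (u : R -> Omega -> R -> R) w : 0 <= T ->
  CL20_process T u -> tcont (fun t => u (clamp T t) w).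
Proof.
move=> T0 [uL uc _].
have su t : 0 <= t <= T -> sqi mu (u t w) by move=> tT; have /L20P[] := uL t w tT.
split => t; first by apply: su; exact: clampP.
have ct := clampP t T0; have := uc w _ ct => h.
have h2 : (fun s => L2dist (u (clamp T s) w) (u (clamp T t) w)) @ t --> 0%E.
  apply: cvg_trans h => S /=; rewrite !nbhs_simpl /= => hS.
  have := @cts_clamp T t _ hS; rewrite nbhs_simpl /=; apply: filterS => s hs.
  by apply: hs => /=; rewrite in_itv /= clampP.
have -> : (fun s => nrm mu (fun x => u (clamp T s) w x - u (clamp T t) w x)) =
    fun s => fine (L2dist (u (clamp T s) w) (u (clamp T t) w)).
  by apply/funext => s /=; rewrite L2distE//; apply: su; exact: clampP.
exact: fine_cvg h2.
Qed.

Lemma tcont_CL20 d (Omega : measurableType d) (T : R) (u : R -> Omega -> R -> R) :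
  (forall w, exists U, tcont U /\ forall t, 0 <= t <= T -> u t w = U t) ->
  (forall t, 0 <= t <= T -> cmeas (u t)) ->
  (forall t w, 0 <= t <= T -> ip mu (u t w) (trig 0) = 0) -> CL20_process T u.
Proof.
move=> tu mu_ u0.
have su t w : 0 <= t <= T -> sqi mu (u t w) by move=> tT; case: (mu_ t tT).
split => [t w tT|w t tT|t g r tT /L2P sg'].
- by apply/L20P; split; [exact: su|exact: u0].
- have [U [[sU cU] uU]] := tu w.
  have h : (fun s => (nrm mu (fun x => U s x - U t x))%:E) @ within `[0, T] (nbhs t) --> 0%E.
    by apply: cvg_EFin; [exact: nearW|apply: cvg_within_filter; exact: cU].
  apply: cvg_trans h; apply: near_eq_cvg; rewrite near_withinE; apply: nearW => s /=; rewrite in_itv /= => sT.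
  by rewrite -L2distE// !uU.
- exact: cmeas_ball (mu_ t tT) sg'.
Qed.

End Clamp.

(** * Wiener integrals *)

Lemma pint_mono (R : realType) (g : R -> R) (a b : R) : continuous g -> 0 <= a -> a <= b ->
  (forall s, 0 <= g s) -> pint g a <= pint g b.
Proof.
move=> cg a0; rewrite le_eqVlt => /predU1P[<- _|ab g0]; first exact: lexx.
have dg (s : R) : s \in `]a, b[ -> is_derive s (1 : R) (pint g) (g s).
  rewrite in_itv/= => /andP[as' _]; apply: pint_derive => //; exact: le_lt_trans as'.
have [c _] := MVT ab dg (continuous_subspaceT (pint_cts cg)).
by rewrite -subr_ge0 => ->; rewrite mulr_ge0// subr_ge0 ltW.
Qed.

Section WienerIntegral.
Context (R : realType) (d : measure_display) (Omega : measurableType d) (P : probability Omega R).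
Implicit Types (g : R -> R[i]) (B : R -> Omega -> R[i]) (Z : Omega -> R[i]).

Definition cmfun Z := measurable_fun [set: Omega] (fun w => complex.Re (Z w)) /\
  measurable_fun [set: Omega] (fun w => complex.Im (Z w)).

Lemma cmfunB Z Z' : cmfun Z -> cmfun Z' -> cmfun (fun w => Z w - Z' w).
Proof.
move=> [r i] [r' i']; split.
  rewrite (_ : (fun w => _) = fun w => complex.Re (Z w) - complex.Re (Z' w)); first exact: measurable_funB.
  by apply/funext => w; case: (Z w) (Z' w) => [? ?] [].
rewrite (_ : (fun w => _) = fun w => complex.Im (Z w) - complex.Im (Z' w)); first exact: measurable_funB.
by apply/funext => w; case: (Z w) (Z' w) => [? ?] [].
Qed.

Lemma csumE (n : nat) (z : nat -> R[i]) : \sum_(k < n) z k =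
  (\sum_(k < n) complex.Re (z k)) +i* (\sum_(k < n) complex.Im (z k)).
Proof.
elim: n => [|n ih]; first by rewrite !big_ord0.
by rewrite !big_ord_recr /= ih; case: (z n).
Qed.

Lemma normc2_meas Z : cmfun Z -> measurable_fun [set: Omega] (fun w => (normc2 (Z w))%:E).
Proof. by move=> [r i]; apply/measurable_EFinP; apply: measurable_funD; exact: measurable_funX. Qed.

Lemma normc2_ge0 (z : R[i]) : 0 <= normc2 z.
Proof. by rewrite addr_ge0 ?sqr_ge0. Qed.

Definition riemann_sum B g t (m : nat) (w : Omega) : R[i] :=
  \sum_(k < m.+1) g (grid t m k) * (B (grid t m k.+1) w - B (grid t m k) w).

Lemma riemann_sum_cmfun B g t m : 0 <= t -> (forall s, 0 <= s -> cmfun (B s)) -> cmfun (riemann_sum B g t m).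
Proof.
move=> t0 mB.
pose D k w := B (grid t m k.+1) w - B (grid t m k) w.
have mD k : cmfun (D k) by apply: cmfunB; apply: mB; exact: grid_ge0.
have E w : riemann_sum B g t m w = \sum_(k < m.+1) g (grid t m k) * D k w by [].
split.
  rewrite (_ : (fun w => _) = fun w => \sum_(k < m.+1) (complex.Re (g (grid t m k)) * complex.Re (D k w)
    - complex.Im (g (grid t m k)) * complex.Im (D k w))).
    by apply: measurable_sum => k; apply: measurable_funB; apply: measurable_funM => //; case: (mD k).
  apply/funext => w; rewrite E (csumE _ (fun k => g (grid t m k) * D k w)) /=; apply: eq_bigr => k _.
  by case: (g _) (D k w) => [? ?] [].
rewrite (_ : (fun w => _) = fun w => \sum_(k < m.+1) (complex.Re (g (grid t m k)) * complex.Im (D k w)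
    + complex.Im (g (grid t m k)) * complex.Re (D k w))).
  by apply: measurable_sum => k; apply: measurable_funD; apply: measurable_funM => //; case: (mD k).
apply/funext => w; rewrite E (csumE _ (fun k => g (grid t m k) * D k w)) /=; apply: eq_bigr => k _.
by case: (g _) (D k w) => [? ?] [].
Qed.

(** Both variables are limits in [L2] of the same Riemann sums. *)
Lemma wiener_uniq B g t Z Z' : 0 <= t -> (forall s, 0 <= s -> cmfun (B s)) ->
  is_wiener_integral P B g t Z -> is_wiener_integral P B g t Z' -> {ae P, forall w, Z w = Z' w}.
Proof.
move=> t0 mB [r i h] [r' i' h'].
have mr m := riemann_sum_cmfun g m t0 mB.
have mZ : cmfun Z by []. have mZ' : cmfun Z' by [].
have n0 (z : R[i]) : (0 <= (normc2 z)%:E)%E by rewrite lee_fin normc2_ge0.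
have b m : (\int[P]_w (normc2 (Z w - Z' w))%:E <=
    2%:E * (\int[P]_w (normc2 (riemann_sum B g t m w - Z w))%:E + \int[P]_w (normc2 (riemann_sum B g t m w - Z' w))%:E))%E.
  have m1 := normc2_meas (cmfunB (mr m) mZ); have m2 := normc2_meas (cmfunB (mr m) mZ').
  rewrite -ge0_integralD// -ge0_integralZl//; [|exact: emeasurable_funD|by move=> w _; exact: adde_ge0].
  apply: ge0_le_integral => //.
  - exact: normc2_meas (cmfunB mZ mZ').
  - by apply: emeasurable_funM => //; exact: emeasurable_funD.
  move=> w _; rewrite -EFinD -EFinM lee_fin /normc2.
  case: (Z w) (Z' w) (riemann_sum B g t m w) => [a1 a2] [b1 b2] [c1 c2] /=.
  have := sqr_ge0 (c1 - a1 + (c1 - b1)); have := sqr_ge0 (c2 - a2 + (c2 - b2)); lra.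
have : (\int[P]_w (normc2 (Z w - Z' w))%:E <= 0)%E.
  have hh : (fun m => 2%:E * (\int[P]_w (normc2 (riemann_sum B g t m w - Z w))%:E +
      \int[P]_w (normc2 (riemann_sum B g t m w - Z' w))%:E))%E @ \oo --> (2%:E * (0 + 0))%E.
    by apply: cvgeZl => //; apply: cvgeD; [|exact: h|exact: h'].
  rewrite adde0 mule0 in hh; rewrite -(cvg_lim _ hh)//; apply: lime_ge; first by apply/cvg_ex; eexists; exact: hh.
  exact: nearW.
move=> le0; have e0 : (\int[P]_w `|(normc2 (Z w - Z' w))%:E| = 0)%E.
  apply/eqP; rewrite eq_le; apply/andP; split; last exact: integral_ge0.
  by apply: le_trans le0; under eq_integral do rewrite gee0_abs//.
have /ae_eq_integral_abs ae := e0.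
apply: (@filterS _ _ (ae_filter_ringOfSetsType P)) (ae measurableT (normc2_meas (cmfunB mZ mZ'))) => w /(_ I) [].
rewrite /normc2; case: (Z w) (Z' w) => [a1 a2] [b1 b2] /= /eqP.
by rewrite paddr_eq0 ?sqr_ge0// !sqrf_eq0 !subr_eq0 => /andP[/eqP -> /eqP ->].
Qed.

(** Reduces negative frequencies to positive ones. *)
Lemma wiener_conj B B' g g' t Z Z' : is_wiener_integral P B g t Z ->
  (forall s w, B' s w = (B s w)^*) -> (forall s, g' s = (g s)^*) -> (forall w, Z' w = (Z w)^*) ->
  is_wiener_integral P B' g' t Z'.
Proof.
move=> [r i h] hB hg hZ.
have RC (z : R[i]) : complex.Re z^* = complex.Re z by case: z.
have IC (z : R[i]) : complex.Im z^* = - complex.Im z by case: z.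
split.
- by under eq_fun do rewrite hZ RC.
- by under eq_fun do rewrite hZ IC; exact: measurable_funN.
- suff -> : (fun m => \int[P]_w (normc2 (riemann_sum B' g' t m w - Z' w))%:E)%E =
    (fun m => \int[P]_w (normc2 (riemann_sum B g t m w - Z w))%:E)%E by exact: h.
  apply/funext => m; apply: eq_integral => w _; congr EFin.
  have -> : riemann_sum B' g' t m w - Z' w = (riemann_sum B g t m w - Z w)^*.
    rewrite rmorphB /= hZ; congr (_ - _); rewrite /riemann_sum rmorph_sum /=; apply: eq_bigr => k _.
    by rewrite rmorphM rmorphB /= hg !hB.
  by rewrite /normc2 RC IC sqrrN.
Qed.

End WienerIntegral.

Section NoiseSource.
Context (R : realType) (d : measure_display) (Omega : measurableType d) (P : probability Omega R).
Variables (F : R -> set (set Omega)) (B : nat -> R -> Omega -> R[i]).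
Hypotheses (hF : filtration F) (hB : independent_complex_brownians P F B).

(** The real Brownian motion that drives the [k]-th coordinate. *)
Definition noise_part (k : nat) (t : R) (w : Omega) : R :=
  if odd k then complex.Im (B (freq k) t w) else complex.Re (B (freq k) t w).

Lemma noise_part_brownian k : (0 < k)%N -> brownian P F (noise_part k).
Proof.
move=> k0; have [h _] := hB; have f0 : (0 < freq k)%N by rewrite /freq; lia.
have [hb _] := h _ f0.
by rewrite /noise_part; case: (odd k); [exact: (hb false)|exact: (hb true)].
Qed.

Lemma noise_part_meas k t : (0 < k)%N -> 0 <= t -> measurable_fun [set: Omega] (noise_part k t).
Proof.
move=> k0 t0; have [aX _ _ _ _] := noise_part_brownian k0.
by apply: (Fmeas_mfun hF t0) => D mD; exact: aX.
Qed.

Lemma noise_partP m t w : B m.+1 t w = noise_part m.*2.+2 t w +i* noise_part m.*2.+1 t w.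
Proof.
have f1 : freq m.*2.+1 = m.+1 by rewrite /freq; lia.
have f2 : freq m.*2.+2 = m.+1 by rewrite /freq; lia.
by rewrite /noise_part f1 f2 /= odd_double /=; case: (B _ _ _).
Qed.

Lemma noise_meas n t : 0 <= t -> cmfun (noise B n t).
Proof.
move=> t0; case: n => [[|m]|m] /=; first by split; exact: measurable_cst.
  by split; under eq_fun do rewrite /noise noise_partP /=; exact: noise_part_meas.
by split; under eq_fun do rewrite /noise noise_partP /=; [|apply: measurable_funN]; exact: noise_part_meas.
Qed.

Lemma noise_mod : exists X : nat -> R -> Omega -> R,
  (forall k, (0 < k)%N -> gnoise P (X k)) /\
  {ae P, forall w, forall k t, (0 < k)%N -> 0 <= t -> X k t w = noise_part k t w}.
Proof.
have h k : exists X, (0 < k)%N -> gnoise P X /\ {ae P, forall w, forall t, 0 <= t -> X t w = noise_part k t w}.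
  case: k => [|k]; first by exists (fun _ _ => 0).
  by have [X hX] := brownian_mod hF (noise_part_brownian (ltn0Sn k)); exists X.
have [X hX] := choice h; exists X; split => [k k0|]; first by case: (hX k k0).
apply: ae_foralln => k; case: k => [|k].
  by apply: (@filterE _ _ (ae_filter_ringOfSetsType P)).
have [_] := hX _ (ltn0Sn k); apply: (@filterS _ _ (ae_filter_ringOfSetsType P)) => w hw t _; exact: hw.
Qed.

End NoiseSource.

(** * The stochastic convolution *)

Section StochasticConvolution.
Context (R : realType) (d : measure_display) (Omega : measurableType d) (P : probability Omega R).
Variables (F : R -> set (set Omega)) (B : nat -> R -> Omega -> R[i]).
Hypotheses (hF : filtration F) (hB : independent_complex_brownians P F B).
Variable phi : int -> R.
Hypotheses (phi_even : forall n, phi (- n) = phi n) (hphi : hilbert_schmidt_L2_H1 phi).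
Notation mu := (torus R).
Notation noise_part := (noise_part B).

(** The real and imaginary parts of the semigroup at time [t - s], in the form in which
    [conv_riemann] applies. *)
Definition cos_kernel (n t s : R) : R := kn n (cos (n ^+ 3 * t)) (sin (n ^+ 3 * t)) t s.
Definition sin_kernel (n t s : R) : R := kn n (sin (n ^+ 3 * t)) (- cos (n ^+ 3 * t)) t s.

Lemma cos_kernelE n t s : cos_kernel n t s = expR (- (n ^+ 2 * (t - s))) * cos (n ^+ 3 * (t - s)).
Proof.
rewrite /cos_kernel /kn /kc /ks [n ^+ 3 * (t - s)]mulrBr cosB [- (_ * (t - s))](_ : _ = - (n ^+ 2 * t) + n ^+ 2 * s); last by ring.
rewrite expRD; ring.
Qed.

Lemma sin_kernelE n t s : sin_kernel n t s = expR (- (n ^+ 2 * (t - s))) * sin (n ^+ 3 * (t - s)).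
Proof.
rewrite /sin_kernel /kn /kc /ks [n ^+ 3 * (t - s)]mulrBr sinB [- (_ * (t - s))](_ : _ = - (n ^+ 2 * t) + n ^+ 2 * s); last by ring.
rewrite expRD; ring.
Qed.

(** The coefficient of [dB_n] in the stochastic convolution at time [t]. *)
Definition integrand (n : int) (t s : R) : R[i] := semigroup (t - s) (convop phi (ddx (fun=> 1))) n.

Lemma integrandE (m : nat) t s : s <= t -> integrand m.+1 t s =
  (- (m.+1%:R * phi m.+1 * sin_kernel m.+1%:R t s)) +i* (m.+1%:R * phi m.+1 * cos_kernel m.+1%:R t s).
Proof.
move=> st; rewrite /integrand /semigroup /convop /ddx /cexp intC ger0_norm ?subr_ge0// cos_kernelE sin_kernelE.
by apply/eqP; rewrite eq_complex /=; apply/andP; split; apply/eqP; ring.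
Qed.

Lemma integrandN (m : nat) t s : integrand (Negz m) t s = (integrand m.+1 t s)^*.
Proof.
rewrite /integrand /semigroup /convop /ddx /cexp !intC NegzE phi_even mulrNz sqrrN.
rewrite [(- _) ^+ 3](_ : _ = - (m.+1%:R ^+ 3)); last by ring.
by rewrite mulNr /= cosN sinN; apply/eqP; rewrite eq_complex /=; apply/andP; split; apply/eqP; ring.
Qed.

Definition gs (k : R -> R) (Y : R -> Omega -> R) t N (w : Omega) : R :=
  gsum (k \o grid t N) Y (grid t N) N.+1 w.

Lemma grid_le (t : R) N k : 0 <= t -> (k <= N.+1)%N -> grid t N k <= t.
Proof. by move=> t0 kN; rewrite /grid ler_pdivrMr ?ltr0n// ler_wpM2l// ler_nat. Qed.

Lemma riemann_sum_gs (m : nat) t N w : 0 <= t -> let n : R := m.+1%:R in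
  riemann_sum (noise B m.+1) (integrand m.+1 t) t N w =
  (- (n * phi m.+1 * (gs (cos_kernel n t) (noise_part m.*2.+1) t N w + gs (sin_kernel n t) (noise_part m.*2.+2) t N w))) +i*
  (n * phi m.+1 * (gs (cos_kernel n t) (noise_part m.*2.+2) t N w - gs (sin_kernel n t) (noise_part m.*2.+1) t N w)).
Proof.
move=> t0 n; pose D l (k : nat) := noise_part l (grid t N k.+1) w - noise_part l (grid t N k) w.
have E : riemann_sum (noise B m.+1) (integrand m.+1 t) t N w = \sum_(k < N.+1)
    ((- (n * phi m.+1 * (cos_kernel n t (grid t N k) * D m.*2.+1 k + sin_kernel n t (grid t N k) * D m.*2.+2 k))) +i*
     (n * phi m.+1 * (cos_kernel n t (grid t N k) * D m.*2.+2 k - sin_kernel n t (grid t N k) * D m.*2.+1 k))).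
  apply: eq_bigr => k _; rewrite integrandE; last by apply: grid_le => //; exact: ltnW.
  rewrite /noise !noise_partP -/n /D.
  by apply/eqP; rewrite eq_complex /=; apply/andP; split; apply/eqP; ring.
rewrite E (csumE _ (fun k => (- (n * phi m.+1 * (cos_kernel n t (grid t N k) * D m.*2.+1 k + sin_kernel n t (grid t N k) * D m.*2.+2 k))) +i*
     (n * phi m.+1 * (cos_kernel n t (grid t N k) * D m.*2.+2 k - sin_kernel n t (grid t N k) * D m.*2.+1 k)))) /gs /gsum /=.
congr (_ +i* _).
  by rewrite sumrN -mulr_sumr big_split.
by rewrite -mulr_sumr sumrB.
Qed.

Variable X : nat -> R -> Omega -> R.
Hypothesis gX : forall k, (0 < k)%N -> gnoise P (X k).
Hypothesis Xsrc : {ae P, forall w, forall k t, (0 < k)%N -> 0 <= t -> X k t w = noise_part k t w}.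

Lemma nc1_amp (m : nat) :
  nc1 R * amp phi m.*2.+1 = - (m.+1%:R * phi m.+1) /\ nc1 R * amp phi m.*2.+2 = - (m.+1%:R * phi m.+1).
Proof.
have s2 : Num.sqrt pi * Num.sqrt pi = pi :> R by rewrite -expr2 sqr_sqrtr// pi_ge0.
have p0 : pi != 0 :> R by rewrite gt_eqF// pi_gt0.
have aux (p x : R) : p != 0 -> (2 * p)^-1 * (- 2) * p * x = - x by move=> ?; field.
have f1 : freq m.*2.+1 = m.+1 by rewrite /freq; lia.
have f2 : freq m.*2.+2 = m.+1 by rewrite /freq; lia.
rewrite /amp /fr f1 f2 /nc1; split.
all: transitivity ((2 * pi)^-1 * (- 2) * (Num.sqrt pi * Num.sqrt pi) * (m.+1%:R * phi m.+1)); first by ring.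
all: by rewrite s2; exact: aux.
Qed.

(** Each of the four real convolutions is within [O(1/N)] of its Riemann sum in mean square, and
    both the Riemann sums and the coordinates are the same combination of these four. *)
Lemma wiener_pos (m : nat) t (Z : Omega -> R[i]) : 0 <= t -> cmfun Z ->
  {ae P, forall w, Z w = cpx (fun k => conv_coord phi X k t w) m.+1} ->
  is_wiener_integral P (noise B m.+1) (integrand m.+1 t) t Z.
Proof.
move=> t0 mZ Zae; split; [by case: mZ|by case: mZ|].
pose n : R := m.+1%:R; have n1 : 1 <= n by rewrite ler1n.
pose DC l N w := gs (cos_kernel n t) (X l) t N w - conv n (cos (n ^+ 3 * t)) (sin (n ^+ 3 * t)) (X l) t w.
pose DS l N w := gs (sin_kernel n t) (X l) t N w - conv n (sin (n ^+ 3 * t)) (- cos (n ^+ 3 * t)) (X l) t w.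
pose c := 8 * ((4 * n ^+ 3) ^+ 2 * t ^+ 3).
have hC l N : (0 < l)%N -> sqi P (DC l N) /\ nrm P (DC l N) ^+ 2 <= c / N.+1%:R ^+ 2.
  by move=> l0; exact: (conv_riemann n1 N (gX l0) t0 (cos_max _) (sin_max _)).
have hS l N : (0 < l)%N -> sqi P (DS l N) /\ nrm P (DS l N) ^+ 2 <= c / N.+1%:R ^+ 2.
  by move=> l0; exact: (conv_riemann n1 N (gX l0) t0 (sin_max _) (nsin_max _)).
pose q := n * phi m.+1.
pose r N w := - q * (DC m.*2.+1 N w + 1 * DS m.*2.+2 N w).
pose i N w := q * (DC m.*2.+2 N w + (-1) * DS m.*2.+1 N w).
have c0 : 0 <= c by rewrite /c; posi; rewrite (le_trans ler01).
have arith (a x y z : R) : x <= z -> y <= z -> a ^+ 2 * (2 * (x + y)) <= a ^+ 2 * (2 * (z + z)).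
  by move=> xz yz; rewrite ler_wpM2l ?sqr_ge0// ler_wpM2l// lerD.
pose K := 8 * q ^+ 2 * c.
have hr N : sqi P (r N) /\ nrm P (r N) ^+ 2 <= q ^+ 2 * (2 * (c / N.+1%:R ^+ 2 + c / N.+1%:R ^+ 2)).
  have [s1 b1] := hC m.*2.+1 N (ltn0Sn _); have [s2 b2] := hS m.*2.+2 N (ltn0Sn _).
  have [s3 b3] := nrm_comb (- q) s1 s2 (normr1 R); split => //; apply: le_trans b3 _.
  by rewrite sqrrN; exact: arith.
have hi N : sqi P (i N) /\ nrm P (i N) ^+ 2 <= q ^+ 2 * (2 * (c / N.+1%:R ^+ 2 + c / N.+1%:R ^+ 2)).
  have [s1 b1] := hC m.*2.+2 N (ltn0Sn _); have [s2 b2] := hS m.*2.+1 N (ltn0Sn _).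
  have [s3 b3] := nrm_comb q s1 s2 (normrN1 R); split => //; apply: le_trans b3 _.
  exact: arith.
have mB (s : R) : 0 <= s -> cmfun (noise B m.+1 s) by exact: noise_meas hF hB _ _.
have mN N := normc2_meas (cmfunB (riemann_sum_cmfun (integrand m.+1 t) N t0 mB) mZ).
have mri N : measurable_fun [set: Omega] (fun w => (r N w ^+ 2)%:E + (i N w ^+ 2)%:E)%E.
  by apply: emeasurable_funD; apply/measurable_EFinP; apply: measurable_funX; [case: (hr N) => -[]|case: (hi N) => -[]].
have E N : (\int[P]_w (normc2 (riemann_sum (noise B m.+1) (integrand m.+1 t) t N w - Z w))%:E =
    \int[P]_w ((r N w ^+ 2)%:E + (i N w ^+ 2)%:E))%E.
  apply: ge0_ae_eq_integral => //.
  - by move=> w _; rewrite lee_fin normc2_ge0.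
  - by move=> w _; rewrite -EFinD lee_fin addr_ge0 ?sqr_ge0.
  apply: (@filterS2 _ _ (ae_filter_ringOfSetsType P)) Xsrc Zae => w hX hZ _.
  rewrite -EFinD; congr EFin; rewrite hZ (riemann_sum_gs _ _ _ t0).
  have gE k l : (0 < l)%N -> gs k (noise_part l) t N w = gs k (X l) t N w.
    by move=> l0; apply: eq_bigr => j _; rewrite !hX//; exact: grid_ge0.
  pose c1 l := conv n (cos (n ^+ 3 * t)) (sin (n ^+ 3 * t)) (X l) t w.
  pose c2 l := conv n (sin (n ^+ 3 * t)) (- cos (n ^+ 3 * t)) (X l) t w.
  have EZ : cpx (fun k => conv_coord phi X k t w) m.+1 =
      (- q * (c1 m.*2.+1 + 1 * c2 m.*2.+2)) +i* (q * (c1 m.*2.+2 + (-1) * c2 m.*2.+1)).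
    have [a1 a2] := nc1_amp m; rewrite /cpx /conv_coord /cos_conv /sin_conv [nc1 R * _]mulrA a1 [nc1 R * _]mulrA a2.
    have [-> ->] := frP R m; have [-> ->] := partnerP m; have [-> ->] := sgP R m.
    by congr (_ +i* _); last by rewrite [X in - X = _]mulNr opprK.
  rewrite !gE// EZ /normc2 /=.
  rewrite -/n -/q /r /i /DC /DS -/(c1 _) -/(c1 _) -/(c2 _) -/(c2 _); ring.
have bnd N : (\int[P]_w ((r N w ^+ 2)%:E + (i N w ^+ 2)%:E) <= (K / N.+1%:R ^+ 2)%:E)%E.
  have [sr br] := hr N; have [si bi] := hi N.
  rewrite ge0_integralD//; last 4 first.
  - by move=> w _; rewrite lee_fin sqr_ge0.
  - by apply/measurable_EFinP; apply: measurable_funX; case: sr.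
  - by move=> w _; rewrite lee_fin sqr_ge0.
  - by apply/measurable_EFinP; apply: measurable_funX; case: si.
  rewrite !ip_intE// -EFinD lee_fin -!nrm2.
  rewrite (_ : K / _ = q ^+ 2 * (2 * (c / N.+1%:R ^+ 2 + c / N.+1%:R ^+ 2)) + q ^+ 2 * (2 * (c / N.+1%:R ^+ 2 + c / N.+1%:R ^+ 2))); last by rewrite /K; ring.
  exact: lerD br bi.
have hK : (fun N => (K / N.+1%:R ^+ 2)%:E) @ \oo --> 0%E.
  apply: cvg_EFin; first exact: nearW.
  have h0 : (fun N => N.+1%:R^-1) @ \oo --> (0 : R) by exact: cvg_harmonic.
  have : (fun N => K * N.+1%:R^-1 ^+ 2) @ \oo --> K * (0 : R) ^+ 2.
    by apply: cvgM; [exact: cvg_cst|exact: cvg_sqr].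
  rewrite expr0n /= mulr0 => h2.
  have -> : fine \o (fun N => (K / N.+1%:R ^+ 2)%:E) = fun N => K * N.+1%:R^-1 ^+ 2; last exact: h2.
  by apply/funext => N /=; rewrite exprVn.
apply: (@squeeze_cvge _ _ _ _ (cst 0%E) _ (fun N => (K / N.+1%:R ^+ 2)%:E)) => //; last exact: cvg_cst.
apply: nearW => N; apply/andP; split; first by apply: integral_ge0 => w _; rewrite lee_fin normc2_ge0.
by have := bnd N; rewrite -E.
Qed.

Variable T : R.
Hypothesis T0 : 0 < T.

(** On the null set where [conv_coord_ae_bound] fails the convolution is replaced by zero, so that the
    path is continuous for every outcome. *)
Lemma convolution_ex : exists Z : R -> Omega -> R -> R,
  [/\ stochastic_convolution P phi B T Z, forall w, tcont (fun t => Z t w), forall t, cmeas (Z t),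
   forall w t, ip mu (Z t w) (trig 0) = 0 &
   forall w, exists M, (forall t, nrm mu (Z t w) <= M) /\ forall N t, 0 <= t <= T ->
    \sum_(k < N) fr R k ^+ 2 * pint (fun s => ip mu (Z s w) (trig k) ^+ 2) t <= M].
Proof.
have T00 := ltW T0.
have [N0 [mN0 PN0 sub]] := conv_coord_ae_bound hphi gX T0.
have czk k w : continuous (fun s => conv_coord phi X k s w) by exact: conv_coord_cts gX _ _.
pose i w : R := \1_(~` N0) w.
have mi : measurable_fun [set: Omega] i by apply: measurable_indic; exact: measurableC.
pose c w t k := i w * conv_coord phi X k (clamp T t) w.
pose Z t w := synth (c w t).
have good w : exists (b : nat -> R) (M : R), [/\ forall N, \sum_(k < N) b k <= M, forall t k, c w t k ^+ 2 <= b k,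
    0 <= M & forall N t, 0 <= t <= T -> \sum_(k < N) fr R k ^+ 2 * pint (fun s => c w s k ^+ 2) t <= M].
  have [Nw|nNw] := pselect (N0 w).
    have i0 : i w = 0 by rewrite /i indicE memNset//= => /(_ Nw).
    have c0 t k : c w t k = 0 by rewrite /c i0 mul0r.
    exists (fun=> 0), 0; split => //.
    - by move=> N; rewrite big1.
    - by move=> t k; rewrite c0 expr0n.
    - move=> N t tT; rewrite big1// => k _; under [X in pint X]eq_fun do rewrite c0 expr0n /=.
      by rewrite /pint /Rintegral integral0 mulr0.
  have i1 : i w = 1 by rewrite /i indicE mem_set.
  have [b [M [h1 h2 h3]]] : exists (b : nat -> R) (M : R),
      [/\ forall N, \sum_(k < N) b k <= M,
          forall t k, 0 <= t <= T -> conv_coord phi X k t w ^+ 2 <= b k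
        & forall N, \sum_(k < N) fr R k ^+ 2 * pint (fun s => conv_coord phi X k s w ^+ 2) T <= M].
    by apply: contrapT => h; apply: nNw; exact: sub.
  have cz k : continuous (fun s => conv_coord phi X k s w ^+ 2).
    by move=> s; apply: cvg_sqr; exact: czk.
  exists b, M; split => //.
  - by move=> t k; rewrite /c i1 mul1r h2// clampP.
  - by have := h3 0%N; rewrite big_ord0.
  - move=> N t /andP[t0 tT]; apply: le_trans (h3 N); apply: ler_sum => k _.
    rewrite ler_wpM2l ?sqr_ge0// (_ : pint _ t = pint (fun s => conv_coord phi X k s w ^+ 2) t).
      by apply: pint_mono => // s; exact: sqr_ge0.
    by apply: pint_eq => s /andP[s0 st]; rewrite /c i1 mul1r clamp_id// s0 (le_trans st).
have ts w : tcont (fun t => Z t w) /\ forall t k, ip mu (Z t w) (trig k) = c w t k.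
  have [b [M [h1 h2 h3 h4]]] := good w.
  apply: tcont_synth => [k|r]; last by exists b; split; [exists M|].
  move=> t; apply: cvgM; first exact: cvg_cst.
  exact: (@continuous_comp R R R (clamp T) (fun s => conv_coord phi X k s w) t (@cts_clamp R T t) (@czk k w _)).
have tZ w : tcont (fun t => Z t w) by case: (ts w).
have cE w t k : ip mu (Z t w) (trig k) = c w t k by case: (ts w).
have mZ t : cmeas (Z t).
  split => [w|k]; first by have [s _] := tZ w; exact: s.
  under eq_fun do rewrite cE; apply: measurable_funM => //; apply: (conv_coord_meas phi gX).
  by have /andP[] := clampP t T00.
have Z0 w t : ip mu (Z t w) (trig 0) = 0 by rewrite cE /c mulr0.
exists Z; split => //; last first.
  move=> w; have [b [M [h1 h2 h3 h4]]] := good w; exists (M + 1); split => [t|N t tT].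
    have [sZ _] := tZ w; have M1 : 0 <= M + 1 by rewrite addr_ge0.
    rewrite -ler_sqr ?nnegrE ?nrm_ge0//; apply: (@le_trans _ _ M).
      apply: nrm_le_trig; first exact: sZ.
      by move=> N; under eq_bigr do rewrite cE; apply: le_trans (h1 N); apply: ler_sum => k _; exact: h2.
    by have := sqr_ge0 M; lra.
  under eq_bigr do under [X in pint X]eq_fun do rewrite cE.
  by apply: le_trans (h4 N t tT) _; rewrite lerDl.
have fE t w n : fourier (Z t w) n = cpx (c w t) n.
  rewrite fourier_cpx; last by have [s _] := tZ w; exact: s.
  by congr (cpx _ n); apply/funext.
have mcpx t n : cmfun (fun w => fourier (Z t w) n).
  have mc k : measurable_fun [set: Omega] (fun w => c w t k).
    by case: (mZ t) => _ h; under eq_fun do rewrite -cE; exact: h.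
  split; under eq_fun do rewrite fE; case: n => [[|m]|m] /=.
  - exact: measurable_funM.
  - exact: measurable_funM.
  - exact: measurable_funM.
  - exact: measurable_cst.
  - by apply: measurable_funN; exact: measurable_funM.
  - exact: measurable_funM.
have Pos (m : nat) t : 0 <= t <= T ->
    is_wiener_integral P (noise B m.+1) (integrand m.+1 t) t (fun w => fourier (Z t w) m.+1).
  move=> tT; have /andP[t0 _] := tT; apply: wiener_pos => //.
  exists N0; split => // w /= h; apply: contrapT => nNw; apply: h.
  have i1 : i w = 1 by rewrite /i indicE mem_set.
  have ck : c w t = fun k => conv_coord phi X k t w by apply/funext => k; rewrite /c i1 mul1r clamp_id.
  by rewrite fE ck.
split.
  apply: (@tcont_CL20 R d Omega T) => [w|t _|t w _]; [|exact: mZ|exact: Z0].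
  by exists (fun t => Z t w).
move=> t n tT; have /andP[t0 _] := tT.
case: n => [[|m]|m]; [|exact: Pos|].
  split; [by case: (mcpx t 0)|by case: (mcpx t 0)|].
  suff -> : (fun m => \int[P]_w (normc2 (riemann_sum (noise B 0) (integrand 0 t) t m w - fourier (Z t w) 0))%:E)%E
    = cst 0%E by exact: cvg_cst.
  apply/funext => m; rewrite /= -[RHS](integral0 P setT); apply: eq_integral => w _.
  rewrite /riemann_sum big1; last by move=> k _; rewrite /noise subrr mulr0.
  by rewrite fE /cpx /c /= !mulr0 /normc2 /= subrr expr0n addr0.
apply: (wiener_conj (Pos m t tT)) => [s w|s|w] //; first exact: integrandN.
by rewrite !fE /cpx /= opprK.
Qed.

End StochasticConvolution.

(** * Well-posedness *)

Lemma cts_rat0 (R : realType) (g : R -> R) : continuous g ->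
  (forall i j : nat, g (i%:R / j.+1%:R) = 0) -> forall t, 0 <= t -> g t = 0.
Proof.
move=> cg g0 t t0.
pose r (j : nat) : R := (Num.truncn (t * j.+1%:R))%:R / j.+1%:R.
have rt : r @ \oo --> t.
  have h : (fun j => j.+1%:R^-1) @ \oo --> (0 : R) by exact: cvg_harmonic.
  apply: cvg_bound h _ => j; have j0 : 0 < j.+1%:R :> R by rewrite ltr0n.
  have x0 : 0 <= t * j.+1%:R by rewrite mulr_ge0.
  have := truncn_le (t * j.+1%:R); rewrite x0 => h1.
  have h2 := truncnS_gt (t * j.+1%:R).
  have -> : r j - t = ((Num.truncn (t * j.+1%:R))%:R - t * j.+1%:R) / j.+1%:R.
    by rewrite /r mulrBl mulfK// gt_eqF.
  rewrite normrM (ger0_norm (x := _^-1)) ?invr_ge0 ?(ltW j0)//.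
  rewrite ler_piMl ?invr_ge0 ?(ltW j0)// ler_norml.
  move: h1 h2; set y := t * _; set m := Num.truncn y; rewrite -natr1 => h1 h2.
  by apply/andP; split; lra.
have h : (g \o r) @ \oo --> g t by apply: continuous_cvg rt; exact: cg.
apply: (cvg_unique (@Rhausdorff R) h).
by rewrite (_ : g \o r = cst 0); [exact: cvg_cst|apply/funext => j /=; exact: g0].
Qed.

Lemma sgrp_0 (R : realType) (t : R) a : sgrp t a 0 = a 0%N.
Proof. by rewrite /sgrp fr0 !expr0n /= !mul0r oppr0 expR0 cos0 sin0 mulr0 mul0r addr0 !mul1r. Qed.

Lemma duhamel_0 (R : realType) (f : R -> nat -> R) t : duhamel f t 0 = 0.
Proof.
rewrite /duhamel (_ : (fun s => _) = fun=> 0).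
  by rewrite /pint /Rintegral integral0.
by apply/funext => s; rewrite sgrp_0 /ddxc fr0 mulr0 mul0r.
Qed.

Lemma eq_cRintegral (R : realType) dX (X : measurableType dX) (mu : {measure set X -> \bar R})
    (D : set X) (f g : X -> R[i]) : (forall x, x \in D -> f x = g x) ->
  cRintegral mu D f = cRintegral mu D g.
Proof.
by move=> fg; rewrite /cRintegral; congr (_ +i* _); apply: eq_Rintegral => x xD; rewrite fg.
Qed.

Section MildSolutions.
Context (R : realType) (d : measure_display) (Omega : measurableType d) (P : probability Omega R).
Variables (F : R -> set (set Omega)) (B : nat -> R -> Omega -> R[i]).
Hypotheses (hF : filtration F) (hB : independent_complex_brownians P F B).
Variables (phi : int -> R) (T : R).
Hypothesis T_ge0 : 0 <= T.
Notation mu := (torus R).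
Implicit Types (u v Z : R -> Omega -> R -> R).

(** Almost surely the coordinates agree at all times of a countable dense set, hence at all times
    by continuity. *)
Lemma convolution_unique Z Z' : stochastic_convolution P phi B T Z ->
  stochastic_convolution P phi B T Z' ->
  {ae P, forall w, forall t k, 0 <= t <= T -> ip mu (Z t w) (trig k) = ip mu (Z' t w) (trig k)}.
Proof.
move=> [cZ hZ] [cZ' hZ'].
(* countably many times, dense in [[0, T]] *)
pose q (i j : nat) : R := clamp T (i%:R / j.+1%:R).
have qT i j : 0 <= q i j <= T by exact: clampP.
have ae1 i j n : {ae P, forall w, fourier (Z (q i j) w) n = fourier (Z' (q i j) w) n}.
  have /andP[q0 _] := qT i j.
  apply: (wiener_uniq q0 _ (hZ _ n (qT i j)) (hZ' _ n (qT i j))) => s s0.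
  exact: (noise_meas hF hB _ s0).
have ae2 : {ae P, forall w, forall i j n, fourier (Z (q i j) w) n = fourier (Z' (q i j) w) n}.
  apply: ae_foralln => i; apply: ae_foralln => j.
  have h1 : {ae P, forall w, forall m : nat, fourier (Z (q i j) w) m = fourier (Z' (q i j) w) m}.
    by apply: ae_foralln => m; exact: ae1.
  have h2 : {ae P, forall w, forall m : nat, fourier (Z (q i j) w) (Negz m) = fourier (Z' (q i j) w) (Negz m)}.
    by apply: ae_foralln => m; exact: ae1.
  by apply: (@filterS2 _ _ (ae_filter_ringOfSetsType P)) h1 h2 => w g1 g2 [m|m].
apply: (@filterS _ _ (ae_filter_ringOfSetsType P)) ae2 => w hw t k tT.
have tZ := CL20_tcont w T_ge0 cZ; have tZ' := CL20_tcont w T_ge0 cZ'.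
have sk := sqi_trig R k.
have c1 := tcont_ip tZ sk; have c2 := tcont_ip tZ' sk.
pose g s := ip mu (Z (clamp T s) w) (trig k) - ip mu (Z' (clamp T s) w) (trig k).
have cg : continuous g by move=> s; apply: cvgB; [exact: c1|exact: c2].
have g0 i j : g (i%:R / j.+1%:R) = 0.
  rewrite /g -/(q i j); apply/eqP; rewrite subr_eq0; apply/eqP.
  have [s1 _] := tZ; have [s2 _] := tZ'.
  apply: (@cpx_inj R (fun k => ip mu (Z (q i j) w) (trig k)) (fun k => ip mu (Z' (q i j) w) (trig k))) => n.
  by rewrite -(fourier_cpx n (s1 (i%:R / j.+1%:R))) -(fourier_cpx n (s2 (i%:R / j.+1%:R))); exact: hw.
have /andP[t0 _] := tT; have := cts_rat0 cg g0 t0.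
by rewrite /g clamp_id// => /eqP; rewrite subr_eq0 => /eqP.
Qed.

Variables (u0 : R -> R).
Hypothesis hu0 : sqi mu u0.

Lemma mild_path u Z w : CL20_process T u -> CL20_process T Z ->
  (forall t, 0 <= t <= T -> forall n, fourier (u t w) n = semigroup t (fourier u0) n
     - cRintegral (@lebesgue_measure R) `[0, t]
         (fun s => semigroup (t - s) (ddx (fourier (fun x => u s w x ^+ 2))) n)
     + fourier (Z t w) n) ->
  forall t k, 0 <= t <= T -> ip mu (u t w) (trig k) - duhamel (fun s j => quad j (u (clamp T s) w)) t k =
    sgrp t (fun k => ip mu u0 (trig k)) k + ip mu (Z t w) (trig k).
Proof.
move=> cu cZ h t k tT; have /andP[t0 tT'] := tT.
have tu := CL20_tcont w T_ge0 cu; have [sZ _] := CL20_tcont w T_ge0 cZ.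
have sZt : sqi mu (Z t w) by have := sZ t; rewrite clamp_id.
have [E _] := mild_cpx tu hu0 sZt t0.
suff H : forall n, fourier (u (clamp T t) w) n = semigroup t (fourier u0) n
     - cRintegral (@lebesgue_measure R) `[0, t]
         (fun s => semigroup (t - s) (ddx (fourier (fun x => u (clamp T s) w x ^+ 2))) n)
     + fourier (Z t w) n.
  have := E H k; rewrite clamp_id// => ->; ring.
move=> n; rewrite (clamp_id tT) (h t tT).
have -> : cRintegral (@lebesgue_measure R) `[0, t]
    (fun s => semigroup (t - s) (ddx (fourier (fun x => u (clamp T s) w x ^+ 2))) n) =
  cRintegral (@lebesgue_measure R) `[0, t]
    (fun s => semigroup (t - s) (ddx (fourier (fun x => u s w x ^+ 2))) n); last by [].
have cs s : s \in `[0, t]%classic -> clamp T s = s.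
  by rewrite inE /= in_itv /= => /andP[r0 st]; apply: clamp_id; rewrite r0 (le_trans st tT').
by apply: eq_cRintegral => s /cs E2; rewrite E2.
Qed.

(** The noises of the two solutions agree almost surely by [convolution_unique], and then
    [duhamel_uniq] applies to each pair of paths. *)
Lemma mild_unique u v : mild_solution P phi B T u0 u -> mild_solution P phi B T u0 v ->
  indistinguishable P T u v.
Proof.
move=> [cu [Z hZ eu]] [cv [Z' hZ' ev]].
have [cZ _] := hZ; have [cZ' _] := hZ'.
apply: (@filterS3 _ _ (ae_filter_ringOfSetsType P)) eu ev (convolution_unique hZ hZ') => w hu hv hw t tT.
have tu := CL20_tcont w T_ge0 cu; have tv := CL20_tcont w T_ge0 cv.
have := duhamel_uniq T_ge0 tu tv _ tT; rewrite clamp_id//; apply => s k sT.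
have hu' := mild_path cu cZ hu k sT; have hv' := mild_path cv cZ' hv k sT.
by rewrite (clamp_id sT) hu' hv' (hw s k sT).
Qed.

End MildSolutions.

Theorem theorem1p2 (R : realType) (d : measure_display)
    (Omega : measurableType d) (P : probability Omega R)
    (F : R -> set (set Omega)) (hF : filtration F)
    (B : nat -> R -> Omega -> R[i])
    (hB : independent_complex_brownians P F B)
    (phi : int -> R) (phi_even : forall n, phi (- n) = phi n)
    (hphi : hilbert_schmidt_L2_H1 phi)
    (u0 : R -> R) (hu0 : L20 u0) (T : R) (T_gt0 : 0 < T) :
  exists u : R -> Omega -> R -> R,
    mild_solution P phi B T u0 u /\
    forall v : R -> Omega -> R -> R,
      mild_solution P phi B T u0 v -> indistinguishable P T u v.
Proof.
have T0 := ltW T_gt0; have /L20P[s0 u00] := hu0.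
have [X [gX Xsrc]] := noise_mod hF hB.
have [Z [hZ tZ mZ Z0 ZM]] := convolution_ex hF hB phi_even hphi gX Xsrc T_gt0.
have [M hM] := choice ZM.
pose a0 k := ip (torus R) u0 (trig k).
have a0M N : \sum_(k < N) a0 k ^+ 2 <= nrm (torus R) u0 ^+ 2 by exact: bessel_trig.
have [V [tV mV eV]] := @mild_coords R d Omega a0 _ T (fun w t => Z t w) M M T0 a0M tZ mZ
  (fun w => (hM w).1) Z0 (fun w => (hM w).2).
pose u t w : R -> R := fun x => V w t x + Z t w x.
have tu w : tcont (fun t => u t w) by exact: tcontD (tV w) (tZ w).
have sV w t : sqi (torus R) (V w t) by have [s _] := tV w; exact: s.
have sZ w t : sqi (torus R) (Z t w) by have [s _] := tZ w; exact: s.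
have cE w t k : 0 <= t <= T -> ip (torus R) (u t w) (trig k) =
    sgrp t a0 k + duhamel (fun s j => quad j (u s w)) t k + ip (torus R) (Z t w) (trig k).
  by move=> tT; rewrite ipDl ?eV//; exact: sqi_trig.
have hu : mild_solution P phi B T u0 u.
  split.
    apply: tcont_CL20 => [w|t tT|t w tT].
    - by exists (fun t => u t w).
    - by apply: cmeasD; [exact: mV|exact: mZ].
    - rewrite cE// Z0 sgrp_0 duhamel_0 /a0 u00 !addr0.
      by [].
  exists Z => //; apply: (@filterE _ _ (ae_filter_ringOfSetsType P)) => w t tT n.
  have /andP[t0 _] := tT; have [_ E] := mild_cpx (tu w) s0 (sZ w t) t0.
  by apply: E => k; exact: cE.
exists u; split => // v hv; exact: (mild_unique hF hB T0 s0 hu hv).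
Qed.
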